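(* Let $G$ be a unimodular totally disconnected locally compact group acting on a $d$-dimensional abstract simplicial complex $\Sigma$ with compact open stabilisers. For every $0\le k\leq d$ let $\Omega_k$ be a set of representatives of the $G$-orbits on the $k$-dimensional simplices of $\Sigma$, and suppose $|\Omega_k|<\infty$ for all $k$. If $\Sigma$ is contractible (i.e. its geometric realization is contractible), then $$\tilde\chi_G=\sum_{0\leq k\leq d}(-1)^k\Big(\sum_{\omega\in\Omega_k}1\cdot\mu_{G_{\pm\omega}}\Big),$$ where $G_{\pm\omega}=\mathrm{stab}_G(\{\underline\omega,-\underline\omega\})$.
   Context: For a $k$-simplex $\omega=\{x_0,\dots,x_k\}$ put $\underline\omega=x_0\wedge\cdots\wedge x_k\in\Lambda_{k+1}(\mathbb{Q}[\Sigma_0])$ (exterior power of the $\mathbb{Q}$-vector space on the vertex set $\Sigma_0$), which is determined by $\omega$ up to sign; $G$ acts on the exterior power through its action on $\Sigma_0$, and $G_{\pm\omega}$ is the stabiliser of the set $\{\underline\omega,-\underline\omega\}$. Let $G$ be a unimodular totally disconnected locally compact (t.d.l.c.) group and let $\mathcal{CO}(G)$ be the set of its compact open subgroups. For $U,V\in\mathcal{CO}(G)$ put $|U:V|=|U:U\cap V|/|V:U\cap V|\in\mathbb{Q}^+$. For $U\in\mathcal{CO}(G)$ let $\mu_U$ be the Haar measure of $G$ with $\mu_U(U)=1$. Put $\mathbf{h}_G=\mathbb{Q}\cdot\mu_{U}$, a one-dimensional $\mathbb{Q}$-vector space independent of $U$. A left $\mathbb{Q}[G]$-module $M$ is discrete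 if the stabilizer $G_m$ of every $m\in M$ is open in $G$. Discrete left $\mathbb{Q}[G]$-modules form a full abelian subcategory ${}_{\mathbb{Q}[G]}\mathbf{dis}$ of all left $\mathbb{Q}[G]$-modules; ''projective'' means projective in this category. A discrete module is finitely generated if it is a quotient of $\bigoplus_{i=1}^n\mathbb{Q}[G/U_i]$ for some $U_1,\dots,U_n\in\mathcal{CO}(G)$. Standard bimodule: $\mathrm{Bi}(G)=\varinjlim_{U\in\mathcal{CO}(G)}\mathbb{Q}[G/U]$, where for $V\subseteq U$ the transition map is $gU\mapsto |U:V|^{-1}\sum_{r}grV$ ($r$ over representatives of the cosets $rV$ in $U$). It is a discrete left $\mathbb{Q}[G]$-module and a right $\mathbb{Q}[G]$-module via $(xU)\cdot g=xgU^g$, $U^g=g^{-1}Ug$. For every discrete left module $M$ there is an isomorphism $\theta_M\colon\mathrm{Bi}(G)\otimes_{\mathbb{Q}[G]}M\to M$, $\theta_M(gU\otimes m)=|U:U\cap G_m|^{-1}\sum_{r}gr\cdot m$ ($r$ over representatives of left cosets of $U\cap G_m$ in $U$). Trace: for fixed $\mathcal{O}\in\mathcal{CO}(G)$ let $\psi^{(\mathcal{O})}\colon\mathrm{Bi}(G)\to C_c(G,\mathbb{Q})$ be the $\mathbb{Q}$-linear map with $\psi^{(\mathcal{O})}(gU)=|\mathcal{O}:U|\cdot I_{gU}$ ($I_{gU}$ the characteristic function), and $\mathrm{tr}(x)=\psi^{(\mathcal{O})}(x)(1)\cdot\mu_{\mathcal{O}}\in\mathbf{h}_G$, which is independent of $\mathcal{O}$.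 Hattori--Stallings rank: for a finitely generated projective discrete left $\mathbb{Q}[G]$-module $P$, $\mathrm{Hom}_G(P,\mathrm{Bi}(G))$ is a right $\mathbb{Q}[G]$-module via $(\phi\cdot g)(p)=\phi(p)\cdot g$, and there is an isomorphism $\xi_{P,P}\colon\mathrm{Hom}_G(P,\mathrm{Bi}(G))\otimes_{\mathbb{Q}[G]}P\to\mathrm{Hom}_G(P,P)$, $\xi_{P,P}(\phi\otimes p)(p')=\theta_P(\phi(p')\otimes p)$. Writing $\xi_{P,P}^{-1}(\mathrm{id}_P)=\sum_i\phi_i\otimes p_i$, one sets $\tilde\rho(P)=\sum_i\mathrm{tr}(\phi_i(p_i))\in\mathbf{h}_G$. Euler--Poincaré characteristic: $G$ is of type FP if the trivial module $\mathbb{Q}$ has a finite-length resolution $0\to P_n\to\cdots\to P_0\to\mathbb{Q}\to0$ in ${}_{\mathbb{Q}[G]}\mathbf{dis}$ by finitely generated projectives; then $\tilde\chi_G=\sum_{k}(-1)^k\tilde\rho(P_k)\in\mathbf{h}_G$ (independent of the resolution). An equality for $\tilde\chi_G$ is understood to include that $\tilde\chi_G$ is defined. *)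

(* Defs.v *)
From HB Require Import structures.
From mathcomp Require Import all_boot all_order all_algebra.
From mathcomp Require Import generic_quotient ring_quotient finmap monalg.
From mathcomp Require Import all_classical all_reals all_analysis.

Set Implicit Arguments.
Unset Strict Implicit.
Unset Printing Implicit Defensive.

Import Order.TTheory GRing.Theory Num.Theory.
Import numFieldNormedType.Exports.

Local Open Scope classical_set_scope.
Local Open Scope ring_scope.
Local Open Scope quotient_scope.

HB.mixin Record isTopGroup G of Group G & Topological G := {
  mulg_continuous : continuous (fun x : G * G => (x.1 * x.2)%g);
  invg_continuous : continuous (fun x : G => (x^-1)%g) }.

#[short(type="topGroupType")]
HB.structure Definition TopGroup :=
  {G of Group G & Topological G & isTopGroup G}.

Definition tdlc (G : topGroupType) : Prop :=
  [/\ hausdorff_space G, locally_compact [set: G] &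
      totally_disconnected [set: G]].

Definition is_subgroup (G : groupType) (U : set G) : Prop :=
  U 1%g /\ forall x y, U x -> U y -> U (x * y^-1)%g.

Definition CO (G : topGroupType) : set (set G) :=
  [set U | [/\ is_subgroup U, compact U & open U]].

Arguments CO G : clear implicits.

Definition ltrans (G : groupType) (g : G) (A : set G) : set G :=
  [set (g * x)%g | x in A].

Definition rtrans (G : groupType) (A : set G) (g : G) : set G :=
  [set (x * g)%g | x in A].

(* The cosets r V with r in U. *)
Definition cosets_in (G : groupType) (U V : set G) : set (set G) :=
  [set ltrans r V | r in U].

(* |U : V| for V <= U of finite index. *)
Definition cindex (G : groupType) (U V : set G) : nat :=
  #|` fset_set (cosets_in U V)|.

(* |U : V| for commensurable U and V. *)
Definition gindex (G : groupType) (U V : set G) : rat :=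
  (cindex U (U `&` V))%:R / (cindex V (U `&` V))%:R.

(* Measurable types are pointed, hence this pointed copy of G. *)
Definition pointed_group (G : topGroupType) : Type := G.
HB.instance Definition _ (G : topGroupType) :=
  Topological.on (pointed_group G).
HB.instance Definition _ (G : topGroupType) :=
  isPointed.Build (pointed_group G) (1%g : G).

Definition borel (G : topGroupType) :=
  g_sigma_algebraType (@open (pointed_group G)).

Record left_haar (R : realType) (G : topGroupType)
    (mu : {measure set (borel G) -> \bar R}) : Prop := LeftHaar {
  haar_ltrans : forall (g : G) (A : set (borel G)), measurable A ->
    mu (@ltrans G g A) = mu A;
  haar_compact : forall K : set G, compact K -> (mu K < +oo)%E;
  haar_outer : forall A : set (borel G), measurable A ->
    mu A = ereal_inf [set mu O | O in [set O : set G | open O /\ A `<=` O]];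
  haar_inner : forall O : set G, open O ->
    mu O = ereal_sup [set mu K | K in [set K : set G | compact K /\ K `<=` O]];
  haar_neq0 : mu setT <> 0%E }.

Definition unimodular (R : realType) (G : topGroupType) : Prop :=
  forall mu : {measure set (borel G) -> \bar R}, left_haar mu ->
  forall (A : set (borel G)) (g : G), measurable A ->
  mu (@rtrans G A g) = mu A.

(* The space in which the multiples of Haar measures are added: h_G is the
   rational line spanned by [haar_vec mu].  A Haar measure is recorded by its
   values on the Borel sets of finite measure; those of infinite measure, which
   are the same for all Haar measures, are sent to 0 by [fine]. *)
Definition haar_space (R : realType) (G : topGroupType) : lmodType R :=
  (measurable : set (set (borel G))) -> R^o.

Definition haar_vec (R : realType) (G : topGroupType)
    (mu : {measure set (borel G) -> \bar R}) : haar_space R G :=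
  fun A => fine (mu (val A)).

HB.mixin Record isGSet (G : groupType) Y := {
  gact : G -> Y -> Y;
  gact1 : forall y, gact 1%g y = y;
  gactM : forall g h y, gact (g * h)%g y = gact g (gact h y) }.

#[short(type="gSetType")]
HB.structure Definition GSet (G : groupType) := {Y of Choice Y & isGSet G Y}.

HB.mixin Record isGMod (G : groupType) M of GSet G M & GRing.Lmodule rat M := {
  gact_linear : forall g : G, linear (gact g : M -> M) }.

#[short(type="gModType")]
HB.structure Definition GMod (G : groupType) :=
  {M of GSet G M & GRing.Lmodule rat M & isGMod G M}.

HB.mixin Record isDiscrete (G : topGroupType) M of GSet G M := {
  stab_open : forall m : M, open [set g : G | gact g m = m] }.

#[short(type="disModType")]
HB.structure Definition DisMod (G : topGroupType) :=
  {M of GMod G M & isDiscrete G M}.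

Arguments gact {G s} g y.

HB.instance Definition _ (G : groupType) (M : gModType G) (g : G) :=
  GRing.isLinear.Build rat M M _ (gact g) (gact_linear g).

Section GModTheory.
Variables (G : groupType) (M : gModType G) (g : G).
Implicit Types x y : M.

Lemma gactD x y : gact g (x + y) = gact g x + gact g y.
Proof. exact: linearD. Qed.

Lemma gactB x y : gact g (x - y) = gact g x - gact g y.
Proof. exact: linearB. Qed.

Lemma gactZ a x : gact g (a *: x) = a *: gact g x.
Proof. exact: linearZ. Qed.

Lemma gact_sum (I : Type) (s : seq I) (F : I -> M) :
  gact g (\sum_(i <- s) F i) = \sum_(i <- s) gact g (F i).
Proof. exact: linear_sum. Qed.

End GModTheory.

Record ghom (G : groupType) (M N : gModType G) := GHom {
  ghom_fun :> M -> N;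
  ghom_linear : linear ghom_fun;
  ghom_act : forall g x, ghom_fun (gact g x) = gact g (ghom_fun x) }.

Definition onto (X Y : Type) (f : X -> Y) : Prop := forall y, exists x, f x = y.

Definition trivQ (G : topGroupType) : Type := rat^o.
HB.instance Definition _ (G : topGroupType) :=
  GRing.Lmodule.copy (trivQ G) rat^o.
HB.instance Definition _ (G : topGroupType) :=
  isGSet.Build G (trivQ G) (fun=> erefl) (fun _ _ => fun=> erefl).

Section TrivQ.
Variable G : topGroupType.
Fact trivQ_linear (g : G) : linear (gact g : trivQ G -> trivQ G).
Proof. by []. Qed.
HB.instance Definition _ := isGMod.Build G (trivQ G) trivQ_linear.
Fact trivQ_open (m : trivQ G) : open [set g : G | gact g m = m].
Proof.
rewrite (_ : [set g | _] = setT); first exact: openT.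
by apply/seteqP; split.
Qed.
HB.instance Definition _ := isDiscrete.Build G (trivQ G) trivQ_open.
End TrivQ.

Definition delta (Y : choiceType) (y : Y) : {malg rat[Y]} := mkmalgU y 1.

(* The linear extension of h : Y -> M to the free module Q[Y]. *)
Definition malg_ext (Y : choiceType) (M : lmodType rat) (h : Y -> M)
    (x : {malg rat[Y]}) : M :=
  \sum_(y <- msupp x) x@_y *: h y.

Section MalgExt.
Variables (Y : choiceType) (M : lmodType rat).
Implicit Types (h : Y -> M) (x : {malg rat[Y]}).

Lemma malg_extw h x (d : {fset Y}) : (msupp x `<=` d)%fset ->
  malg_ext h x = \sum_(y <- d) x@_y *: h y.
Proof.
move=> xd; rewrite /malg_ext (big_fset_incl _ xd) // => y _ /mcoeff_outdom ->.
by rewrite scale0r.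
Qed.

Lemma malg_ext_linear h : linear (malg_ext h).
Proof.
move=> a x y; set d := (msupp x `|` msupp y `|` msupp (a *: x + y))%fset.
have xd : (msupp x `<=` d)%fset by rewrite /d -fsetUA fsubsetUl.
have yd : (msupp y `<=` d)%fset.
  by rewrite /d [(msupp x `|` _)%fset]fsetUC -fsetUA fsubsetUl.
rewrite (malg_extw h xd) (malg_extw h yd) (@malg_extw h _ d) ?fsubsetUr //.
rewrite scaler_sumr -big_split /=; apply: eq_bigr => z _.
by rewrite mcoeffD fgscaleE scalerDl scalerA.
Qed.

HB.instance Definition _ h := GRing.isLinear.Build rat {malg rat[Y]} M _
  (malg_ext h) (malg_ext_linear h).

Lemma malg_ext_delta h y : malg_ext h (delta y) = h y.
Proof.
rewrite (@malg_extw _ _ [fset y]%fset) ?msuppU_le //.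
by rewrite big_seq_fset1 mcoeffUU scale1r.
Qed.

Lemma malg_ind_linear (f g : {linear {malg rat[Y]} -> M}) :
  (forall y, f (delta y) = g (delta y)) -> f =1 g.
Proof.
move=> fg x; rewrite [x]monalgE !raddf_sum /=; apply: eq_bigr => y _.
have -> : mkmalgU y x@_y = x@_y *: delta y :> {malg rat[Y]}.
  by apply/malgP => z; rewrite fgscaleE !mcoeffU mulrnAr mulr1.
by rewrite !linearZ fg.
Qed.

End MalgExt.

Section PermMod.
Variables (G : groupType) (Y : gSetType G).
Implicit Types x : {malg rat[Y]}.

Definition malg_act (g : G) x : {malg rat[Y]} :=
  malg_ext (fun y => delta (gact g y)) x.

Lemma malg_act1 x : malg_act 1%g x = x.
Proof.
by apply: (malg_ind_linear (f := malg_ext _) (g := idfun)) => y;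
  rewrite /= malg_ext_delta gact1.
Qed.

Lemma malg_actM g h x : malg_act (g * h)%g x = malg_act g (malg_act h x).
Proof.
apply: (malg_ind_linear (f := malg_ext _) (g := malg_ext _ \o malg_ext _)) => y.
by rewrite /= !malg_ext_delta gactM.
Qed.

HB.instance Definition _ := isGSet.Build G {malg rat[Y]} malg_act1 malg_actM.
HB.instance Definition _ := isGMod.Build G {malg rat[Y]}
  (fun g => malg_ext_linear (fun y : Y => delta (gact g y))).

Lemma gact_delta g (y : Y) : gact g (delta y) = delta (gact g y).
Proof. exact: malg_ext_delta. Qed.

End PermMod.

Section LCoset.
Variables (G : groupType) (U : set G).

Definition lcoset : Type := [set ltrans g U | g in setT] : set (set G).
HB.instance Definition _ := Choice.on lcoset.

Fact mkcoset_subproof (g : G) :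
  ltrans g U \in ([set ltrans g U | g in setT] : set (set G)).
Proof. by apply/mem_set; exists g. Qed.

Definition mkcoset (g : G) : lcoset := exist _ (ltrans g U) (mkcoset_subproof g).

Lemma ltransM (g h : G) (A : set G) :
  ltrans (g * h)%g A = ltrans g (ltrans h A).
Proof.
by rewrite /ltrans image_comp; apply: eq_imagel => x _ /=; rewrite mulgA.
Qed.

Lemma ltrans1 (A : set G) : ltrans 1%g A = A.
Proof.
by rewrite -[RHS]image_id; apply: eq_imagel => x _ /=; rewrite mul1g.
Qed.

Fact lcoset_act_subproof (g : G) (A : lcoset) :
  ltrans g (val A) \in ([set ltrans g U | g in setT] : set (set G)).
Proof.
have /set_mem[h _ <-] := valP A; apply/mem_set; exists (g * h)%g => //.
exact: ltransM.
Qed.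

Definition lcoset_act (g : G) (A : lcoset) : lcoset :=
  exist _ (ltrans g (val A)) (lcoset_act_subproof g A).

Fact lcoset_act1 A : lcoset_act 1%g A = A.
Proof. by apply: val_inj; rewrite /= ltrans1. Qed.

Fact lcoset_actM g h A :
  lcoset_act (g * h)%g A = lcoset_act g (lcoset_act h A).
Proof. by apply: val_inj; rewrite /= ltransM. Qed.

HB.instance Definition _ := isGSet.Build G lcoset lcoset_act1 lcoset_actM.

End LCoset.

Section Coproduct.
Variables (G : groupType) (I : choiceType) (Y : I -> gSetType G).

Definition coprod : Type := {i : I & Y i}.
HB.instance Definition _ := Choice.on coprod.

Definition coprod_act (g : G) (y : coprod) : coprod :=
  Tagged (fun i => Y i : Type) (gact g (tagged y)).

Fact coprod_act1 y : coprod_act 1%g y = y.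
Proof. by case: y => i y; rewrite /coprod_act /= gact1. Qed.

Fact coprod_actM g h y :
  coprod_act (g * h)%g y = coprod_act g (coprod_act h y).
Proof. by case: y => i y; rewrite /coprod_act /= gactM. Qed.

HB.instance Definition _ := isGSet.Build G coprod coprod_act1 coprod_actM.

End Coproduct.

Section FFunGSet.
Variables (G : groupType) (I : finType) (Y : gSetType G).

Definition ffun_act (g : G) (t : {ffun I -> Y}) : {ffun I -> Y} :=
  [ffun i => gact g (t i)].

Fact ffun_act1 t : ffun_act 1%g t = t.
Proof. by apply/ffunP => i; rewrite ffunE gact1. Qed.

Fact ffun_actM g h t : ffun_act (g * h)%g t = ffun_act g (ffun_act h t).
Proof. by apply/ffunP => i; rewrite !ffunE gactM. Qed.

HB.instance Definition _ := isGSet.Build G {ffun I -> Y} ffun_act1 ffun_actM.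

End FFunGSet.

Section FSetGSet.
Variables (G : groupType) (Y : gSetType G).

Definition fset_act (g : G) (s : {fset Y}) : {fset Y} :=
  [fset gact g y | y in s]%fset.

Fact fset_act1 s : fset_act 1%g s = s.
Proof.
by apply/fsetP => y; apply/imfsetP/idP => /= [[x xs ->]|ys];
  [rewrite gact1|exists y; rewrite ?gact1].
Qed.

Fact fset_actM g h s : fset_act (g * h)%g s = fset_act g (fset_act h s).
Proof.
apply/fsetP => y; apply/imfsetP/imfsetP => /= [[x xs ->]|[_ /imfsetP[/= x xs ->] ->]].
  by exists (gact h x); [exact: in_imfset|rewrite gactM].
by exists x; rewrite ?gactM.
Qed.

HB.instance Definition _ := isGSet.Build G {fset Y} fset_act1 fset_actM.

End FSetGSet.

Section LQuot.
Variables (M : lmodType rat) (R : set M).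

Definition lspan : {pred M} := fun x => `[< exists s : seq (rat * M),
  (forall p, p \in s -> R p.2) /\ x = \sum_(p <- s) p.1 *: p.2 >].

Fact span_submod : submod_closed lspan.
Proof.
split=> [|a x y]; first by apply/asboolP; exists [::]; rewrite big_nil.
move=> /asboolP[s [sR ->]] /asboolP[t [tR ->]]; apply/asboolP.
exists ([seq (a * p.1, p.2) | p <- s] ++ t); split=> [p|].
  by rewrite mem_cat => /orP[/mapP[q qs ->]|/tR //]; exact: (sR q qs).
rewrite big_cat big_map scaler_sumr /=; congr (_ + _).
by apply: eq_bigr => p _; rewrite scalerA.
Qed.

HB.instance Definition _ := GRing.isSubmodClosed.Build rat M lspan
  (GRing.submod_closed_semi span_submod).
HB.instance Definition _ := GRing.isOppClosed.Build M lspan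
  (GRing.zmod_closedN (GRing.submod_closedB span_submod)).

Definition lquot : Type := Quotient.quot lspan.
HB.instance Definition _ := GRing.Zmodule.on lquot.

Definition lproj (x : M) : lquot := \pi_(Quotient.quot lspan) x.
Definition lrepr (q : lquot) : M := repr (q : Quotient.quot lspan).

Lemma lreprK : cancel lrepr lproj. Proof. by move=> q; rewrite /lproj reprK. Qed.

Lemma lprojP x y : (lproj x = lproj y) <-> (x - y \in lspan).
Proof.
by rewrite Quotient.idealrBE; exact: (rwP eqP).
Qed.

Lemma lprojD x y : lproj (x + y) = lproj x + lproj y.
Proof. exact: pi_addr. Qed.

Definition lquot_scale (a : rat) (q : lquot) : lquot := lproj (a *: lrepr q).

Lemma lprojZ a x : lproj (a *: x) = lquot_scale a (lproj x).
Proof.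
apply/lprojP; rewrite -scalerBr rpredZ //.
by apply/lprojP; rewrite lreprK.
Qed.

Fact lquot_scaleA a b q : lquot_scale a (lquot_scale b q) = lquot_scale (a * b) q.
Proof. by rewrite -[q]lreprK -!lprojZ scalerA. Qed.
Fact lquot_scale1 : left_id 1 lquot_scale.
Proof. by move=> q; rewrite -[q]lreprK -!lprojZ scale1r. Qed.
Fact lquot_scaleDr : right_distributive lquot_scale +%R.
Proof.
move=> a p q; rewrite -[p]lreprK -[q]lreprK -lprojD -!lprojZ.
by rewrite scalerDr lprojD.
Qed.
Fact lquot_scaleDl q : {morph lquot_scale^~ q : a b / a + b}.
Proof. by move=> a b /=; rewrite -[q]lreprK -!lprojZ scalerDl lprojD. Qed.

HB.instance Definition _ := GRing.Zmodule_isLmodule.Build rat lquot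
  lquot_scaleA lquot_scale1 lquot_scaleDr lquot_scaleDl.

Fact lproj_linear : linear lproj.
Proof. by move=> a x y; rewrite lprojD lprojZ. Qed.
HB.instance Definition _ := GRing.isLinear.Build rat M lquot _ lproj lproj_linear.

(* The map induced by f on the quotient, provided f vanishes on R. *)
Definition lquot_lift (N : lmodType rat) (f : M -> N) (q : lquot) : N :=
  f (lrepr q).

Lemma lquot_liftE (N : lmodType rat) (f : {linear M -> N}) x :
  (forall r, R r -> f r = 0) -> lquot_lift f (lproj x) = f x.
Proof.
move=> fR; apply/eqP; rewrite -subr_eq0 -linearB; apply/eqP.
have /lprojP/asboolP[s [sR ->]] := lreprK (lproj x).
rewrite linear_sum big1_seq // => p /andP[_ ps].
by rewrite linearZ /= (fR _ (sR _ ps)) scaler0.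
Qed.

End LQuot.

Section LQuotAct.
Variables (G : groupType) (M : gModType G) (R : set M).
Hypothesis RG : forall g x, R x -> R (gact g x).

Definition lquot_act (g : G) : lquot R -> lquot R :=
  lquot_lift (fun x => lproj R (gact g x)).

Lemma lquot_actE g x : lquot_act g (lproj R x) = lproj R (gact g x).
Proof.
apply: (lquot_liftE (f := lproj R \o gact g)) => r Rr /=.
rewrite -[RHS](raddf0 (lproj R)); apply/lprojP; rewrite subr0; apply/asboolP.
exists [:: (1, gact g r)]; rewrite big_seq1 scale1r; split=> // p.
by rewrite inE => /eqP -> /=; exact: RG.
Qed.

Lemma lquot_act1 q : lquot_act 1%g q = q.
Proof. by rewrite -[q]lreprK lquot_actE gact1. Qed.

Lemma lquot_actM g h q : lquot_act (g * h)%g q = lquot_act g (lquot_act h q).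
Proof. by rewrite -[q]lreprK !lquot_actE gactM. Qed.

Lemma lquot_act_linear g : linear (lquot_act g).
Proof.
move=> a p q; rewrite -[p]lreprK -[q]lreprK -linearP !lquot_actE.
by rewrite gact_linear linearP.
Qed.

End LQuotAct.

Section Bi.
Variable G : topGroupType.

(* The disjoint union of the G/U, so that Q[bi_gen] is the direct sum of the
   Q[G/U], U in CO(G). *)
Definition bi_gen : Type := coprod (fun U : CO G => lcoset (val U)).
HB.instance Definition _ := GSet.on bi_gen.

Definition bi_coset (U : CO G) (A : lcoset (val U)) : bi_gen :=
  Tagged (fun U : CO G => lcoset (val U) : Type) A.

(* The direct limit is the quotient of the direct sum by the elements x - eta x,
   where eta : Q[G/U] -> Q[G/V], V <= U, is the transition map and x = gU;
   the A below run over the cosets rV with r in U. *)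
Definition bi_rel : set {malg rat[bi_gen]} :=
  [set x | exists (U V : CO G) (g : G),
    (val V `<=` val U)%classic /\
    x = delta (bi_coset (mkcoset (val U) g)) -
        (cindex (val U) (val V))%:R^-1 *:
        \sum_(A <- fset_set [set A : lcoset (val V) | (val A `<=` val U)%classic])
          delta (bi_coset (gact g A))].

Definition Bi : Type := lquot bi_rel.
HB.instance Definition _ := GRing.Lmodule.on Bi.

Fact bi_rel_stable g x : bi_rel x -> bi_rel (gact g x).
Proof.
move=> [U [V [h [VU ->]]]]; exists U, V, (g * h)%g; split=> //.
have gU : gact g (mkcoset (val U) h) = mkcoset (val U) (g * h)%g.
  by apply: val_inj; exact/esym/ltransM.
rewrite gactB gactZ gact_delta gact_sum -gU.
under eq_bigr do rewrite gact_delta.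
by under [in RHS]eq_bigr do rewrite gactM.
Qed.

HB.instance Definition _ := isGSet.Build G Bi
  (lquot_act1 bi_rel_stable) (lquot_actM bi_rel_stable).
HB.instance Definition _ := isGMod.Build G Bi
  (lquot_act_linear bi_rel_stable).

(* The linear map on Bi(G) with value h U (gU) on gU, provided h is compatible
   with the transition maps. *)
Definition bi_ext (M : lmodType rat) (h : set G -> set G -> M) : Bi -> M :=
  lquot_lift (malg_ext (fun y : bi_gen => h (val (tag y)) (val (tagged y)))).

(* theta_M (x (x) m); here A = gU, B = rW, and [xget] picks representatives of
   these cosets. *)
Definition theta (M : gModType G) (x : Bi) (m : M) : M :=
  bi_ext (fun U A => let W := U `&` [set g | gact g m = m] in
    (cindex U W)%:R^-1 *: \sum_(B <- fset_set (cosets_in U W))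
      gact (xget 1%g A * xget 1%g B)%g m) x.

Definition psi (O : set G) : Bi -> G -> rat^o :=
  bi_ext (fun U A => gindex O U *: (\1_A : G -> rat^o)).

Definition trace (R : realType) (O : set G)
    (muO : {measure set (borel G) -> \bar R}) (x : Bi) : haar_space R G :=
  ratr (psi O x 1%g) *: haar_vec muO.

End Bi.

Section Rank.
Variable G : topGroupType.

Definition fin_gen (P : disModType G) : Prop :=
  exists (n : nat) (U : 'I_n -> CO G)
         (f : ghom {malg rat[coprod (fun i => lcoset (val (U i)))]} P), onto f.

Definition projective (P : disModType G) : Prop :=
  forall (A B : disModType G) (p : ghom A B) (f : ghom P B), onto p ->
  exists h : ghom P A, forall x, p (h x) = f x.

(* xi_{P,P} maps the sum of the phi (x) p, (phi, p) in s, to id_P. *)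
Definition xi_id (P : disModType G) (s : seq (ghom P (Bi G) * P)) : Prop :=
  forall p' : P, \sum_(u <- s) theta (u.1 p') u.2 = p'.

(* The value does not depend on s; neither does [euler_char] below depend on the
   resolution.  [xget] selects it. *)
Definition HS_rank (R : realType) (O : set G)
    (muO : {measure set (borel G) -> \bar R}) (P : disModType G) :
    haar_space R G :=
  xget 0 [set rho | exists2 s : seq (ghom P (Bi G) * P), xi_id s &
    rho = \sum_(u <- s) trace O muO (u.1 u.2)].

Record FP_resolution := FPResolution {
  res_len : nat;
  res_mod : nat -> disModType G;
  res_d : forall k, ghom (res_mod k.+1) (res_mod k);
  res_aug : ghom (res_mod 0) (trivQ G);
  res_proj : forall k, (k <= res_len)%N ->
    fin_gen (res_mod k) /\ projective (res_mod k);
  res_zero : forall k (x : res_mod k), (res_len < k)%N -> x = 0;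
  res_aug_surj : onto res_aug;
  res_exact0 : forall x, res_aug x = 0 <-> exists y, res_d 0 y = x;
  res_exact : forall k x, res_d k x = 0 <-> exists y, res_d k.+1 y = x }.

Definition type_FP : Prop := exists r : FP_resolution, True.

Definition euler_char (R : realType) (O : set G)
    (muO : {measure set (borel G) -> \bar R}) : haar_space R G :=
  xget 0 [set chi | exists r : FP_resolution,
    chi = \sum_(0 <= k < (res_len r).+1)
            (-1) ^+ k *: HS_rank O muO (res_mod r k)].

End Rank.

Definition upd (I : finType) (T : Type) (t : {ffun I -> T}) (i : I) (u : T) :
  {ffun I -> T} := [ffun j => if j == i then u else t j].

Section Exterior.
Variables (n : nat) (M : lmodType rat).

Definition ext_rel : set {malg rat[{ffun 'I_n -> M}]} :=
  [set x | exists t i a u v,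
    x = delta (upd t i (a *: u + v)) -
        (a *: delta (upd t i u) + delta (upd t i v))] `|`
  [set x | exists (t : {ffun 'I_n -> M}) i j,
    [/\ i != j, t i = t j & x = delta t]].

Definition ext : Type := lquot ext_rel.
HB.instance Definition _ := GRing.Lmodule.on ext.

Definition wedge (t : {ffun 'I_n -> M}) : ext := lproj ext_rel (delta t).

End Exterior.

Section ExteriorAct.
Variables (G : groupType) (n : nat) (M : gModType G).

Fact ext_rel_stable g (x : {malg rat[{ffun 'I_n -> M}]}) :
  @ext_rel n M x -> @ext_rel n M (gact g x).
Proof.
have gupd t i u : gact g (upd t i u) = upd (gact g t) i (gact g u)
    :> {ffun 'I_n -> M}.
  by apply/ffunP => j; rewrite !ffunE; case: ifP.
case=> [[t [i [a [u [v ->]]]]]|[t [i [j [ij tij ->]]]]].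
  left; exists (gact g t), i, a, (gact g u), (gact g v).
  by rewrite gactB gactD gactZ !gact_delta !gupd gactD gactZ.
right; exists (gact g t), i, j; split=> //; last exact: gact_delta.
by rewrite !ffunE tij.
Qed.

HB.instance Definition _ := isGSet.Build G (ext n M)
  (lquot_act1 ext_rel_stable) (lquot_actM ext_rel_stable).
HB.instance Definition _ := isGMod.Build G (ext n M)
  (lquot_act_linear ext_rel_stable).

Lemma gact_wedge g (t : {ffun 'I_n -> M}) :
  gact g (wedge t) = wedge (gact g t).
Proof. by rewrite [LHS](lquot_actE ext_rel_stable) gact_delta. Qed.

End ExteriorAct.

Record simplicial_complex (V : choiceType) := SimplicialComplex {
  simplex : set {fset V};
  simplex_neq0 : forall s, simplex s -> s != fset0;
  simplex_sub : forall s t, simplex s -> (t `<=` s)%fset -> t != fset0 ->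
    simplex t;
  simplex_vertex : forall v, simplex [fset v]%fset }.

Definition simplices (V : choiceType) (S : simplicial_complex V) (k : nat) :
  set {fset V} := [set s | simplex S s /\ #|` s| = k.+1].

Definition dimension (V : choiceType) (S : simplicial_complex V) (d : nat) :
  Prop := (exists s, simplices S d s) /\ forall s, simplex S s -> (#|` s| <= d.+1)%N.

Definition acts_on (G : groupType) (V : gSetType G)
    (S : simplicial_complex V) : Prop :=
  forall (g : G) (s : {fset V}), simplex S s -> simplex S (gact g s).

Definition orbit_reps (G : groupType) (Y : gSetType G) (X Om : set Y) : Prop :=
  Om `<=` X /\
  forall x, X x -> exists! w, Om w /\ exists g : G, gact g w = x.

Arguments orbit_reps G {Y} X Om.

(* x_0 /\ ... /\ x_k in the exterior power of Q[V], for the enumeration of the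
   vertices of w provided by [fset]. *)
Definition orient (V : choiceType) (w : {fset V}) : ext #|` w| {malg rat[V]} :=
  wedge [ffun i => delta (tnth (in_tuple w) i)].

Definition stab_pm (G : groupType) (V : gSetType G) (w : {fset V}) : set G :=
  [set g | gact g @` [set orient w; - orient w] = [set orient w; - orient w]].

Arguments stab_pm G {V} w.

Section Realization.
Variables (R : realType) (V : choiceType) (S : simplicial_complex V).

(* A point is given by its barycentric coordinates. *)
Definition realization : Type := [set a : V -> R | (forall v, 0 <= a v) /\
  exists s, [/\ simplex S s, forall v, (v \in s) = (a v != 0) &
                \sum_(v <- s) a v = 1]].
HB.instance Definition _ := Choice.on realization.

Definition bary (a : realization) : V -> R := val a.

Definition in_face (s : {fset V}) (a : realization) : Prop :=
  forall v, v \notin s -> bary a v = 0.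

(* The coherent topology: O is open when its trace on each closed simplex is
   open for the euclidean topology of that simplex. *)
Definition realization_open : set (set realization) :=
  [set O | forall s, simplex S s -> forall a, in_face s a -> O a ->
    exists2 e : R, 0 < e & forall b, in_face s b ->
      (forall v, `|bary b v - bary a v| < e) -> O b].

Fact realization_openT : realization_open setT.
Proof. by move=> s _ a _ _; exists 1. Qed.

Fact realization_openI : setI_closed realization_open.
Proof.
move=> A B oA oB s Ss a sa [Aa Ba].
have [e e0 eA] := oA s Ss a sa Aa; have [f f0 fB] := oB s Ss a sa Ba.
exists (Num.min e f) => [|b sb ab]; first by rewrite lt_min e0.
by split; [apply: eA|apply: fB] => // v; have := ab v; rewrite lt_min => /andP[].
Qed.

Fact realization_open_bigcup (I : Type) (F : I -> set realization) :
  (forall i, realization_open (F i)) -> realization_open (\bigcup_i F i).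
Proof.
move=> oF s Ss a sa [i _ Fa]; have [e e0 eF] := oF i s Ss a sa Fa.
by exists e => // b sb ab; exists i => //; exact: eF.
Qed.

HB.instance Definition _ := isOpenTopological.Build realization
  realization_openT realization_openI realization_open_bigcup.

End Realization.

Definition contractible (R : realType) (X : topologicalType) : Prop :=
  exists (x0 : X) (H : R * X -> X),
    [/\ {within `[0, 1]%classic `*` [set: X], continuous H},
        forall x, H (0, x) = x & forall x, H (1, x) = x0].

(* Main.v *)
(** The trivial module is resolved by the permutation modules Q[Y_k], where Y_k
    is the set of flags s_0 > ... > s_k of simplices: G permutes the cells of the
    barycentric subdivision without orientation signs.  The module Q[Y] has rank
    the sum of mu_{G_y} over orbit representatives y.  Since mu_{G_y} is
    |G_w : G_y| mu_{G_w} for a flag y with top simplex w, summing over orbits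
    amounts to counting, with weight mu_{G_w}, all flags with top w, w in Omega;
    the signed number of these is (-1)^{dim w}.

    The Euler characteristic does not depend on the resolution because the trace
    of endomorphisms satisfies Tr(fh) = Tr(hf), so that the Lefschetz number is
    invariant under chain homotopy and the comparison maps F, F' of two
    resolutions have L(F'F) = L(FF').  This trace property comes from the symmetry
    of the trace form (x, y) |-> tr(theta(x (x) y)) on Bi(G), which is where
    unimodularity enters.

    Exactness: the contraction H pulls the cover by open vertex stars back to
    [0, 1] x |F|, F a finite set of vertices, and a Lebesgue number e turns small
    tuples of points into simplices.  A simplicial cycle is first replaced by a
    homologous cycle of e-small tuples in its closed simplices, which needs no
    subdivision: such tuples in a simplex form an acyclic complex, by contracting
    linearly in small steps.  That cycle is then moved along H in steps of length
    less than e.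

    All Haar measures are proportional: they are proportional on compact open
    subgroups, and by van Dantzig's theorem compact sets can be approximated by
    finite unions of cosets of these. *)
Require Import Defs.
From HB Require Import structures.
From mathcomp Require Import all_boot all_order all_algebra.
From mathcomp Require Import finmap monalg.
From mathcomp Require Import all_classical all_reals all_analysis.
From mathcomp Require Import ring lra.
From mathcomp Require perm.

Set Implicit Arguments.
Unset Strict Implicit.
Unset Printing Implicit Defensive.

Import Order.TTheory GRing.Theory Num.Theory.
Import numFieldNormedType.Exports.

Local Open Scope classical_set_scope.
Local Open Scope ring_scope.

(** * Cosets and compact open subgroups *)

(** The complex of oriented simplices consists of modules twisted by the sign with which a setwise
    stabiliser permutes the vertices. An element preserving a flag preserves each member of it, so
    flags give genuine permutation modules, whose rank needs only a dual basis indexed by orbits.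
    Signs remain only in [stab_pm], which turns out to be the setwise stabiliser.

    Neither H, nor the chosen vertices, nor the chosen fillings are equivariant. This is harmless:
    exactness concerns the underlying vector spaces, and the differentials are equivariant by
    construction. Where an equivariant choice is required, for lifts out of Q[Y], it is obtained by
    averaging over a compact open stabiliser, the indices being invertible in Q.

    H need not be simplicial, so the homotopy it induces is built on ordered tuples of vertices,
    where repetitions are allowed and prisms have simple formulas. Flags are compared with tuples by
    choosing a vertex of each simplex in one direction and by acyclic carriers in the other. *)

Lemma fsbig_fibers (R : nmodType) (I J : choiceType) (A : set I) (h : I -> J)
    (F : I -> R) : finite_set A ->
  \sum_(i \in A) F i =
  \sum_(j \in h @` A) \sum_(i \in A `&` h @^-1` [set j]) F i.
Proof.
move=> Af; have hf : finite_set (h @` A) by exact: finite_image.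
transitivity (\sum_(i \in A) \sum_(j \in h @` A) (if h i == j then F i else 0)).
  apply: eq_fsbigr => i /set_mem Ai.
  rewrite (fsbigD1 (h i)) //=; last by exists i.
  rewrite eqxx fsbig1 ?addr0 // => j [_ /= /eqP]; rewrite eq_sym.
  by move=> /negPf ->.
rewrite exchange_fsbig //; apply: eq_fsbigr => j _.
rewrite fsbig_mkcondr; apply: eq_fsbigr => i _.
have [<-|hij] := eqVneq (h i) j; first by rewrite mem_set.
by rewrite memNset // => hj; rewrite hj eqxx in hij.
Qed.

Lemma fsum_cst (I : choiceType) (M : lmodType rat) (A : set I) (x : M) :
  finite_set A -> \sum_(i \in A) x = #|` fset_set A|%:R *: x.
Proof.
move=> Af; rewrite fsbig_finite // big_const_seq count_predT iter_addr addr0.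
by rewrite scaler_nat.
Qed.

Section Subgroups.
Variable G : groupType.
Implicit Types (U V W : set G) (g h x y : G).

Section One.
Variables (U : set G) (sU : is_subgroup U).

Lemma sg1 : U 1%g. Proof. by case: sU. Qed.

Lemma sgV x : U x -> U x^-1%g.
Proof. by move=> Ux; rewrite -[x^-1%g]mul1g; case: sU => U1; apply. Qed.

Lemma sgM x y : U x -> U y -> U (x * y)%g.
Proof.
by move=> Ux Uy; rewrite -[y]invgK; case: sU => _; apply=> //; exact: sgV.
Qed.

Lemma sgMl x y : U x -> U (x * y)%g <-> U y.
Proof.
move=> Ux; split=> [Uxy|]; last exact: sgM.
by rewrite -[y](mulKg x); apply: sgM => //; exact: sgV.
Qed.

Lemma sgMr x y : U y -> U (x * y)%g <-> U x.
Proof.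
move=> Uy; split=> [Uxy|Ux]; last exact: sgM.
by rewrite -[x](mulgK y); apply: sgM => //; exact: sgV.
Qed.

End One.

Lemma ltransP g U x : ltrans g U x <-> U (g^-1 * x)%g.
Proof.
split=> [[u Uu <-]|Ux]; first by rewrite mulKg.
by exists (g^-1 * x)%g => //; rewrite mulVKg.
Qed.

Lemma ltrans_eqP U g h : is_subgroup U ->
  ltrans g U = ltrans h U <-> U (g^-1 * h)%g.
Proof.
move=> sU; split=> [E|Ugh].
  by apply/ltransP; rewrite E; apply/ltransP; rewrite mulVg; exact: sg1.
apply/seteqP; split=> x /ltransP Ux; apply/ltransP.
  rewrite -[(h^-1 * x)%g]mul1g -(mulVg (g^-1 * h)%g) -mulgA.
  rewrite (sgMl sU); first by rewrite mulgA mulgK.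
  exact: sgV.
by rewrite -[x](mulVKg h) mulgA; exact: (sgM sU).
Qed.

Lemma ltrans_id U g : is_subgroup U -> ltrans g U = U <-> U g.
Proof. by move=> sU; rewrite -{2}[U]ltrans1 ltrans_eqP // mulg1; split=> /(sgV sU) //; rewrite invgK. Qed.

Lemma ltrans_self U g : is_subgroup U -> ltrans g U g.
Proof. by move=> sU; apply/ltransP; rewrite mulVg; exact: sg1. Qed.

Lemma ltrans_xget U g : is_subgroup U ->
  ltrans (xget 1%g (ltrans g U)) U = ltrans g U.
Proof.
move=> sU; apply/esym/ltrans_eqP => //; apply/ltransP.
exact: (xgetPex 1%g (ex_intro _ g (ltrans_self g sU))).
Qed.

Lemma ltrans_xgetM U g : is_subgroup U ->
  exists2 u, U u & xget 1%g (ltrans g U) = (g * u)%g.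
Proof.
move=> sU; exists (g^-1 * xget 1%g (ltrans g U))%g; last by rewrite mulVKg.
by apply/ltrans_eqP => //; rewrite ltrans_xget.
Qed.

Lemma cosets_in_rep U V B : is_subgroup U -> is_subgroup V -> V `<=` U ->
  cosets_in U V B -> U (xget 1%g B) /\ ltrans (xget 1%g B) V = B.
Proof.
move=> sU sV VU [r Ur <-]; split; last exact: ltrans_xget.
by have [v Vv ->] := ltrans_xgetM r sV; apply: (sgM sU) => //; exact: VU.
Qed.

Lemma is_subgroupI U V : is_subgroup U -> is_subgroup V ->
  is_subgroup (U `&` V).
Proof.
move=> [U1 UB] [V1 VB]; split=> // x y [Ux Vx] [Uy Vy].
by split; [exact: UB|exact: VB].
Qed.

Definition conj_set g U : set G := [set x | U (g^-1 * x * g)%g].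

Lemma is_subgroup_conj g U : is_subgroup U -> is_subgroup (conj_set g U).
Proof.
move=> sU; split; first by rewrite /conj_set /= mulg1 mulVg; exact: sg1.
move=> x y Ux Uy; rewrite /conj_set /=.
suff -> : (g^-1 * (x * y^-1) * g = (g^-1 * x * g) * (g^-1 * y * g)^-1)%g.
  by case: sU => _; apply.
by rewrite !invgM invgK !mulgA mulgK.
Qed.

(** Intended for [F] constant on the cosets rW with r in U, so that the representatives picked by
    [xget] do not matter. *)
Definition csum (M : nmodType) U W (F : G -> M) : M :=
  \sum_(B \in cosets_in U W) F (xget 1%g B).

Section Csum.
Variables (M : nmodType) (U V W : set G) (F : G -> M).
Hypotheses (sU : is_subgroup U) (sV : is_subgroup V) (sW : is_subgroup W).
Hypotheses (WV : W `<=` V) (VU : V `<=` U) (UWf : finite_set (cosets_in U W)).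
Hypothesis FW : forall r w, U r -> W w -> F (r * w)%g = F r.

Let VW_UW : cosets_in V W `<=` cosets_in U W.
Proof. by move=> _ [r Vr <-]; exists r => //; exact: VU. Qed.

Lemma cosets_in_finr : finite_set (cosets_in V W).
Proof. exact: sub_finite_set VW_UW UWf. Qed.

Lemma cosets_in_finl : finite_set (cosets_in U V).
Proof.
apply: (sub_finite_set _ (finite_image (fun B => ltrans (xget 1%g B) V) UWf)).
move=> _ [r Ur <-]; exists (ltrans r W); first by exists r.
by have [w Ww ->] := ltrans_xgetM r sW; apply/ltrans_eqP => //;
  rewrite invgM mulgVK; apply: sgV => //; exact: WV.
Qed.

Lemma xget_inv r : U r -> F (xget 1%g (ltrans r W)) = F r.
Proof. by move=> Ur; have [w Ww ->] := ltrans_xgetM r sW; exact: FW. Qed.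

(** The cosets of W are grouped by the coset of V that contains them; left translation by a
    representative r identifies V/W with the cosets of W in rV. *)
Lemma csum_tower : csum U W F = csum U V (fun r => csum V W (fun v => F (r * v)%g)).
Proof.
have WU : W `<=` U by move=> x /WV/VU.
have cV r w : W w -> ltrans (r * w)%g V = ltrans r V.
  move=> Ww; apply/ltrans_eqP => //; rewrite invgM mulgVK.
  by apply: sgV => //; exact: WV.
rewrite /csum (fsbig_fibers (fun B => ltrans (xget 1%g B) V)) //.
have -> : (fun B => ltrans (xget 1%g B) V) @` cosets_in U W = cosets_in U V.
  apply/seteqP; split=> [_ [_ [r Ur <-] <-]|_ [r Ur <-]].
    by have [w Ww ->] := ltrans_xgetM r sW; rewrite cV //; exists r.
  exists (ltrans r W); first by exists r.
  by have [w Ww ->] := ltrans_xgetM r sW; rewrite cV.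
apply: eq_fsbigr => C /set_mem UVC.
have [Ur rC] := cosets_in_rep sU sV VU UVC.
set r := xget 1%g C in Ur rC *.
rewrite (reindex_fsbig (ltrans r) (cosets_in V W)) /=.
  apply: eq_fsbigr => _ /set_mem[v Vv <-]; rewrite -ltransM.
  have Uv := VU Vv.
  rewrite xget_inv; last exact: (sgM sU).
  have [w Ww ->] := ltrans_xgetM v sW.
  by rewrite mulgA (FW _ Ww) //; exact: (sgM sU).
split.
- move=> _ [v Vv <-]; rewrite -ltransM; split.
    by exists (r * v)%g => //; apply: (sgM sU) => //; exact: VU.
  rewrite /preimage /=; have [w Ww ->] := ltrans_xgetM (r * v)%g sW.
  rewrite cV // -rC; apply/ltrans_eqP => //.
  by rewrite invgM mulgVK; exact: sgV.
- move=> A B _ _ E; rewrite -[A]ltrans1 -[B]ltrans1 -(mulVg r).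
  by rewrite !ltransM E.
- move=> _ [[x Ux <-]]; rewrite /preimage /=.
  have [w Ww ->] := ltrans_xgetM x sW; rewrite cV // => xC.
  exists (ltrans (r^-1 * x)%g W); last by rewrite -ltransM mulVKg.
  by exists (r^-1 * x)%g => //; apply/ltrans_eqP => //; rewrite rC.
Qed.

(** Left translation by u permutes the cosets of W in U. Averages over U are U-invariant for this
    reason. *)
Lemma csum_transl u : U u -> csum U W (fun r => F (u * r)%g) = csum U W F.
Proof.
move=> Uu; rewrite /csum [RHS](reindex_fsbig (ltrans u) (cosets_in U W)) /=.
  apply: eq_fsbigr => _ /set_mem[v Uv <-]; rewrite -ltransM.
  rewrite xget_inv; last exact: (sgM sU).
  have [w Ww ->] := ltrans_xgetM v sW.
  by rewrite mulgA (FW _ Ww) //; exact: (sgM sU).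
split.
- by move=> _ [v Vv <-]; rewrite -ltransM; exists (u * v)%g => //; exact: (sgM sU).
- move=> A B _ _ E; rewrite -[A]ltrans1 -[B]ltrans1 -(mulVg u).
  by rewrite !ltransM E.
- move=> _ [x Ux <-]; exists (ltrans (u^-1 * x)%g W).
    by exists (u^-1 * x)%g => //; apply: (sgM sU) => //; exact: sgV.
  by rewrite -ltransM mulVKg.
Qed.

End Csum.

Lemma csum_cst (M : lmodType rat) U W (x : M) : finite_set (cosets_in U W) ->
  csum U W (fun=> x) = (cindex U W)%:R *: x.
Proof. exact: fsum_cst. Qed.

Lemma cosets_in_id U : is_subgroup U -> cosets_in U U = [set U].
Proof.
move=> sU; apply/seteqP; split=> [_ [r Ur <-]|_ ->]; first exact/ltrans_id.
by exists 1%g; [exact: sg1|exact: ltrans1].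
Qed.

Lemma csum_id (M : nmodType) U (F : G -> M) : is_subgroup U ->
  (forall u, U u -> F u = F 1%g) -> csum U U F = F 1%g.
Proof.
move=> sU FU; rewrite /csum cosets_in_id // fsbig_set1 FU //.
by apply: (xgetPex 1%g); exists 1%g; exact: sg1.
Qed.

Lemma cindex_gt0 U W : is_subgroup U -> finite_set (cosets_in U W) ->
  (0 < cindex U W)%N.
Proof.
move=> sU fUW; rewrite /cindex cardfs_gt0; apply/fset0Pn.
exists (ltrans 1%g W); rewrite in_fset_set //; apply/mem_set.
by exists 1%g => //; exact: sg1.
Qed.

(** Multiplicativity of the index is [csum_tower] for the constant function 1. *)
Lemma cindex_tower U V W : is_subgroup U -> is_subgroup V -> is_subgroup W ->
  W `<=` V -> V `<=` U -> finite_set (cosets_in U W) ->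
  cindex U W = (cindex U V * cindex V W)%N.
Proof.
move=> sU sV sW WV VU fin.
have fl := cosets_in_finl sV sW WV fin; have fr := cosets_in_finr VU fin.
have := @csum_tower rat^o U V W (fun=> 1) sU sV sW WV VU fin (fun _ _ _ _ => erefl).
rewrite csum_cst // csum_cst // csum_cst // scalerA -natrM /GRing.scale /= !mulr1.
by move=> /eqP; rewrite eqr_nat => /eqP.
Qed.

End Subgroups.

Section TopGroupTheory.
Variable G : topGroupType.
Implicit Types (U V W A : set G) (g h x : G).

Lemma mulg_continuousr g : continuous (fun x : G => (g * x)%g).
Proof.
move=> x; apply: (@continuous_comp _ _ _ (fun y : G => (g, y))
  (fun p : G * G => (p.1 * p.2)%g)); last exact: mulg_continuous.
by apply: cvg_pair => //=; exact: cvg_cst.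
Qed.

Lemma mulg_continuousl g : continuous (fun x : G => (x * g)%g).
Proof.
move=> x; apply: (@continuous_comp _ _ _ (fun y : G => (y, g))
  (fun p : G * G => (p.1 * p.2)%g)); last exact: mulg_continuous.
by apply: cvg_pair => //=; exact: cvg_cst.
Qed.

Lemma ltransE g A : ltrans g A = (fun x => (g^-1 * x)%g) @^-1` A.
Proof. by apply/seteqP; split=> x /ltransP. Qed.

Lemma open_ltrans g A : open A -> open (ltrans g A).
Proof.
move=> oA; rewrite ltransE; apply: open_comp => // x _.
exact: mulg_continuousr.
Qed.

Lemma compact_ltrans g A : compact A -> compact (ltrans g A).
Proof.
move=> cA; apply: continuous_compact => //; apply: continuous_subspaceT.
exact: mulg_continuousr.
Qed.

Lemma open_conj g A : open A -> open (conj_set g A).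
Proof.
move=> oA; rewrite (_ : conj_set g A = (fun x => (x * g)%g) @^-1`
  ((fun x => (g^-1 * x)%g) @^-1` A)); last first.
  by apply/seteqP; split=> x; rewrite /conj_set /preimage /= mulgA.
apply: open_comp => [x _|]; first exact: mulg_continuousl.
by apply: open_comp => // x _; exact: mulg_continuousr.
Qed.

Lemma conj_setE g A : conj_set g A = (fun x => (g * x * g^-1)%g) @` A.
Proof.
apply/seteqP; split=> [x Ax|_ [x Ax <-]].
  by exists (g^-1 * x * g)%g => //; rewrite !mulgA mulgV mul1g mulgK.
by rewrite /conj_set /= !mulgA mulVg mul1g mulgVK.
Qed.

Lemma compact_conj g A : compact A -> compact (conj_set g A).
Proof.
move=> cA; rewrite conj_setE.
rewrite (_ : [set _ | x in A] = (fun x => (x * g^-1)%g) @` ltrans g A).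
  apply: continuous_compact; last exact: compact_ltrans.
  by apply: continuous_subspaceT; exact: mulg_continuousl.
by rewrite /ltrans image_comp.
Qed.

Lemma open_subgroup_closed W : is_subgroup W -> open W -> closed W.
Proof.
move=> sW oW; rewrite -[W]setCK closedC.
rewrite (_ : ~` W = \bigcup_(g in ~` W) ltrans g W).
  by apply: bigcup_open => g _; exact: open_ltrans.
apply/seteqP; split=> [g Wg|x [g Wg] /ltransP Wgx Wx].
  by exists g => //; exact: ltrans_self.
by apply: Wg; rewrite -[g]invgK; apply: (sgV sW); exact: (sgMr sW (g^-1)%g Wx).1.
Qed.

Lemma subgroup_open W A : is_subgroup W -> nbhs 1%g A -> A `<=` W -> open W.
Proof.
move=> sW + AW; rewrite nbhsE => -[N [oN N1] NA].
rewrite (_ : W = \bigcup_(g in W) ltrans g N).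
  by apply: bigcup_open => g _; exact: open_ltrans.
apply/seteqP; split=> [g Wg|x [g Wg] /ltransP Ngx].
  by exists g => //; apply/ltransP; rewrite mulVg.
by rewrite -[x](mulVKg g); apply: (sgM sW) => //; apply/AW/NA.
Qed.

Lemma CO_subgroup U : CO G U -> is_subgroup U. Proof. by case. Qed.
Lemma CO_compact U : CO G U -> compact U. Proof. by case. Qed.
Lemma CO_open U : CO G U -> open U. Proof. by case. Qed.

Lemma CO_setI U W : CO G U -> is_subgroup W -> open W -> CO G (U `&` W).
Proof.
move=> [sU cU oU] sW oW; split; first exact: is_subgroupI.
  apply: compact_closedI => //; exact: open_subgroup_closed.
exact: openI.
Qed.

Lemma CO_setI2 U V : CO G U -> CO G V -> CO G (U `&` V).
Proof. by move=> CU [sV _ oV]; exact: CO_setI. Qed.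

Lemma CO_conj g U : CO G U -> CO G (conj_set g U).
Proof.
by move=> [sU cU oU]; split;
  [exact: is_subgroup_conj|exact: compact_conj|exact: open_conj].
Qed.

Lemma group_compact_cover U : compact U ->
  forall (I : choiceType) (D : set I) (f : I -> set G),
    (forall i, D i -> open (f i)) -> U `<=` cover D f ->
    finite_subset_cover D f U.
Proof.
move=> cU; suff : cover_compact (U : set (pointed_group G)) by [].
by rewrite -compact_cover.
Qed.

(** The open cosets of W cover the compact U, and a finite subcover must contain every coset that
    meets U. *)
Lemma CO_finite U W : CO G U -> is_subgroup W -> open W ->
  finite_set (cosets_in U W).
Proof.
move=> [sU cU oU] sW oW.
have [] := group_compact_cover cU (D := U) (f := fun g => ltrans g W).
- by move=> g _; exact: open_ltrans.
- by move=> g Ug; exists g => //; exact: ltrans_self.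
move=> D DU UD.
apply: (@sub_finite_set _ _ ((fun g => ltrans g W) @` [set` D])); last first.
  exact: finite_image.
move=> _ [r Ur <-]; have [g gD /ltransP Wr] := UD r Ur.
by exists g => //; apply/ltrans_eqP.
Qed.

End TopGroupTheory.

(** * Van Dantzig's theorem *)

Section VanDantzig.
Variables (G : topGroupType) (O : set G).
Hypotheses (hG : hausdorff_space G) (tG : totally_disconnected [set: G]).
Hypothesis CO_O : CO G O.

Let base := [set C : set G | [/\ clopen C, C 1%g & C `<=` O]].
Let Q := \bigcap_(C in base) C.

Let base_O : base O.
Proof.
split=> //; last exact: (sg1 (CO_subgroup CO_O)).
split; first exact: CO_open.
exact: (open_subgroup_closed (CO_subgroup CO_O) (CO_open CO_O)).
Qed.

(** The complements of the members of [base] form an open cover of K, so finitely many members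
    already have an intersection missing K. Intersecting with [O] keeps the result inside [O]. *)
Let base_sep (K : set G) : compact K -> K `&` Q = set0 ->
  exists2 C, base C & C `&` K = set0.
Proof.
move=> cK KQ.
have [| |D DB KD] := group_compact_cover cK (I := set G) (D := base) (f := fun C => ~` C).
- by move=> C [[_ cC] _ _]; exact: closed_openC.
- move=> x Kx; apply: contrapT => nx.
  have : (K `&` Q) x.
    split=> // C bC; apply: contrapT => nC; apply: nx; exists C => //.
  by rewrite KQ.
exists (O `&` \bigcap_(C in [set` D]) C).
  split.
  - split.
      apply: openI; first exact: CO_open.
      by rewrite bigcap_fset big_seq; apply: big_ind => [||C CD];
        [exact: openT|exact: openI|have /set_mem[[] //] := DB _ CD].
    apply: closedI; first by case: base_O => -[].
    by apply: closed_bigI => C CD; have /set_mem[[] //] := DB _ CD.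
  - by split; [case: base_O|move=> C CD; have /set_mem[] := DB _ CD].
  - by move=> x [].
apply/seteqP; split=> // x [[Ox DCx] Kx].
by have [C CD] := KD _ Kx; apply; exact: DCx.
Qed.

Let Q1 : Q 1%g. Proof. by move=> C []. Qed.
Let QO : Q `<=` O. Proof. by move=> x; apply. Qed.
Let Q_closed : closed Q.
Proof. by apply: closed_bigI => C [[]]. Qed.

(* The quasi-component [Q] of 1 cannot be split: separate the two parts by an
   open [W]; the boundary of [W] misses [Q], hence by compactness misses some
   basic [C], and then [C `&` W] is itself clopen. *)
Let Q_split (A A' : set G) : closed A -> closed A' -> A `|` A' = Q ->
  A `&` A' = set0 -> A 1%g -> A' = set0.
Proof.
move=> clA clA' AA' dAA' A1.
have AQ : A `<=` Q by rewrite -AA'; left.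
have A'Q : A' `<=` Q by rewrite -AA'; right.
have AO : A `<=` O° by rewrite ((interior_id O).1 (CO_open CO_O)) => x /AQ/QO.
have nA := compact_normal_local hG (CO_compact CO_O) AO clA.
have [|N /set_nbhsP[W [oW AW WN]] clN] := nA (~` A').
  apply/set_nbhsP; exists (~` A'); split=> //; first exact: closed_openC.
  by move=> x Ax A'x; have : (A `&` A') x by []; rewrite dAA'.
have cWA' : closure W `<=` ~` A' by move=> x /(closureS WN)/clN.
have QW x : Q x -> closure W x -> W x.
  by rewrite -AA' => -[/AW //|A'x /cWA'].
have [|//|C [[oC cC] C1 CO_] CK] := base_sep (K := O `&` (closure W `&` ~` W)).
- apply: compact_closedI; first exact: CO_compact.
  by apply: closedI; [exact: closed_closure|exact: open_closedC].
- by apply/seteqP; split=> // x [[_ [cW nW]] Qx]; apply: nW; exact: QW.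
have CW : C `&` W = C `&` closure W.
  apply/seteqP; split=> x [Cx Wx]; split=> //; first exact: subset_closure.
  apply: contrapT => nW; have : (C `&` (O `&` (closure W `&` ~` W))) x.
    by split=> //; split=> //; exact: CO_.
  by rewrite CK.
have bCW : base (C `&` W).
  split; last by move=> x [/CO_].
    split; first exact: openI.
    by rewrite CW; apply: closedI => //; exact: closed_closure.
  by split=> //; exact: AW.
apply/seteqP; split=> // x A'x; have [_ Wx] := A'Q _ A'x _ bCW.
by apply: (cWA' x) => //; exact: subset_closure.
Qed.

Let Q_connected : connected Q.
Proof.
move=> B B0 [C oC BC] [D cD BD].
have QB : Q `&` ~` B = Q `&` ~` C.
  by rewrite BC; apply/seteqP; split=> x [Qx nB]; split=> //;
    [move=> Cx; apply: nB|move=> -[]].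
have clB : closed B by rewrite BD; exact: closedI Q_closed cD.
have clnB : closed (Q `&` ~` B).
  by rewrite QB; apply: (closedI Q_closed); exact: open_closedC.
have BQ : B `<=` Q by rewrite BC => x [].
have U : B `|` (Q `&` ~` B) = Q.
  apply/seteqP; split=> [x [/BQ|[]] //|x Qx].
  by have [|] := pselect (B x); [left|right].
have I : B `&` (Q `&` ~` B) = set0 by apply/seteqP; split=> // x [? []].
have [B1|nB1] := pselect (B 1%g).
  by rewrite -[RHS]U (Q_split clB clnB U I B1) setU0.
case: B0 => x Bx; suff B0 : B = set0 by rewrite B0 in Bx.
by apply: (Q_split clnB clB); [rewrite setUC|rewrite setIC|split].
Qed.

Let Q_trivial : Q = [set 1%g].
Proof.
rewrite -(tG I); apply/seteqP; split; last first.
  by rewrite tG // => _ ->.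
exact: (connected_component_max Q1 (fun _ _ => I) Q_connected).
Qed.

(** Since Q is trivial, [base_sep] gives a compact open C with 1 in C and C inside N. The required
    subgroup is the right stabiliser of the set C. *)
Lemma CO_basis (N : set G) : nbhs 1%g N -> exists2 U, CO G U & U `<=` N.
Proof.
rewrite nbhsE => -[M [oM M1] MN].
have [||C [[oC cC] C1 CsubO] CK] := base_sep (K := O `&` ~` M).
- apply: compact_closedI; first exact: CO_compact.
  exact: open_closedC.
- by rewrite Q_trivial; apply/seteqP; split=> // x [[_ nM] /= x1]; apply: nM; rewrite x1.
have CM : C `<=` M.
  move=> x Cx; apply: contrapT => nM; have : (C `&` (O `&` ~` M)) x.
    by split=> //; split=> //; exact: CsubO.
  by rewrite CK.
have cptC : compact C by exact: subclosed_compact cC (CO_compact CO_O) CsubO.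
have [invc mulc] := (@invg_continuous G, @mulg_continuous G).
(* Tube lemma: multiplication maps C x {1} into the open C, and C is compact, so a whole
   neighbourhood of 1 multiplies C into C. *)
pose V := [set x : G | forall c, C c -> C (c * x)%g].
have nV : nbhs 1%g V.
  have := (compact_near_coveringP C).1 cptC G (nbhs (1%g : G))
    (fun x c => C (c * x)%g) _.
  apply=> c Cc.
  have : nbhs ((c, 1%g) : G * G) ((fun p : G * G => (p.1 * p.2)%g) @^-1` C).
    by apply: mulc; apply: open_nbhs_nbhs; split=> //=; rewrite mulg1.
  by [].
(* U contains V together with its inverses, hence is open, and U lies in C because 1 does. *)
pose U := [set x : G | forall c, C c <-> C (c * x)%g].
have sU : is_subgroup U.
  split=> [c|x y Ux Uy c]; first by rewrite mulg1.
  rewrite mulgA [C (_ * y^-1)%g]Uy mulgVK; exact: Ux.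
have oU : open U.
  apply: (subgroup_open sU (A := V `&` (fun x => x^-1%g) @^-1` V)).
    by apply: filterI => //; apply: invc; rewrite invg1.
  move=> x [Vx Vx'] c; split; first exact: Vx.
  by move=> /Vx'; rewrite mulgK.
have UC : U `<=` C by move=> x /(_ 1%g); rewrite mul1g => -[+ _]; apply.
exists U; last by move=> x /UC/CM/MN.
split=> //; apply: (subclosed_compact _ cptC UC).
exact: open_subgroup_closed.
Qed.

End VanDantzig.

(** * Haar measures *)

Section Haar.
Variables (R : realType) (G : topGroupType).
Implicit Types (mu nu : {measure set (borel G) -> \bar R}) (U V W : set G).

Lemma open_borel (A : set G) : open A -> measurable (A : set (borel G)).
Proof. exact: sub_sigma_algebra. Qed.

Definition vol mu U : R := fine (mu U).

Lemma haar_disjoint_cosets mu W (X : set (set G)) : left_haar mu ->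
  is_subgroup W -> open W -> finite_set X ->
  (forall B, X B -> exists r, B = ltrans r W) ->
  mu (\bigcup_(B in X) B) = ((#|` fset_set X|)%:R%:E * mu W)%E.
Proof.
move=> hmu sW oW fX XW.
rewrite measure_fin_bigcup //; first last.
- move=> B XB; have [r ->] := XW _ XB; apply: open_borel.
  exact: open_ltrans.
- move=> A B XA XB [x [Ax Bx]].
  have [r Ar] := XW _ XA; have [s Bs] := XW _ XB.
  move: Ax Bx; rewrite Ar Bs => /ltransP Wrx /ltransP Wsx.
  transitivity (ltrans x W); first exact/ltrans_eqP.
  by apply/esym/ltrans_eqP.
transitivity (\sum_(B \in X) mu W)%E.
  apply: eq_fsbigr => B /set_mem /XW[r ->].
  exact: (haar_ltrans hmu r (open_borel oW)).
rewrite fsbig_finite // big_const_seq count_predT /=.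
elim: (size _) => [|n IH]; first by rewrite mul0e.
by rewrite iterS IH -nat1r EFinD ge0_muleDl ?lee_fin // mul1e.
Qed.

Lemma haar_index mu U W : left_haar mu -> CO G U -> is_subgroup W -> open W ->
  W `<=` U -> mu U = ((cindex U W)%:R%:E * mu W)%E.
Proof.
move=> hmu CU sW oW WU.
rewrite -(haar_disjoint_cosets hmu sW oW (CO_finite CU sW oW)); last first.
  by move=> _ [r _ <-]; exists r.
congr (mu _); apply/seteqP; split=> [u Uu|x [_ [r Ur <-] [w Ww <-]]].
  by exists (ltrans u W); [exists u|exact: ltrans_self].
by apply: (sgM (CO_subgroup CU)) => //; exact: WU.
Qed.

Lemma haar_CO_fin mu U : left_haar mu -> CO G U -> mu U \is a fin_num.
Proof.
move=> hmu [_ cU _]; rewrite ge0_fin_numE ?measure_ge0 //.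
exact: haar_compact.
Qed.

Section Normalised.
Variables (mu : {measure set (borel G) -> \bar R}) (O : set G).
Hypotheses (hmu : left_haar mu) (CO_O : CO G O) (muO : mu O = 1%E).

Lemma vol_index U W : CO G U -> is_subgroup W -> open W -> W `<=` U ->
  vol mu U = (cindex U W)%:R * vol mu W.
Proof. by move=> CU sW oW WU; rewrite /vol (haar_index hmu CU sW) // fineM //;
  apply: haar_CO_fin => //; rewrite -(setIidr WU); exact: CO_setI. Qed.

(** O and U are finite unions of cosets of their intersection. If that intersection were null, O
    would be null as well, against [muO]. *)
Lemma vol_gt0 U : CO G U -> 0 < vol mu U.
Proof.
move=> CU; have CI := CO_setI2 CO_O CU.
have [sI _ oI] := CI.
have v0 V : 0 <= vol mu V by rewrite /vol fine_ge0 // measure_ge0.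
have IO : 0 < vol mu (O `&` U).
  rewrite lt_def v0 andbT; apply/negP => /eqP I0.
  have := vol_index CO_O sI oI (@subIsetl _ _ _).
  by rewrite I0 mulr0 /vol muO => /eqP; rewrite oner_eq0.
rewrite (vol_index CU sI oI (@subIsetr _ _ _)) mulr_gt0 // ltr0n.
by apply: cindex_gt0; [exact: CO_subgroup|exact: CO_finite].
Qed.

Lemma vol_cindex U W : CO G U -> is_subgroup W -> open W -> W `<=` U ->
  (cindex U W)%:R = vol mu U / vol mu W.
Proof.
move=> CU sW oW WU; rewrite (vol_index CU sW oW WU) mulfK //.
have CW : CO G W by rewrite -(setIidr WU); exact: CO_setI.
by rewrite gt_eqF ?vol_gt0.
Qed.

(** Index identities become identities between volumes, where conjugation invariance can be
    applied. *)
Lemma ratr_gindex U V : CO G U -> CO G V ->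
  ratr (gindex U V) = vol mu U / vol mu V.
Proof.
move=> CU CV; have CI := CO_setI2 CU CV; have [sI _ oI] := CI.
rewrite /gindex fmorph_div /= !ratr_nat.
rewrite (vol_cindex CU sI oI (@subIsetl _ _ _)).
rewrite (vol_cindex CV sI oI (@subIsetr _ _ _)).
have := vol_gt0 CI; have := vol_gt0 CV; set a := vol _ V; set b := vol _ (_ `&` _).
by move=> a0 b0; rewrite invf_div mulrA mulfVK // gt_eqF.
Qed.

End Normalised.

(** K is covered by finitely many cosets lying in N. These are cut into cosets of one common
    subgroup W, and on a disjoint union of such cosets both measures are determined by their value
    on W. *)
Lemma haar_compact_open_approx mu nu (c : R) (O : set G) :
  hausdorff_space G -> totally_disconnected [set: G] -> CO G O ->
  left_haar mu -> left_haar nu ->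
  (forall W, CO G W -> nu W = (c%:E * mu W)%E) ->
  forall K N : set G, compact K -> open N -> K `<=` N ->
  exists C : set G, [/\ K `<=` C, C `<=` N, open C & nu C = (c%:E * mu C)%E].
Proof.
move=> hG tG CO_O hmu hnu cW K N cK oN KN.
have Wx x : exists W, K x -> CO G W /\ ltrans x W `<=` N.
  have [Kx|nK] := pselect (K x); last by exists setT.
  have [|W CW WN] := CO_basis hG tG CO_O (N := ltrans x^-1%g N).
    apply: open_nbhs_nbhs; split; first exact: open_ltrans.
    by apply/ltransP; rewrite invgK mulg1; exact: KN.
  exists W => _; split=> // _ [w /WN/ltransP + <-].
  by rewrite invgK.
have [f fP] := choice Wx.
have [||D DK KD] := group_compact_cover cK (I := G) (D := K)
  (f := fun x => ltrans x (f x)).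
- by move=> x /fP[[_ _ oW] _]; exact: open_ltrans.
- move=> x Kx; exists x => //; apply: ltrans_self.
  by have [[]] := fP _ Kx.
have DK' x : x \in D -> K x by move=> /DK/set_mem.
(* [O] keeps the intersection compact, even when [D] is empty. *)
pose W := O `&` \bigcap_(x in [set` D]) f x.
have WP : is_subgroup W /\ open W.
  split.
    apply: is_subgroupI; first exact: CO_subgroup.
    split=> [x /DK'/fP[[[]]] //|x y Wx' Wy z zD].
    by have [[[_ +] _ _] _] := fP _ (DK' _ zD); apply; [exact: Wx'|exact: Wy].
  apply: openI; first exact: CO_open.
  rewrite bigcap_fset big_seq; apply: big_ind => [||C CD];
    [exact: openT|exact: openI|by have [[]] := fP _ (DK' _ CD)].
have [sW oW] := WP.
have CW : CO G W.
  split=> //; apply: (subclosed_compact _ (CO_compact CO_O)); last by move=> x [].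
  exact: open_subgroup_closed.
(* The chosen neighbourhoods may overlap, but as a set X contains each coset of W once, and distinct
   cosets are disjoint. *)
pose X := \bigcup_(x in [set` D]) [set ltrans x B | B in cosets_in (f x) W].
have fX : finite_set X.
  apply: bigcup_finite => // x xD; apply: finite_image; apply: CO_finite => //.
  by have [] := fP _ (DK' _ xD).
have XW B : X B -> exists r, B = ltrans r W.
  by move=> [x _ [_ [r _ <-] <-]]; exists (x * r)%g; rewrite ltransM.
have Wf x : x \in D -> W `<=` f x by move=> xD y [_]; exact.
exists (\bigcup_(B in X) B); split.
- move=> x /KD[y yD /ltransP fx]; exists (ltrans x W); last exact: ltrans_self.
  exists y => //; exists (ltrans (y^-1 * x)%g W); first by exists (y^-1 * x)%g.
  by rewrite -ltransM mulVKg.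
- move=> x [_ [y yD [_ [r fr <-] <-]]]; rewrite -ltransM => -[w Ww <-].
  have [[sf _ _]] := fP _ (DK' _ yD); apply.
  by exists (r * w)%g; [apply: (sgM sf) => //; exact: (Wf _ yD)|rewrite mulgA].
- by apply: bigcup_open => B /XW[r ->]; exact: open_ltrans.
rewrite (haar_disjoint_cosets hmu sW oW fX XW).
by rewrite (haar_disjoint_cosets hnu sW oW fX XW) cW // muleCA.
Qed.

(** For open N, inner regularity of nu reduces to compact K in N, and an approximating C gives nu K
    <= nu C = c mu C <= c mu N. Outer regularity of mu then passes from open sets to Borel sets. *)
Lemma haar_le mu nu (c : R) (O : set G) :
  hausdorff_space G -> totally_disconnected [set: G] -> CO G O ->
  left_haar mu -> left_haar nu -> 0 < c ->
  (forall W, CO G W -> nu W = (c%:E * mu W)%E) ->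
  forall A : set (borel G), measurable A -> (nu A <= c%:E * mu A)%E.
Proof.
move=> hG tG CO_O hmu hnu c0 cW A mA.
have op N : open (N : set G) -> (nu N <= c%:E * mu N)%E.
  move=> oN; rewrite (haar_inner hnu oN); apply: ge_ereal_sup => _ [K [cK KN] <-].
  have [C [KC CN oC eC]] :=
    haar_compact_open_approx hG tG CO_O hmu hnu cW cK oN KN.
  have mK : measurable (K : set (borel G)).
    rewrite -[K]setCK; apply: measurableC; apply: open_borel.
    by apply: closed_openC; exact: compact_closed.
  apply: (@le_trans _ _ (nu C)).
    by apply: le_measure; rewrite ?inE //; exact: open_borel.
  rewrite eC lee_pmul2l ?lte_fin //.
  by apply: le_measure; rewrite ?inE //; exact: open_borel.
rewrite -lee_pdivrMl //.
rewrite [leRHS](haar_outer hmu mA); apply: le_ereal_inf_tmp => _ [N [oN AN] <-].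
rewrite lee_pdivrMl //; apply: le_trans (op _ oN).
by apply: le_measure; rewrite ?inE //; exact: open_borel.
Qed.

Lemma haar_vec_unique mu nu U O :
  hausdorff_space G -> totally_disconnected [set: G] -> CO G O -> CO G U ->
  left_haar mu -> left_haar nu -> mu O = 1%E -> nu U = 1%E ->
  haar_vec nu = (vol mu U)^-1 *: haar_vec mu.
Proof.
move=> hG tG CO_O CU hmu hnu muO nuU.
have v0 := vol_gt0 hmu CO_O muO CU.
have c0 : 0 < (vol mu U)^-1 by rewrite invr_gt0.
(* Both measures of W are computed from W [&] U, and that of W [&] U from U, where nu is
   normalised. *)
have cW W : CO G W -> vol nu W = (vol mu U)^-1 * vol mu W.
  move=> CW; have [sI _ oI] := CO_setI2 CW CU.
  rewrite (vol_index hnu CW sI oI (@subIsetl _ _ _)).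
  rewrite (vol_index hmu CW sI oI (@subIsetl _ _ _)).
  have := vol_cindex hnu CU nuU CU sI oI (@subIsetr _ _ _).
  rewrite (vol_cindex hmu CO_O muO CU sI oI (@subIsetr _ _ _)).
  rewrite {3}/vol nuU div1r => /(congr1 GRing.inv); rewrite invrK => <-.
  by rewrite invf_div; ring.
have eW W : CO G W -> nu W = ((vol mu U)^-1%:E * mu W)%E.
  move=> CW; rewrite -(fineK (haar_CO_fin hnu CW)) -(fineK (haar_CO_fin hmu CW)).
  by rewrite -EFinM; congr EFin; exact: cW.
have eW' W : CO G W -> mu W = ((vol mu U)%:E * nu W)%E.
  by move=> CW; rewrite eW // muleA -EFinM divff ?gt_eqF // mul1e.
apply/funext => -[A mA']; have mA := set_mem mA'.
rewrite /haar_vec /=; change (fine (nu A) = (vol mu U)^-1 * fine (mu A)).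
(* A positive factor preserves infinite values and [fine] sends them to 0, so the identity of
   extended reals suffices. *)
suff -> : nu A = ((vol mu U)^-1%:E * mu A)%E.
  case: (mu A) => [r||] //=.
    by rewrite mulry gtr0_sg // mul1e mulr0.
  by rewrite mulrNy gtr0_sg // mul1e mulr0.
apply/eqP; rewrite eq_le (haar_le hG tG CO_O) //=.
(* The other inequality is [haar_le] with mu and nu exchanged and the inverse constant. *)
rewrite -(@lee_pmul2l _ (vol mu U)%:E) ?fin_numE // ?lte_fin //.
rewrite muleA -EFinM divff ?gt_eqF // mul1e.
exact: (haar_le hG tG CO_O).
Qed.

(** Conjugation is a left translation, harmless for any left Haar measure, followed by a right
    translation, harmless by unimodularity. *)
Lemma vol_conj mu U g : unimodular R G -> left_haar mu -> CO G U ->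
  vol mu (conj_set g U) = vol mu U.
Proof.
move=> uG hmu CU; rewrite /vol.
have -> : conj_set g U = rtrans (ltrans g U) g^-1.
  rewrite conj_setE /rtrans /ltrans image_comp.
  by apply: eq_imagel => x _ /=.
have oU := CO_open CU.
rewrite uG //; last by apply: open_borel; exact: open_ltrans.
by congr fine; exact: (haar_ltrans hmu g (open_borel oU)).
Qed.

End Haar.

(** * Averages and the standard bimodule *)

HB.instance Definition _ (G : groupType) (M N : gModType G) (k : ghom M N) :=
  GRing.isLinear.Build rat M N _ (ghom_fun k) (ghom_linear k).

Section Stabilisers.
Variables (G : groupType) (Y : gSetType G).

Definition stab (y : Y) : set G := [set g | gact g y = y].

Lemma gactK g (y : Y) : gact g^-1%g (gact g y) = y.
Proof. by rewrite -gactM mulVg gact1. Qed.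

Lemma gactVK g (y : Y) : gact g (gact g^-1%g y) = y.
Proof. by rewrite -gactM mulgV gact1. Qed.

Lemma is_subgroup_stab y : is_subgroup (stab y).
Proof.
split=> [|g h gy hy]; rewrite /stab /=; first exact: gact1.
by rewrite gactM -[in gact h^-1 y]hy gactK.
Qed.

Lemma stab_gact g y : stab (gact g y) = conj_set g (stab y).
Proof.
apply/seteqP; split=> h; rewrite /stab /conj_set /=.
  by rewrite !gactM => ->; rewrite gactK.
by rewrite !gactM => /(congr1 (gact g)); rewrite gactVK.
Qed.

End Stabilisers.

Definition discrete (G : topGroupType) (Y : gSetType G) : Prop :=
  forall y : Y, open (stab y).

Section Average.
Variables (G : topGroupType) (M : gModType G).
Hypothesis dM : discrete M.
Implicit Types (U V W : set G) (m n : M) (g u : G).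

(** The mean of m over its finite U-orbit, that is, the projection of M onto the U-fixed vectors;
    [theta] is built from it. *)
Definition av U m : M :=
  (cindex U (U `&` stab m))%:R^-1 *: csum U (U `&` stab m) (fun r => gact r m).

(** By the tower formula each term is merely repeated |S : W| times, S being the stabiliser of m in
    U. Averages of different vectors can therefore be compared at one common level W. *)
Lemma av_refine U W m : CO G U -> is_subgroup W -> open W -> W `<=` U ->
  W `<=` stab m -> av U m = (cindex U W)%:R^-1 *: csum U W (fun r => gact r m).
Proof.
move=> CU sW oW WU Wm; rewrite /av; set S := U `&` stab m.
have sU := CO_subgroup CU.
have [sS _ oS] : CO G S by apply: CO_setI => //; exact: is_subgroup_stab.
have WS : W `<=` S by move=> x Wx; split; [exact: WU|exact: Wm].
have SU : S `<=` U by move=> x [].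
have UWf := CO_finite CU sW oW.
have SWf := cosets_in_finr SU UWf.
rewrite (cindex_tower sU sS sW WS SU UWf).
rewrite (csum_tower sU sS sW WS SU UWf); last first.
  by move=> r w _ /Wm wm; rewrite gactM wm.
transitivity ((cindex U S * cindex S W)%:R^-1 *: ((cindex S W)%:R *: csum U S (fun r => gact r m)) : M).
  rewrite scalerA natrM invfM -mulrA mulVf ?mulr1 //.
  by rewrite pnatr_eq0 -lt0n cindex_gt0.
congr (_ *: _); rewrite /csum.
have Uf := cosets_in_finl sS sW WS UWf.
rewrite !fsbig_finite // scaler_sumr; apply: eq_big_seq => B.
rewrite in_fset_set // => /set_mem UB; rewrite -fsum_cst //.
apply: eq_fsbigr => C /set_mem SC.
have [[_ Sv] _] := cosets_in_rep sS sW WS SC.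
by rewrite gactM Sv.
Qed.

Lemma av_fixed U m : CO G U -> U `<=` stab m -> av U m = m.
Proof.
move=> CU Um; have [sU _ oU] := CU; rewrite (av_refine CU sU oU) //.
rewrite csum_id // => [|u Uu]; last by rewrite gact1; exact: Um.
rewrite /cindex cosets_in_id // fset_set1 cardfs1 invr1 scale1r.
exact: gact1.
Qed.

Lemma gact_csum U W g (F : G -> M) :
  gact g (csum U W F) = csum U W (fun r => gact g (F r)).
Proof.
rewrite /csum; have [f|nf] := pselect (finite_set (cosets_in U W)).
  by rewrite !fsbig_finite // gact_sum.
(* For infinite U/W the sum runs over the support of the summand, which the injective [gact g]
   preserves. If the support is infinite too, both sums are 0 by convention. *)
have gI : injective (gact g : M -> M).
  by move=> x y /(congr1 (gact g^-1%g)); rewrite !gactK.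
have E : cosets_in U W `&` (fun B => F (xget 1%g B)) @^-1` [set~ 0] =
         cosets_in U W `&` (fun B => gact g (F (xget 1%g B))) @^-1` [set~ 0].
  apply/seteqP; split=> B [cB B0]; split=> // E; apply: B0.
    by apply: gI; rewrite E linear0.
  by rewrite /= E linear0.
have [f|nf'] := pselect (finite_set (cosets_in U W `&` (fun B => F (xget 1%g B)) @^-1` [set~ 0])).
  rewrite fsbig_supp [in RHS]fsbig_supp -E !fsbig_finite //.
  by rewrite gact_sum.
by rewrite !fsbig_dflt ?linear0 // -E.
Qed.

Lemma av_gact U u m : CO G U -> U u -> gact u (av U m) = av U m.
Proof.
move=> CU Uu; rewrite /av gactZ gact_csum; congr (_ *: _).
have sI := is_subgroupI (CO_subgroup CU) (is_subgroup_stab m).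
have F r w : U r -> (U `&` stab m) w -> gact (r * w)%g m = gact r m.
  by move=> _ [_ wm]; rewrite gactM wm.
rewrite -(csum_transl (CO_subgroup CU) sI F Uu).
by apply: eq_fsbigr => B _; rewrite gactM.
Qed.

(** This becomes the compatibility of [theta] with the transition maps of the direct limit. *)
Lemma av_tower U V m : CO G U -> CO G V -> V `<=` U ->
  av U m = (cindex U V)%:R^-1 *: csum U V (fun r => gact r (av V m)).
Proof.
move=> CU CV VU.
have [sU [sV _ oV]] := (CO_subgroup CU, CV).
have CW : CO G (V `&` stab m) by apply: CO_setI => //; exact: is_subgroup_stab.
have [sW _ oW] := CW; have WV : V `&` stab m `<=` V by move=> x [].
have WU := subset_trans WV VU; have UWf := CO_finite CU sW oW.
rewrite (av_refine CU sW oW WU); last by move=> x [].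
rewrite (cindex_tower sU sV sW WV VU UWf) natrM invfM -scalerA; congr (_ *: _).
rewrite (csum_tower sU sV sW WV VU UWf); last first.
  by move=> r w _ [_ wm]; rewrite gactM wm.
have Uf := cosets_in_finl sV sW WV UWf.
rewrite /csum !fsbig_finite // scaler_sumr; apply: eq_bigr => B _.
rewrite /av gactZ gact_csum; congr (_ *: _).
by apply: eq_fsbigr => C _; rewrite gactM.
Qed.

Lemma av_linear U : CO G U -> linear (av U).
Proof.
(* S fixes m and n, hence also a m + n, and serves as common level for the three averages. *)
move=> CU a m n; set S := U `&` (stab m `&` stab n).
have CS : CO G S.
  apply: CO_setI => //; last exact: openI.
  by apply: is_subgroupI; exact: is_subgroup_stab.
have [sS _ oS] := CS; have SU : S `<=` U by move=> x [].
have Uf := CO_finite CU sS oS.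
rewrite !(av_refine CU sS oS SU); try by move=> x [? []].
  rewrite /csum !fsbig_finite // scalerA.
  rewrite [a * _]mulrC -!scalerA -scalerDr; congr (_ *: _).
  by rewrite scaler_sumr -big_split; apply: eq_bigr => B _; rewrite gact_linear.
by move=> x [_ [xm xn]]; rewrite /stab /= gact_linear xm xn.
Qed.

End Average.

Lemma av_ghom (G : topGroupType) (M N : gModType G) (k : ghom M N) U m :
  discrete M -> discrete N -> CO G U -> av U (k m) = k (av U m).
Proof.
move=> dM dN CU.
have CS : CO G (U `&` stab m) by apply: CO_setI => //; exact: is_subgroup_stab.
have [sS _ oS] := CS; have SU : U `&` stab m `<=` U by move=> x [].
rewrite (av_refine dM CU sS oS SU); last by move=> x [].
rewrite (av_refine dN CU sS oS SU); last first.
  by move=> x [_ xm]; rewrite /stab /= -ghom_act xm.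
have Uf := CO_finite CU sS oS.
rewrite linearZZ /csum !fsbig_finite //.
rewrite [in RHS]linear_sum; apply: (congr1 (fun x : N => _ *: x)); apply: eq_bigr => B _ /=.
by rewrite ghom_act.
Qed.

Section OpenStab.
Variables (G : topGroupType) (M : gModType G).

Lemma stab_subgroup_open (Y : gSetType G) (y : Y) (W : set G) :
  is_subgroup W -> open W -> W `<=` stab y -> open (stab y).
Proof.
move=> sW oW; apply: subgroup_open; first exact: is_subgroup_stab.
by apply: open_nbhs_nbhs; split=> //; exact: sg1.
Qed.

Lemma open_stabZD a (m n : M) :
  open (stab m) -> open (stab n) -> open (stab (a *: m + n)).
Proof.
move=> om on; apply: (@stab_subgroup_open _ _ (stab m `&` stab n)).
- by apply: is_subgroupI; exact: is_subgroup_stab.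
- exact: openI.
- by move=> g [gm gn]; rewrite /stab /= gact_linear gm gn.
Qed.

Lemma open_stab0 : open (stab (0 : M)).
Proof.
apply: (@stab_subgroup_open _ _ setT) => //; first exact: openT.
by move=> g _; rewrite /stab /= linear0.
Qed.

Lemma open_stab_sum (I : eqType) (s : seq I) (a : I -> rat) (F : I -> M) :
  (forall i, i \in s -> open (stab (F i))) ->
  open (stab (\sum_(i <- s) a i *: F i)).
Proof.
move=> oF; rewrite big_seq; apply: (big_ind (fun m => open (stab m))).
- exact: open_stab0.
- by move=> m n om on; rewrite -[m]scale1r; exact: open_stabZD.
- move=> i /oF oi; rewrite -[X in stab X]addr0; apply: open_stabZD => //.
  exact: open_stab0.
Qed.

End OpenStab.

Lemma malg_deltaE (Y : choiceType) (x : {malg rat[Y]}) :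
  x = \sum_(y <- msupp x) x@_y *: delta y.
Proof.
have E y : delta y = malg_ext (@delta Y) (delta y) by rewrite malg_ext_delta.
exact: (malg_ind_linear (f := idfun) (g := malg_ext (@delta Y)) E).
Qed.

Lemma malg_discrete (G : topGroupType) (Y : gSetType G) :
  discrete Y -> discrete {malg rat[Y]}.
Proof.
move=> dY x.
rewrite [x]malg_deltaE.
apply: open_stab_sum => y _.
apply: (stab_subgroup_open (is_subgroup_stab y) (dY y)).
by move=> g gy; rewrite /stab /= gact_delta gy.
Qed.

Lemma lquot_lift_linear (M N : lmodType rat) (R : set M) (f : {linear M -> N}) :
  (forall r, R r -> f r = 0) -> linear (@lquot_lift M R N f).
Proof.
move=> fR a p q; rewrite -[p]lreprK -[q]lreprK -linearP !lquot_liftE //.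
exact: linearP.
Qed.

Lemma lproj_rel (M : lmodType rat) (R : set M) x c y :
  R (x - c *: y) -> lproj R x = c *: lproj R y.
Proof.
move=> Rxy; rewrite -linearZZ; apply/lprojP/asboolP.
by exists [:: (1, x - c *: y)]; rewrite big_seq1 scale1r; split=> // p;
  rewrite inE => /eqP ->.
Qed.

Section Bi.
Variable G : topGroupType.
Implicit Types (U V : CO G) (g h u : G).

Definition bicoset U g : Bi G :=
  lproj (@bi_rel G) (delta (bi_coset (mkcoset (val U) g))).

Lemma CO_val U : CO G (val U). Proof. exact: set_mem (valP U). Qed.

Lemma gact_bicoset h U g : gact h (bicoset U g) = bicoset U (h * g)%g.
Proof.
rewrite [LHS](lquot_actE (@bi_rel_stable G)) gact_delta /bicoset.
congr (lproj _ (delta (Tagged _ _))).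
by apply: val_inj; exact/esym/ltransM.
Qed.

Lemma bicoset_eq U g u : val U u -> bicoset U (g * u)%g = bicoset U g.
Proof.
move=> Uu; rewrite /bicoset; congr (lproj _ (delta (bi_coset _))).
apply: val_inj; apply/ltrans_eqP; first exact: (CO_subgroup (CO_val U)).
by rewrite invgM mulgVK; apply: (sgV (CO_subgroup (CO_val U))).
Qed.

Lemma bi_lin_eq (M : lmodType rat) (f f' : {linear Bi G -> M}) :
  (forall U g, f (bicoset U g) = f' (bicoset U g)) -> f =1 f'.
Proof.
move=> ff' x; rewrite -[x]lreprK.
apply: (@malg_ind_linear _ _ (f \o lproj _) (f' \o lproj _)) => -[U [A pA]] /=.
have /set_mem[g _ gA] := pA; have := ff' U g; rewrite /bicoset.
suff -> : mkcoset (val U) g = exist _ A pA by [].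
exact: val_inj.
Qed.

Lemma bi_linear_eq (M : lmodType rat) (f f' : Bi G -> M) :
  linear f -> linear f' ->
  (forall U g, f (bicoset U g) = f' (bicoset U g)) -> f =1 f'.
Proof.
move=> lf lf'.
pose F : {linear Bi G -> M} := HB.pack f (GRing.isLinear.Build _ _ _ _ _ lf).
pose F' : {linear Bi G -> M} := HB.pack f' (GRing.isLinear.Build _ _ _ _ _ lf').
exact: (bi_lin_eq (f := F) (f' := F')).
Qed.

Lemma discrete_Bi : discrete (Bi G).
Proof.
move=> x; rewrite -[x]lreprK.
rewrite [lrepr x]malg_deltaE.
rewrite linear_sum /=.
under eq_bigr do rewrite linearZ /=.
apply: open_stab_sum => -[U [A pA]] _.
have /set_mem[g _ gA] := pA.
have -> : lproj (@bi_rel G) (delta (existT _ U (exist _ A pA))) = bicoset U g.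
  rewrite /bicoset; congr (lproj _ (delta (bi_coset _))).
  exact: val_inj.
have CU := CO_conj g (CO_val U).
apply: (stab_subgroup_open (CO_subgroup CU) (CO_open CU)).
move=> h hU; rewrite /stab /= gact_bicoset.
rewrite -[in RHS](bicoset_eq g hU); congr bicoset.
by rewrite mulgA mulVKg.
Qed.

Section Ext.
Variables (M : lmodType rat) (h : set G -> set G -> M).
Hypothesis hP : forall (U V : set G) g, CO G U -> CO G V -> V `<=` U ->
  h U (ltrans g U) =
  (cindex U V)%:R^-1 *: csum U V (fun r => h V (ltrans (g * r)%g V)).

Let f : bi_gen G -> M := fun y => h (val (tag y)) (val (tagged y)).

(** The defining relations of Bi(G) sum over the type [lcoset (val V)], while [csum] sums over a set
    of subsets of G; [val] is the bijection between the two index sets. *)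
Lemma coset_sumE U V (N : lmodType rat) (F : lcoset (val V) -> N)
    (F' : set G -> N) : val V `<=` val U -> (forall A, F A = F' (val A)) ->
  \sum_(A <- fset_set [set A : lcoset (val V) | (val A `<=` val U)%classic]) F A
  = csum (val U) (val V) (fun r => F' (ltrans r (val V))).
Proof.
move=> VU FF'.
have [sU [sV _ oV]] := (CO_subgroup (CO_val U), CO_val V).
have Uf := CO_finite (CO_val U) sV oV.
have bij : set_bij [set A : lcoset (val V) | (val A `<=` val U)%classic]
    (cosets_in (val U) (val V)) val.
  split.
  - move=> [A pA] /= AU; have /set_mem[g _ gA] := pA; exists g => //.
    by apply: AU; rewrite -gA; exact: ltrans_self.
  - by move=> A B _ _; exact: val_inj.
  - move=> A [r Ur rA]; exists (mkcoset (val V) r) => //= x [v Vv <-].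
    by apply: (sgM sU) => //; exact: VU.
have fin : finite_set [set A : lcoset (val V) | (val A `<=` val U)%classic].
  apply: (sub_finite_set _ (finite_image (fun B => mkcoset (val V) (xget 1%g B)) Uf)).
  move=> [A pA] AU; have /set_mem[g _ gA] := pA.
  exists A; first by have [+ _ _] := bij => /(_ (exist _ A pA)); apply.
  by apply: val_inj; rewrite /= -{1}gA ltrans_xget.
rewrite -fsbig_finite // /csum (reindex_fsbig _ _ _ _ bij).
apply: eq_fsbigr => -[A pA] /set_mem /= AU; rewrite FF' /=.
have /set_mem[g _ gA] := pA; rewrite -gA ltrans_xget //.
Qed.

Lemma bi_ext_rel r : bi_rel r -> malg_ext f r = 0.
Proof.
move=> [U [V [g [VU ->]]]].
rewrite linearB linearZ /= malg_ext_delta (linear_sum (malg_ext f)) /=.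
have E (A : lcoset (val V)) : malg_ext f (delta (bi_coset (gact g A))) =
  h (val V) (ltrans g (val A)) := malg_ext_delta f _.
transitivity (h (val U) (ltrans g (val U)) - (cindex (val U) (val V))%:R^-1 *:
    \sum_(A <- fset_set [set A : lcoset (val V) | (val A `<=` val U)%classic])
      h (val V) (ltrans g (val A))).
  by congr (_ - _ *: _); apply: eq_bigr => A _; exact: E.
rewrite (@coset_sumE U V M _ (fun A => h (val V) (ltrans g A))) //.
apply/eqP; rewrite subr_eq0 (hP g (CO_val U) (CO_val V) VU); apply/eqP.
by congr (_ *: _); apply: eq_fsbigr => A _; rewrite ltransM.
Qed.

Lemma bi_extE U g : bi_ext h (bicoset U g) = h (val U) (ltrans g (val U)).
Proof. by rewrite /bi_ext lquot_liftE; [exact: malg_ext_delta|exact: bi_ext_rel]. Qed.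

Lemma bi_ext_linear : linear (bi_ext h).
Proof. by apply: lquot_lift_linear; exact: bi_ext_rel. Qed.

End Ext.

Lemma bicoset_refine U V g : val V `<=` val U -> bicoset U g =
  (cindex (val U) (val V))%:R^-1 *:
    csum (val U) (val V) (fun r => bicoset V (g * r)%g).
Proof.
move=> VU.
have rel : @bi_rel G (delta (bi_coset (mkcoset (val U) g)) -
   (cindex (val U) (val V))%:R^-1 *:
     \sum_(A <- fset_set [set A : lcoset (val V) | (val A `<=` val U)%classic])
      delta (bi_coset (gact g A))) by exists U, V, g.
apply: (etrans (lproj_rel rel)).
apply: (congr1 (fun x : Bi G => (cindex (val U) (val V))%:R^-1 *: x)).
rewrite linear_sum.
(* [coset_sumE] asks for a function of arbitrary subsets of G; the value 0 off the cosets of V is a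
   default. *)
pose F' A := lproj (@bi_rel G)
  (if pselect (exists x : G, A = ltrans x (val V)) is left P
   then delta (bi_coset (mkcoset (val V) (g * proj1_sig (cid P))%g)) else 0).
have sV := CO_subgroup (CO_val V).
have F'E x : F' (ltrans x (val V)) = bicoset V (g * x)%g.
  rewrite /F'; case: pselect => [P|[]]; last by exists x.
  case: cid => y /= yx; rewrite /bicoset; congr (lproj _ (delta (bi_coset _))).
  by apply: val_inj => /=; rewrite !ltransM yx.
rewrite (coset_sumE (F' := F')) //; first by apply: eq_fsbigr => B _; exact: F'E.
move=> [A pA]; have /set_mem[x _ xA] := pA; transitivity (bicoset V (g * x)%g); last by rewrite -F'E xA.
rewrite /bicoset; congr (lproj _ (delta (bi_coset _))).
by apply: val_inj => /=; rewrite ltransM xA.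
Qed.

Section Theta.
Variable M : gModType G.
Hypothesis dM : discrete M.

(** The representative of gU picked by [xget] is g u with u in U, and u disappears because the
    average is U-invariant. *)
Lemma theta_compat (m : M) (g : G) (U : set G) : CO G U ->
  let W := U `&` stab m in
  (cindex U W)%:R^-1 *: \sum_(B <- fset_set (cosets_in U W))
      gact (xget 1%g (ltrans g U) * xget 1%g B)%g m = gact g (av U m).
Proof.
move=> CU W; have [u Uu ->] := ltrans_xgetM g (CO_subgroup CU).
rewrite -[av U m](av_gact m CU Uu) -gactM [in RHS]/av gactZ gact_csum.
have CW : CO G W by apply: CO_setI => //; exact: is_subgroup_stab.
have Uf := CO_finite CU (CO_subgroup CW) (CO_open CW).
rewrite /csum -fsbig_finite //; congr (_ *: _).
by apply: eq_fsbigr => B _; exact: gactM.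
Qed.

Lemma theta_hP (m : M) (U V : set G) g : CO G U -> CO G V -> V `<=` U ->
  let h := fun X A : set G => let W := X `&` [set g | gact g m = m] in
    (cindex X W)%:R^-1 *: \sum_(B <- fset_set (cosets_in X W))
      gact (xget 1%g A * xget 1%g B)%g m in
  h U (ltrans g U) =
  (cindex U V)%:R^-1 *: csum U V (fun r => h V (ltrans (g * r)%g V)).
Proof.
move=> CU CV VU /=; rewrite theta_compat // (av_tower dM m CU CV VU).
rewrite gactZ gact_csum; congr (_ *: _); apply: eq_fsbigr => B _.
by rewrite theta_compat // gactM.
Qed.

Lemma theta_bicoset U g (m : M) : theta (bicoset U g) m = gact g (av (val U) m).
Proof.
rewrite /theta bi_extE; last by move=> *; exact: theta_hP.
exact: theta_compat (CO_val U).
Qed.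

Lemma theta_linearl (m : M) : linear (fun x : Bi G => theta x m).
Proof. by apply: bi_ext_linear => *; exact: theta_hP. Qed.

Lemma theta_linearr (x : Bi G) : linear (fun m : M => theta x m).
Proof.
move=> a m n.
pose f y := a *: theta y m + theta y n.
have lf : linear f.
  by move=> b y z; rewrite /f !theta_linearl !scalerDr !scalerA mulrC addrACA.
apply: (bi_linear_eq (theta_linearl (a *: m + n)) lf) => U g.
by rewrite /f !theta_bicoset av_linear ?gact_linear //; exact: CO_val.
Qed.

End Theta.
End Bi.

(** * The trace and the rank *)

Section Tau.
Variables (R : realType) (G : topGroupType) (O : set G).
Variable mu : {measure set (borel G) -> \bar R}.
Hypotheses (uG : unimodular R G) (CO_O : CO G O).
Hypotheses (hmu : left_haar mu) (muO : mu O = 1%E).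
Implicit Types (U V W : CO G) (g h : G).

Definition tau (x : Bi G) : rat^o := psi O x 1%g.

Lemma fsum_unique (I : choiceType) (A : set I) (P : I -> bool) (b : bool) :
  (b -> exists2 i, A i & P i /\ forall j, A j -> P j -> j = i) ->
  (forall i, A i -> P i -> b) ->
  \sum_(i \in A) ((P i)%:R : rat) = b%:R.
Proof.
case: b => [/(_ isT)[i Ai [Pi uniqi]] _|_ nP]; last first.
  by apply: fsbig1 => i /nP; case: (P i) => // /(_ isT).
rewrite -(fsbig_widen [set i]) ?fsbig_set1 ?Pi //.
- by move=> _ ->.
- move=> j [Aj ij] /=; case Pj : (P j) => //; case: ij.
  exact: uniqi.
Qed.

(** After embedding the rationals into R both sides are quotients of volumes. *)
Lemma gindex_refine (U V : set G) : CO G U -> CO G V -> V `<=` U ->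
  gindex O V = (cindex U V)%:R * gindex O U.
Proof.
move=> CU CV VU; apply: (fmorph_inj (ratr : rat -> R)).
rewrite [in RHS]rmorphM /= ratr_nat !(ratr_gindex hmu CO_O muO) //.
have [sV _ oV] := CV.
rewrite (vol_cindex hmu CO_O muO CU sV oV VU).
have := vol_gt0 hmu CO_O muO CU; have := vol_gt0 hmu CO_O muO CV.
by move=> /gt_eqF v /gt_eqF u; field; rewrite u v.
Qed.

(** The indicator of gU is the sum of those of the cosets grV, and the factor |U : V| by which |O :
    V| exceeds |O : U| cancels the normalisation of the transition map. *)
Lemma psi_hP (U V : set G) g : CO G U -> CO G V -> V `<=` U ->
  gindex O U *: (\1_(ltrans g U) : G -> rat^o) =
  (cindex U V)%:R^-1 *:
    csum U V (fun r => gindex O V *: (\1_(ltrans (g * r)%g V) : G -> rat^o)).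
Proof.
move=> CU CV VU; have [[sU _ _] [sV _ oV]] := (CU, CV).
have Uf := CO_finite CU sV oV.
apply/funext => x; rewrite /csum fsbig_finite // -scaler_sumr scalerA.
rewrite (gindex_refine CU CV VU) mulrA mulVf ?mul1r; last first.
  by rewrite pnatr_eq0 -lt0n cindex_gt0.
rewrite !fctE fct_sumE /indic -fsbig_finite //; congr (_ * _).
apply/esym/fsum_unique.
- move=> /set_mem/ltransP Ux; exists (ltrans (g^-1 * x)%g V); first by exists (g^-1 * x)%g.
  split.
    have [v Vv ->] := ltrans_xgetM (g^-1 * x)%g sV.
    apply/mem_set/ltransP; rewrite mulgA mulVKg invgM mulgVK.
    exact: (sgV sV).
  move=> B UB /set_mem/ltransP Vx; have [Ub <-] := cosets_in_rep sU sV VU UB.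
  by apply/ltrans_eqP => //; rewrite mulgA -invgM.
- move=> B UB /set_mem/ltransP Vx; have [Ub _] := cosets_in_rep sU sV VU UB.
  apply/mem_set/ltransP; move: Vx; rewrite invgM -mulgA => /VU.
  by move=> /(sgM sU Ub); rewrite mulVKg.
Qed.

Lemma tau_linear : linear tau.
Proof.
move=> a x y; rewrite /tau /psi bi_ext_linear //.
by move=> U V g CU CV VU; exact: psi_hP.
Qed.

Lemma tau_sum (I : Type) (s : seq I) (F : I -> Bi G) :
  tau (\sum_(i <- s) F i) = \sum_(i <- s) tau (F i).
Proof.
pose f : {linear Bi G -> rat^o} := HB.pack tau
  (GRing.isLinear.Build _ _ _ _ _ tau_linear).
exact: (linear_sum f).
Qed.

Lemma tauZ a x : tau (a *: x) = a * tau x.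
Proof.
pose f : {linear Bi G -> rat^o} := HB.pack tau
  (GRing.isLinear.Build _ _ _ _ _ tau_linear).
exact: (linearZZ f).
Qed.

Lemma tau_bicoset U g : tau (bicoset U g) = gindex O (val U) * (g \in val U)%:R.
Proof.
rewrite /tau /psi bi_extE; last by move=> *; exact: psi_hP.
rewrite !fctE /indic; congr (_ * (nat_of_bool _)%:R).
have sU := CO_subgroup (CO_val U).
apply/idP/idP => [/set_mem/ltransP|/set_mem Ug]; last first.
  by apply/mem_set/ltransP; rewrite mulg1; exact: (sgV sU).
by rewrite mulg1 => /(sgV sU); rewrite invgK => /mem_set.
Qed.

Section SameLevel.
Variable W : CO G.

(** [meets g h] says that h lies in the double coset W g^-1 W. [J h] below is the stabiliser of the
    coset hW in W. *)
Let meets g h := `[< exists2 w, val W w & val W (g * w * h)%g >].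
Let J h := val W `&` conj_set h (val W).

Let CO_J h : CO G (J h).
Proof. exact: CO_setI2 (CO_val W) (CO_conj h (CO_val W)). Qed.

Let meetsC g h : meets g h -> meets h g.
Proof.
move=> /asboolP[w Ww Wg]; apply/asboolP.
have sW := CO_subgroup (CO_val W).
exists (g * w * h)^-1%g; first exact: (sgV sW).
by rewrite !invgM !mulgA mulgV mul1g mulgVK; exact: (sgV sW).
Qed.

(** Pairing gW with hW gives the mean of the cosets gwhW over w in W/J(h). They are distinct, so at
    most one of them is W, and [tau] vanishes on all cosets of W but W itself. *)
Let tau_theta_same g h : tau (theta (bicoset W g) (bicoset W h)) =
  (cindex (val W) (J h))%:R^-1 * gindex O (val W) * (meets g h)%:R.
Proof.
have sW := CO_subgroup (CO_val W); have [sJ _ oJ] := CO_J h.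
have JW : J h `<=` val W by move=> x [].
have Jh : J h `<=` stab (bicoset W h).
  move=> x [_ Wx]; rewrite /stab /= gact_bicoset -[RHS](bicoset_eq _ Wx).
  by rewrite !mulgA mulgV mul1g.
have Uf := CO_finite (CO_val W) sJ oJ.
rewrite theta_bicoset; last exact: discrete_Bi.
rewrite (av_refine (discrete_Bi (G := G)) (CO_val W) sJ oJ JW Jh).
rewrite gactZ gact_csum tauZ /csum fsbig_finite // tau_sum.
rewrite -mulrA; congr (_ * _).
transitivity (\sum_(B \in cosets_in (val W) (J h))
  (gindex O (val W) * ((g * xget 1%g B * h)%g \in val W)%:R)).
  rewrite fsbig_finite //; apply: eq_bigr => B _.
  by rewrite !gact_bicoset -tau_bicoset mulgA.
rewrite -mulr_fsumr; congr (_ * _); apply: fsum_unique.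
- move=> /asboolP[w Ww Wg]; exists (ltrans w (J h)); first by exists w.
  split.
    have [j [_ Wj] ->] := ltrans_xgetM w sJ; apply/mem_set.
    rewrite (_ : (g * (w * j) * h = (g * w * h) * (h^-1 * j * h))%g).
      exact: (sgM sW).
    by rewrite !mulgA mulgK.
  move=> B WB /set_mem Wb; have [WB' <-] := cosets_in_rep sW sJ JW WB.
  apply/esym/ltrans_eqP => //; split; first by apply: (sgM sW) => //; exact: (sgV sW).
  rewrite /conj_set /=.
  rewrite (_ : (h^-1 * (w^-1 * xget 1 B) * h = (g * w * h)^-1 * (g * xget 1 B * h))%g).
    by apply: (sgM sW) => //; exact: (sgV sW).
  by rewrite !invgM !mulgA mulgVK.
- move=> B WB /set_mem Wb; have [WB' _] := cosets_in_rep sW sJ JW WB.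
  by apply/asboolP; exists (xget 1%g B).
Qed.

(* [meets g h] is symmetric, and when it holds [J g] is conjugate to [J h]. *)
Lemma tau_theta_sameC g h :
  tau (theta (bicoset W g) (bicoset W h)) =
  tau (theta (bicoset W h) (bicoset W g)).
Proof.
apply: (etrans (tau_theta_same g h)); apply/esym/(etrans (tau_theta_same h g)).
have sW := CO_subgroup (CO_val W).
have E : meets h g = meets g h by apply/idP/idP; exact: meetsC.
rewrite E; apply/esym; case m : (meets g h); last by rewrite !mulr0.
congr (_^-1 * _ * _); apply: (fmorph_inj (ratr : rat -> R)).
rewrite /= !ratr_nat.
have [[sJ _ oJ] [sJ' _ oJ']] := (CO_J h, CO_J g).
rewrite (vol_cindex hmu CO_O muO (CO_val W) sJ oJ) //; last by move=> x [].
rewrite (vol_cindex hmu CO_O muO (CO_val W) sJ' oJ') //; last by move=> x [].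
congr (_ / _); move/asboolP : m => [w Ww Wg].
(* Conjugation by gw takes W to gWg^-1, since w is in W, and takes hWh^-1 to W, since gwh is in W;
   so it takes [J h] to [J g]. *)
rewrite -(vol_conj (g * w)%g uG hmu (CO_J h)); congr vol.
have cW y x : val W y -> val W (y^-1 * x * y)%g <-> val W x.
  by move=> Wy; rewrite (sgMr sW _ Wy) (sgMl sW) //; exact: (sgV sW).
apply/seteqP; split=> x; rewrite /J /conj_set /= !invgM -!mulgA => -[Wx Wgx].
  by split; [apply/(cW _ _ Wg)|apply/(cW _ _ Ww)]; rewrite ?invgM -!mulgA.
split; first by move/(cW _ _ Ww) : Wgx; rewrite -!mulgA.
by move/(cW _ _ Wg) : Wx; rewrite !invgM -!mulgA.
Qed.

End SameLevel.

Lemma bi_eq_refine (f f' : Bi G -> rat^o) U V g : linear f -> linear f' ->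
  val V `<=` val U ->
  (forall h, f (bicoset V h) = f' (bicoset V h)) -> f (bicoset U g) = f' (bicoset U g).
Proof.
move=> lf lf' VU ff'.
pose F : {linear Bi G -> rat^o} := HB.pack f (GRing.isLinear.Build _ _ _ _ _ lf).
pose F' : {linear Bi G -> rat^o} := HB.pack f' (GRing.isLinear.Build _ _ _ _ _ lf').
change (F (bicoset U g) = F' (bicoset U g)).
rewrite (bicoset_refine g VU) !linearZZ; congr (_ *: _).
have [sV _ oV] := CO_val V; have Uf := CO_finite (CO_val U) sV oV.
rewrite /csum fsbig_finite // !linear_sum.
by apply: eq_bigr => B _; exact: ff'.
Qed.

Lemma tau_theta_linearl (y : Bi G) : linear (fun x : Bi G => tau (theta x y) : rat^o).
Proof.
by move=> a x x'; rewrite (theta_linearl (discrete_Bi (G := G))) tau_linear.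
Qed.

Lemma tau_theta_linearr (y : Bi G) : linear (fun x : Bi G => tau (theta y x) : rat^o).
Proof.
by move=> a x x'; rewrite (theta_linearr (discrete_Bi (G := G))) tau_linear.
Qed.

(** A coset of U or of V is an average of cosets of their intersection, so bilinearity reduces the
    symmetry to two cosets of one subgroup. *)
Lemma tau_thetaC (x y : Bi G) : tau (theta x y) = tau (theta y x).
Proof.
have [fl fr] := (tau_theta_linearl, tau_theta_linearr).
apply: (bi_linear_eq (fl y) (fr y)) => U g.
apply: (bi_linear_eq (fr (bicoset U g)) (fl (bicoset U g))) => V h.
have pW : val U `&` val V \in CO G.
  by apply/mem_set; exact: CO_setI2 (CO_val U) (CO_val V).
pose W : CO G := exist (fun A => A \in CO G) _ pW.
have WU : val W `<=` val U by move=> x' [].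
have WV : val W `<=` val V by move=> x' [].
apply: (@bi_eq_refine _ _ V W h (fr (bicoset U g)) (fl (bicoset U g)) WV) => h'.
apply: (@bi_eq_refine _ _ U W g (fl (bicoset W h')) (fr (bicoset W h')) WU) => g'.
exact: tau_theta_sameC.
Qed.

End Tau.

Section Ghom.
Variable G : groupType.

Definition idghom (M : gModType G) : ghom M M :=
  @GHom G M M idfun (fun _ _ _ => erefl) (fun _ _ => erefl).

Fact comp_ghom_linear (M N P : gModType G) (f : ghom N P) (h : ghom M N) :
  linear (f \o h).
Proof. by move=> a x y; rewrite /= !linearP. Qed.

Fact comp_ghom_act (M N P : gModType G) (f : ghom N P) (h : ghom M N) g x :
  (f \o h) (gact g x) = gact g ((f \o h) x).
Proof. by rewrite /= !ghom_act. Qed.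

Definition comp_ghom (M N P : gModType G) (f : ghom N P) (h : ghom M N) :
  ghom M P := GHom (comp_ghom_linear f h) (comp_ghom_act f h).

Fact add_ghom_linear (M N : gModType G) a (f h : ghom M N) :
  linear (fun x => f x + a *: h x).
Proof.
move=> b x y; rewrite !ghom_linear !scalerDr !scalerA [a * b]mulrC.
by rewrite addrACA.
Qed.

Fact add_ghom_act (M N : gModType G) a (f h : ghom M N) g x :
  f (gact g x) + a *: h (gact g x) = gact g (f x + a *: h x).
Proof. by rewrite gactD gactZ !ghom_act. Qed.

Definition add_ghom (M N : gModType G) a (f h : ghom M N) : ghom M N :=
  GHom (add_ghom_linear a f h) (add_ghom_act a f h).

Fact zero_ghom_linear (M N : gModType G) : linear (fun x : M => 0 : N).
Proof. by move=> a x y; rewrite scaler0 addr0. Qed.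

Fact zero_ghom_act (M N : gModType G) g (x : M) : (0 : N) = gact g 0.
Proof. by rewrite linear0. Qed.

Definition zero_ghom (M N : gModType G) : ghom M N :=
  GHom (@zero_ghom_linear M N) (@zero_ghom_act M N).

End Ghom.

Lemma theta_ghom (G : topGroupType) (M N : gModType G) (k : ghom M N)
    (x : Bi G) (m : M) : discrete M -> discrete N ->
  theta x (k m) = k (theta x m).
Proof.
move=> dM dN; have lf : linear (fun x : Bi G => k (theta x m)).
  by move=> a y z; rewrite (theta_linearl dM) linearP.
apply: (bi_linear_eq (theta_linearl dN (k m)) lf) => U g.
by rewrite !theta_bicoset // ghom_act av_ghom //; exact: CO_val.
Qed.

Lemma disMod_discrete (G : topGroupType) (M : disModType G) : discrete M.
Proof. by move=> m; exact: stab_open. Qed.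

Section Trace.
Variables (R : realType) (G : topGroupType) (O : set G).
Variable mu : {measure set (borel G) -> \bar R}.
Hypotheses (uG : unimodular R G) (CO_O : CO G O).
Hypotheses (hmu : left_haar mu) (muO : mu O = 1%E).
Implicit Types (P Q : disModType G).

(** If [s] represents the identity, the pairs (phi, f p) represent the endomorphism f, by naturality
    of [theta]; this is the trace of f in units of the Haar vector. *)
Definition tr_end P (s : seq (ghom P (Bi G) * P)) (f : P -> P) : rat :=
  \sum_(u <- s) tau O (u.1 (f u.2)).

Let tau_lin := tau_linear CO_O hmu muO.
Let tau_sum := @tau_sum _ _ _ _ CO_O hmu muO.

(** Expanding f p through [t] on one side and h q through [s] on the other yields the same double
    sum of values of the trace form, with its two arguments exchanged. *)
Lemma tr_end_swap P Q (s : seq (ghom P (Bi G) * P)) (t : seq (ghom Q (Bi G) * Q)) (f : ghom P Q) (h : ghom Q P) : xi_id s -> xi_id t ->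
  tr_end s (fun x => h (f x)) = tr_end t (fun y => f (h y)).
Proof.
move=> xs xt; have [[dP dQ] dB] := (@disMod_discrete _ P, @disMod_discrete _ Q, discrete_Bi (G := G)).
rewrite /tr_end.
have E1 (u : ghom P (Bi G) * P) : tau O (u.1 (h (f u.2))) =
    \sum_(v <- t) tau O (theta (v.1 (f u.2)) (u.1 (h v.2))).
  rewrite -tau_sum -[in LHS](xt (f u.2)); congr tau; rewrite !linear_sum.
  apply: eq_bigr => v _.
  exact/esym/(theta_ghom (comp_ghom u.1 h) (v.1 (f u.2)) v.2 dQ dB).
have E2 (v : ghom Q (Bi G) * Q) : tau O (v.1 (f (h v.2))) =
    \sum_(u <- s) tau O (theta (u.1 (h v.2)) (v.1 (f u.2))).
  rewrite -tau_sum -[in LHS](xs (h v.2)); congr tau; rewrite !linear_sum.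
  apply: eq_bigr => u _.
  exact/esym/(theta_ghom (comp_ghom v.1 f) (u.1 (h v.2)) u.2 dP dB).
rewrite (eq_bigr _ (fun u _ => E1 u)) (eq_bigr _ (fun v _ => E2 v)) exchange_big.
apply: eq_bigr => v _; apply: eq_bigr => u _.
exact: (tau_thetaC uG CO_O hmu muO).
Qed.

Lemma HS_rankE P (s : seq (ghom P (Bi G) * P)) : xi_id s ->
  HS_rank O mu P = ratr (tr_end s idfun) *: haar_vec mu.
Proof.
move=> xs; rewrite /HS_rank.
have tE (t : seq (ghom P (Bi G) * P)) : \sum_(u <- t) trace O mu (u.1 u.2) =
    ratr (tr_end t idfun) *: haar_vec mu.
  by rewrite /trace -scaler_suml -rmorph_sum.
apply: xget_unique; first by exists s => //; rewrite tE.
move=> _ [t xt ->]; rewrite tE; congr (ratr _ *: _).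
(* With both maps the identity, the trace property says that the rank does not depend on the
   representation of id_P. *)
exact: (@tr_end_swap _ _ t s (idghom P) (idghom P) xt xs).
Qed.

Lemma tr_endD P (s : seq (ghom P (Bi G) * P)) (f h : P -> P) a :
  tr_end s (fun x => f x + a *: h x) = tr_end s f + a * tr_end s h.
Proof.
rewrite /tr_end mulr_sumr -big_split; apply: eq_bigr => u _ /=.
by rewrite [f _ + _]addrC ghom_linear tau_lin addrC.
Qed.

(** A dual basis is transported to a retract by composing its forms with h and applying f to its
    vectors. *)
Lemma xi_id_retract P Q (s : seq (ghom Q (Bi G) * Q)) (f : ghom Q P) (h : ghom P Q) : xi_id s ->
  (forall x, f (h x) = x) ->
  xi_id [seq (comp_ghom u.1 h, f u.2) | u <- s].
Proof.
move=> xs fh p; rewrite big_map -[RHS]fh -[h p in RHS](xs (h p)) linear_sum.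
by apply: eq_bigr => u _ /=; rewrite theta_ghom //; exact: disMod_discrete.
Qed.

End Trace.

Definition perm_mod (G : topGroupType) (Y : gSetType G) (dY : discrete Y) :
  disModType G := HB.pack_for (disModType G) {malg rat[Y]}
    (isDiscrete.Build G {malg rat[Y]} (malg_discrete dY)).

Section PermGhom.
Variables (G : groupType) (Y : gSetType G) (M : gModType G) (h : Y -> M).
Hypothesis hP : forall g y, h (gact g y) = gact g (h y).

Fact perm_ghom_act g (x : {malg rat[Y]}) :
  malg_ext h (gact g x) = gact g (malg_ext h x).
Proof.
pose f : {linear {malg rat[Y]} -> M} := (malg_ext h \o gact g : {malg rat[Y]} -> M).
pose f' : {linear {malg rat[Y]} -> M} := (gact g \o malg_ext h : {malg rat[Y]} -> M).
apply: (malg_ind_linear (f := f) (g := f')) => y.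
by rewrite /= gact_delta !malg_ext_delta hP.
Qed.

Definition perm_ghom : ghom {malg rat[Y]} M :=
  @GHom G {malg rat[Y]} M (malg_ext h) (malg_ext_linear h) perm_ghom_act.

End PermGhom.

Section PermTrace.
Variables (G : topGroupType) (Y : gSetType G).
Hypothesis CO_Y : forall y : Y, CO G (stab y).

Lemma CO_discrete : discrete Y. Proof. by move=> y; exact: CO_open. Qed.

Definition CO_stab (y : Y) : CO G := exist (fun A => A \in CO G) _ (mem_set (CO_Y y)).

(** The coordinate form gx |-> g G_x at the orbit of x, extended by 0. The g picked by [cid] is
    determined up to right multiplication by G_x, hence its coset is well defined. *)
Definition orbit_coset (x y : Y) : Bi G :=
  if pselect (exists g, gact g x = y) is left e
  then bicoset (CO_stab x) (sval (cid e)) else 0.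

Lemma orbit_cosetE (x : Y) g : orbit_coset x (gact g x) = bicoset (CO_stab x) g.
Proof.
rewrite /orbit_coset; case: pselect => [e|[]]; last by exists g.
case: cid => h /= hg; rewrite -[h](mulVKg g) bicoset_eq //=.
by rewrite /stab /= gactM hg gactK.
Qed.

Lemma orbit_coset0 (x y : Y) : ~ (exists g, gact g x = y) -> orbit_coset x y = 0.
Proof. by rewrite /orbit_coset; case: pselect. Qed.

Lemma orbit_coset_act (x : Y) h y :
  orbit_coset x (gact h y) = gact h (orbit_coset x y).
Proof.
have [[g <-]|ny] := pselect (exists g, gact g x = y).
  by rewrite -gactM !orbit_cosetE gact_bicoset.
rewrite !orbit_coset0 ?linear0 // => -[g gx]; apply: ny.
by exists (h^-1 * g)%g; rewrite gactM gx gactK.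
Qed.

Definition orbit_fun (x : Y) : ghom {malg rat[Y]} (Bi G) :=
  perm_ghom (orbit_coset_act x).

Definition orbit_system (r : seq Y) : Prop :=
  (forall y, exists2 x, x \in r & exists g, gact g x = y) /\
  (forall x x' g, x \in r -> x' \in r -> gact g x = x' -> x = x').

(** On gx only the form of the orbit of x is nonzero, and pairing its value g G_x with x gives gx
    because G_x fixes x. *)
Lemma perm_xi (r : seq Y) : uniq r -> orbit_system r ->
  @xi_id G (perm_mod CO_discrete) [seq (orbit_fun x, delta x) | x <- r].
Proof.
move=> ur [rex runi].
have dY := malg_discrete CO_discrete.
pose F (p : {malg rat[Y]}) : {malg rat[Y]} :=
  \sum_(x <- r) theta (orbit_fun x p) (delta x).
have lF : linear F.
  move=> a p q; rewrite /F scaler_sumr -big_split; apply: eq_bigr => x _.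
  by rewrite linearP (theta_linearl dY).
pose FL : {linear {malg rat[Y]} -> {malg rat[Y]}} :=
  HB.pack F (GRing.isLinear.Build _ _ _ _ _ lF).
move=> p; rewrite big_map.
apply: (malg_ind_linear (f := FL) (g := idfun)) => y /=.
have [x xr [g <-]] := rex y.
have E x' y' : orbit_fun x' (delta y') = orbit_coset x' y' := malg_ext_delta _ _.
have T1 : theta (orbit_fun x (delta (gact g x))) (delta x : {malg rat[Y]}) =
    gact g (delta x).
  rewrite (etrans (E _ _) (orbit_cosetE _ _)).
  apply: (etrans (theta_bicoset dY _ _ _)); congr (gact g _).
  apply: av_fixed => //; first exact: CO_Y.
  by move=> h hx; rewrite /stab /= gact_delta hx.
have T0 x' : x' \in r -> x' != x ->
    theta (orbit_fun x' (delta (gact g x))) (delta x' : {malg rat[Y]}) = 0.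
  move=> x'r x'x; rewrite E orbit_coset0; last first.
    move=> [h hx']; move/eqP: x'x; apply.
    by apply: (runi _ _ (g^-1 * h)%g) => //; rewrite gactM hx' gactK.
  have := theta_linearl dY (delta x') (-1) 0 0.
  by rewrite !scaleN1r !addNr.
rewrite -[RHS]gact_delta -[RHS]addr0 /F.
apply: (etrans (bigD1_seq x xr ur)); apply: (f_equal2 _ T1).
by apply: big1_seq => x' /andP[x'x x'r]; exact: T0.
Qed.

Lemma perm_tr (R : realType) (O : set G) (mu : {measure set (borel G) -> \bar R}) (r : seq Y) :
  CO G O -> left_haar mu -> mu O = 1%E ->
  @tr_end G O (perm_mod CO_discrete) [seq (orbit_fun x, delta x) | x <- r] idfun =
  \sum_(x <- r) gindex O (stab x).
Proof.
move=> CO_O hmu muO; rewrite /tr_end big_map; apply: eq_bigr => x _ /=.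
have E : orbit_fun x (delta x) = bicoset (CO_stab x) 1%g.
  by rewrite -orbit_cosetE gact1; exact: malg_ext_delta.
apply: (etrans (congr1 (tau O) E)).
apply: (etrans (tau_bicoset CO_O hmu muO _ _)); rewrite mem_set ?mulr1 //.
exact: (sg1 (is_subgroup_stab x)).
Qed.

End PermTrace.

(** Lifting the identity along a presentation makes P a retract of a permutation module, where a
    dual basis is explicit. *)
Lemma projective_xi (G : topGroupType) (P : disModType G) :
  fin_gen P -> projective P -> exists s, @xi_id G P s.
Proof.
move=> [n [U [f fonto]]] projP.
pose Y : gSetType G := coprod (fun i => lcoset (val (U i))).
pose b (i : 'I_n) : Y :=
  Tagged (fun i => lcoset (val (U i)) : Type) (mkcoset (val (U i)) 1%g).
have bE (y : Y) : exists i g, gact g (b i) = y.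
  case: y => i [A pA]; have /set_mem[g _ gA] := pA; exists i, g.
  apply: (congr1 (Tagged (fun i => lcoset (val (U i)) : Type))).
  by apply: val_inj => /=; rewrite -ltransM mulg1.
have sb i : stab (b i) = val (U i).
  have sU := CO_subgroup (CO_val (U i)).
  apply/seteqP; split=> h; rewrite /stab /=.
    move=> /eqP; rewrite -tag_eqE /tag_eq /= eqxx /= tagged_asE.
    by move=> /eqP/(congr1 val) /=; rewrite ltrans1 ltrans_id.
  move=> Uh; apply: (congr1 (Tagged (fun i => lcoset (val (U i)) : Type))).
  by apply: val_inj => /=; rewrite ltrans1; exact/ltrans_id.
have CO_Y (y : Y) : CO G (stab y).
  have [i [g <-]] := bE y; rewrite stab_gact; apply: CO_conj.
  by rewrite sb; exact: CO_val.
have [h fh] := projP (perm_mod (CO_discrete CO_Y)) P f (idghom P) fonto.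
pose r : seq Y := [seq b i | i <- enum 'I_n].
have ur : uniq r.
  by rewrite map_inj_uniq ?enum_uniq // => i j /(congr1 (@tag _ _)).
have sr : orbit_system r.
  split=> [y|x x' g].
    by have [i [g <-]] := bE y; exists (b i); [rewrite map_f ?mem_enum|exists g].
  move=> /mapP[i _ ->] /mapP[j _ ->] /(congr1 (@tag _ _)) /= ij.
  by rewrite ij.
refine (ex_intro _ _ (@xi_id_retract G P (perm_mod (CO_discrete CO_Y)) _ f h
  (perm_xi (CO_Y := CO_Y) ur sr) fh)).
Qed.

(** * Independence of the resolution *)

(** The invariant [I] records what the next map of a chain map or homotopy needs in order to
    exist. *)
Lemma dependent_choice_seq (T : nat -> Type) (I : forall k, T k -> Prop)
    (Rl : forall k, T k -> T k.+1 -> Prop) (x0 : T 0%N) : I 0%N x0 ->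
  (forall k x, I k x -> exists y, I k.+1 y /\ Rl k x y) ->
  exists f : forall k, T k, f 0%N = x0 /\ forall k, Rl k (f k) (f k.+1).
Proof.
move=> I0 step.
pose next k (x : {x : T k | I k x}) : {y : T k.+1 | I k.+1 y} :=
  let e := cid (step k (sval x) (svalP x)) in exist _ (sval e) (proj1 (svalP e)).
pose F := fix F k : {x : T k | I k x} :=
  if k is k'.+1 then next k' (F k') else exist _ x0 I0.
exists (fun k => sval (F k)); split=> // k.
exact: (proj2 (svalP (cid (step k (sval (F k)) (svalP (F k)))))).
Qed.

Lemma ghomB (G : groupType) (M N : gModType G) (k : ghom M N) x y :
  k (x - y) = k x - k y.
Proof. exact: (linearB k). Qed.

Lemma ghom0 (G : groupType) (M N : gModType G) (k : ghom M N) : k 0 = 0.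
Proof. exact: (linear0 k). Qed.

Section Image.
Variables (G : topGroupType) (A B : disModType G) (d : ghom A B).

Definition im_pred : {pred B} := fun b => `[< exists a, d a = b >].

Fact im_submod : submod_closed im_pred.
Proof.
split=> [|c x y]; first by apply/asboolP; exists 0; rewrite linear0.
move=> /asboolP[a <-] /asboolP[b <-]; apply/asboolP.
by exists (c *: a + b); rewrite ghom_linear.
Qed.

HB.instance Definition _ := GRing.isSubmodClosed.Build rat B im_pred
  (GRing.submod_closed_semi im_submod).
HB.instance Definition _ := GRing.isOppClosed.Build B im_pred
  (GRing.zmod_closedN (GRing.submod_closedB im_submod)).

(** [projective] lifts only along surjections. Making the image of d a discrete module lets every
    map with values in that image be lifted through d. *)
Definition im_mod : Type := {b : B | b \in im_pred}.
HB.instance Definition _ := SubChoice.on im_mod.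
HB.instance Definition _ := [SubChoice_isSubLmodule of im_mod by <:].

Fact im_act_subproof g (b : im_mod) : gact g (val b) \in im_pred.
Proof.
have /asboolP[a <-] := valP b; apply/asboolP; exists (gact g a).
exact: ghom_act.
Qed.

Definition im_act g (b : im_mod) : im_mod :=
  exist (fun b => b \in im_pred) _ (im_act_subproof g b).

Fact im_act1 b : im_act 1%g b = b.
Proof. by apply: val_inj; rewrite /= gact1. Qed.

Fact im_actM g h b : im_act (g * h)%g b = im_act g (im_act h b).
Proof. by apply: val_inj; rewrite /= gactM. Qed.

HB.instance Definition _ := isGSet.Build G im_mod im_act1 im_actM.

Fact im_act_linear g : linear (gact g : im_mod -> im_mod).
Proof.
move=> a x y; apply: val_inj; pose v : {linear im_mod -> B} := val.
apply: (etrans (congr1 (gact g) (linearP v a x y))).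
apply: (etrans (gact_linear g a (v x) (v y))).
exact/esym/(linearP v a (im_act g x) (im_act g y)).
Qed.

HB.instance Definition _ := isGMod.Build G im_mod im_act_linear.

Fact im_stab_open (b : im_mod) : open [set g : G | gact g b = b].
Proof.
rewrite (_ : [set g | _] = [set g | gact g (val b) = val b]); first exact: stab_open.
apply/seteqP; split=> g /=; first by move=> /(congr1 val).
by move=> E; apply: val_inj.
Qed.

HB.instance Definition _ := isDiscrete.Build G im_mod im_stab_open.

Definition im_corestrict (P : disModType G) (u : ghom P B)
  (uim : forall p, u p \in im_pred) : ghom P im_mod.
Proof.
apply: (@GHom G P im_mod (fun p => exist (fun b => b \in im_pred) _ (uim p))).
  by move=> a x y; apply: val_inj; rewrite /= linearP.
by move=> g x; apply: val_inj; rewrite /= ghom_act.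
Defined.

Lemma proj_lift (P : disModType G) (u : ghom P B) : projective P ->
  (forall p, exists a, d a = u p) -> exists v : ghom P A, forall p, d (v p) = u p.
Proof.
move=> projP uim.
have uim' p : u p \in im_pred by apply/asboolP.
have dim a : d a \in im_pred by apply/asboolP; exists a.
have onto_d : onto (im_corestrict dim).
  move=> b; have /asboolP[a ab] := valP b; exists a; exact: val_inj.
have [v dv] := projP A im_mod (im_corestrict dim) (im_corestrict uim') onto_d.
by exists v => p; have /(congr1 val) := dv p.
Qed.

End Image.

Section Resolutions.
Variable G : topGroupType.
Implicit Types r : FP_resolution G.

(** Beyond the length of the resolution the modules vanish, so comparison maps and homotopies can be
    built in all degrees alike. *)
Lemma res_projective r k : projective (res_mod r k).
Proof.
have [|lt] := leqP k (res_len r); first by move/res_proj => [].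
move=> A B p f _; exists (zero_ghom _ _) => x.
by rewrite /= linear0 (@res_zero _ r _ x lt) linear0.
Qed.

Arguments res_projective : clear implicits.

Lemma res_xi r k : exists s, @xi_id G (res_mod r k) s.
Proof.
have [|lt] := leqP k (res_len r).
  by move/res_proj => [fg pr]; exact: projective_xi.
by exists [::] => x; rewrite big_nil (@res_zero _ r _ x lt).
Qed.

Lemma res_dd r k x : res_d r k (res_d r k.+1 x) = 0.
Proof. by apply/res_exact; exists x. Qed.

Lemma res_aug_d r x : res_aug r (res_d r 0 x) = 0.
Proof. by apply/res_exact0; exists x. Qed.

Lemma res_comparison r r' :
  exists F : forall k, ghom (res_mod r k) (res_mod r' k),
    (forall x, res_aug r' (F 0%N x) = res_aug r x) /\
    (forall k x, res_d r' k (F k.+1 x) = F k (res_d r k x)).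
Proof.
have [F0 F0aug] := res_projective r 0%N _ _ _ (res_aug r) (@res_aug_surj _ r').
have [||F [F0E FR]] := @dependent_choice_seq
  (fun k => ghom (res_mod r k) (res_mod r' k))
  (fun k F => forall p, exists q, res_d r' k q = F (res_d r k p))
  (fun k F F' => forall p, res_d r' k (F' p) = F (res_d r k p)) F0.
- by move=> p; apply/res_exact0; rewrite F0aug res_aug_d.
- move=> k F /(proj_lift (u := comp_ghom F (res_d r k)) (res_projective r _))[F' FF'].
  exists F'; split=> // p; apply/res_exact.
  by rewrite FF' /= res_dd linear0.
by exists F; split=> [x|//]; rewrite F0E.
Qed.

Lemma res_homotopy r (F : forall k, ghom (res_mod r k) (res_mod r k)) :
    (forall x, res_aug r (F 0%N x) = res_aug r x) ->
    (forall k x, res_d r k (F k.+1 x) = F k (res_d r k x)) ->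
  exists h : forall k, ghom (res_mod r k) (res_mod r k.+1),
    (forall x, F 0%N x = x + res_d r 0 (h 0%N x)) /\
    (forall k x, F k.+1 x = x + res_d r k.+1 (h k.+1 x) + h k (res_d r k x)).
Proof.
move=> Faug Fd; pose D k := add_ghom (-1) (F k) (idghom _).
have DE k x : D k x = F k x - x by rewrite /D /= scaleN1r.
have [|h0 h0E] := proj_lift (d := res_d r 0) (u := D 0%N) (res_projective r _).
  by move=> p; apply/res_exact0; rewrite DE ghomB Faug subrr.
(* The invariant d h d = D d makes D - h d take values in cycles, hence in boundaries, so the next h
   exists. *)
have [||h [hE hR]] := @dependent_choice_seq
  (fun k => ghom (res_mod r k) (res_mod r k.+1))
  (fun k h => forall x, res_d r k (h (res_d r k x)) = D k (res_d r k x))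
  (fun k h h' => forall x, res_d r k.+1 (h' x) = D k.+1 x - h (res_d r k x)) h0.
- by move=> x; rewrite h0E.
- move=> k h hd.
  pose u := add_ghom (-1) (D k.+1) (comp_ghom h (res_d r k)).
  have uE p : u p = D k.+1 p - h (res_d r k p).
    by rewrite -[in RHS]scaleN1r.
  have [|h' h'E] := proj_lift (d := res_d r k.+1) (u := u) (res_projective r _).
    move=> p; apply/res_exact; by rewrite uE ghomB hd DE DE ghomB Fd subrr.
  exists h'; split=> x; rewrite h'E uE //.
  by rewrite res_dd linear0 subr0.
exists h; split=> [x|k x].
  by rewrite hE h0E DE addrC subrK.
by rewrite hR DE addrA subrK addrC subrK.
Qed.

End Resolutions.

Section EulerChar.
Variables (R : realType) (G : topGroupType) (O : set G).
Variable mu : {measure set (borel G) -> \bar R}.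
Hypotheses (uG : unimodular R G) (CO_O : CO G O).
Hypotheses (hmu : left_haar mu) (muO : mu O = 1%E).
Implicit Types r : FP_resolution G.

Definition res_tr r k (f : res_mod r k -> res_mod r k) : rat :=
  tr_end O (sval (cid (res_xi r k))) f.

(** The Lefschetz number of f. N may exceed the length, so two resolutions can be compared with the
    same bound. *)
Definition res_euler r N (f : forall k, res_mod r k -> res_mod r k) : rat :=
  \sum_(0 <= k < N) (-1) ^+ k * res_tr (f k).

Lemma res_tr0 r k (f : res_mod r k -> res_mod r k) :
  (forall x, f x = 0) -> res_tr f = 0.
Proof.
move=> f0; rewrite /res_tr /tr_end big1 // => u _; rewrite f0 linear0.
have := tau_linear CO_O hmu muO (-1) 0 0.
by rewrite !scaleN1r !addNr.
Qed.

(** With A_k = Tr(d h_k) = Tr(h_k d), the trace of F exceeds that of the identity by A_k + A_(k-1)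
    in degree k. The alternating sum telescopes to the last A, which vanishes because the last h
    maps into a zero module. *)
Lemma res_euler_homotopic r N (F : forall k, ghom (res_mod r k) (res_mod r k)) :
    (forall x, res_aug r (F 0%N x) = res_aug r x) ->
    (forall k x, res_d r k (F k.+1 x) = F k (res_d r k x)) ->
  (res_len r < N)%N -> res_euler N (fun k => F k) = res_euler N (fun k => @id (res_mod r k)).
Proof.
move=> Faug Fd; case: N => // N lN.
have [h [h0 hS]] := res_homotopy Faug Fd.
pose A k := res_tr (fun x => res_d r k (h k x)).
have AN : A N = 0.
  by apply: res_tr0 => x; rewrite [h N x](@res_zero _ r _ (h N x) lN) linear0.
suff E : forall n, res_euler n.+1 (fun k => F k) =
    res_euler n.+1 (fun k => @id (res_mod r k)) + (-1) ^+ n * A n.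
  by rewrite E AN mulr0 addr0.
have E0 : res_tr (F 0%N) = res_tr (@id (res_mod r 0%N)) + A 0%N.
  rewrite /res_tr -[A 0%N]mul1r -(tr_endD CO_O hmu muO).
  by congr tr_end; apply/funext => x; rewrite scale1r h0.
have ES k : res_tr (F k.+1) = res_tr (@id (res_mod r k.+1)) + A k.+1 + A k.
  have -> : A k = res_tr (fun x => h k (res_d r k x)).
    exact: (tr_end_swap uG CO_O hmu muO (h k) (res_d r k)
      (svalP (cid (res_xi r k))) (svalP (cid (res_xi r k.+1)))).
  rewrite /A /res_tr -[X in _ + X + _]mul1r -[X in _ + X]mul1r -!(tr_endD CO_O hmu muO).
  by congr tr_end; apply/funext => x; rewrite !scale1r hS.
elim=> [|n IH].
  by rewrite /res_euler !big_nat1 expr0 !mul1r.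
rewrite /res_euler big_nat_recr //= -/(res_euler _ _) IH ES.
rewrite [in RHS]big_nat_recr //= -/(res_euler _ _).
by rewrite exprS; ring.
Qed.

Lemma res_eulerC r r' (F : forall k, ghom (res_mod r k) (res_mod r' k))
    (F' : forall k, ghom (res_mod r' k) (res_mod r k)) N :
  res_euler N (fun k x => F' k (F k x)) = res_euler N (fun k x => F k (F' k x)).
Proof.
apply: eq_bigr => k _; congr (_ * _).
exact: (tr_end_swap uG CO_O hmu muO (F k) (F' k)
  (svalP (cid (res_xi r k))) (svalP (cid (res_xi r' k)))).
Qed.

Lemma res_euler_unique r r' N : (res_len r < N)%N -> (res_len r' < N)%N ->
  res_euler N (fun k => @id (res_mod r k)) = res_euler N (fun k => @id (res_mod r' k)).
Proof.
move=> lN lN'; have [F [Fa Fd]] := res_comparison r r'.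
have [F' [Fa' Fd']] := res_comparison r' r.
rewrite -(@res_euler_homotopic r N (fun k => comp_ghom (F' k) (F k))) //=; first last.
- by move=> k x; rewrite Fd' Fd.
- by move=> x; rewrite Fa' Fa.
rewrite -(@res_euler_homotopic r' N (fun k => comp_ghom (F k) (F' k))) //=; first last.
- by move=> k x; rewrite Fd Fd'.
- by move=> x; rewrite Fa Fa'.
exact: res_eulerC.
Qed.

Lemma res_HS_sum r N : (res_len r < N)%N ->
  \sum_(0 <= k < (res_len r).+1) (-1) ^+ k *: HS_rank O mu (res_mod r k) =
  ratr (res_euler N (fun k => @id (res_mod r k))) *: haar_vec mu.
Proof.
move=> lN; rewrite /res_euler (big_cat_nat (leq0n _) lN) //= [X in _ + X]big_nat_cond.
rewrite [X in _ + X]big1 ?addr0 => [|k /andP[/andP[lk _] _]]; last first.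
  rewrite res_tr0 ?mulr0 // => x; exact: (@res_zero _ r _ x lk).
rewrite rmorph_sum scaler_suml; apply: eq_bigr => k _.
rewrite (HS_rankE uG CO_O hmu muO (svalP (cid (res_xi r k)))) scalerA.
by rewrite rmorphM rmorphXn rmorphN1.
Qed.

Lemma euler_charE r : euler_char O mu =
  \sum_(0 <= k < (res_len r).+1) (-1) ^+ k *: HS_rank O mu (res_mod r k).
Proof.
rewrite /euler_char; apply: xget_unique; first by exists r.
move=> _ [r' ->]; pose N := (maxn (res_len r) (res_len r')).+1.
have lN : (res_len r < N)%N by rewrite ltnS leq_maxl.
have lN' : (res_len r' < N)%N by rewrite ltnS leq_maxr.
by rewrite (res_HS_sum lN) (res_HS_sum lN') (res_euler_unique lN lN').
Qed.

End EulerChar.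

(** * Ordered chains *)

Section LinearExtension.
Variables (Y : choiceType) (M : lmodType rat).
Implicit Types (F : Y -> M) (c : {malg rat[Y]}).

Definition chain_in (Q : set Y) c : Prop := forall y, c@_y != 0 -> Q y.

Lemma malg_ext_eq (Q : set Y) F F' c : chain_in Q c ->
  (forall y, Q y -> F y = F' y) -> malg_ext F c = malg_ext F' c.
Proof.
move=> Qc FF'; apply: eq_big_seq => y; rewrite -mcoeff_neq0 => /Qc Qy.
by rewrite FF'.
Qed.

Lemma malg_extB F F' c :
  malg_ext (fun y => F y - F' y) c = malg_ext F c - malg_ext F' c.
Proof.
by rewrite /malg_ext -sumrB; apply: eq_bigr => y _; rewrite scalerBr.
Qed.

Lemma malg_extD F F' c :
  malg_ext (fun y => F y + F' y) c = malg_ext F c + malg_ext F' c.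
Proof.
by rewrite /malg_ext -big_split; apply: eq_bigr => y _; rewrite scalerDr.
Qed.

Lemma malg_extZ a F c : malg_ext (fun y => a *: F y) c = a *: malg_ext F c.
Proof.
by rewrite /malg_ext scaler_sumr; apply: eq_bigr => y _; rewrite !scalerA mulrC.
Qed.

Lemma malg_ext0 c : malg_ext (fun=> 0 : M) c = 0.
Proof. by apply: big1 => y _; rewrite scaler0. Qed.

Lemma malg_ext_comp (N : lmodType rat) (g : {linear M -> N}) F c :
  g (malg_ext F c) = malg_ext (g \o F) c.
Proof. by rewrite /malg_ext linear_sum; apply: eq_bigr => y _; rewrite linearZ. Qed.

End LinearExtension.

Lemma malg_ext_id (Y : choiceType) (c : {malg rat[Y]}) : malg_ext (@delta Y) c = c.
Proof.
apply: (malg_ind_linear (f := malg_ext (@delta Y)) (g := idfun)) => y.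
exact: malg_ext_delta.
Qed.

Section ChainIn.
Variable Y : choiceType.
Implicit Types (Q : set Y) (c : {malg rat[Y]}).

Lemma chain_in0 Q : chain_in Q 0.
Proof. by move=> y; rewrite mcoeff0 eqxx. Qed.

Lemma chain_in_delta Q y : Q y -> chain_in Q (delta y).
Proof. by move=> Qy z; rewrite mcoeffU; have [<-|] := eqVneq y z. Qed.

Lemma chain_inD Q c c' : chain_in Q c -> chain_in Q c' -> chain_in Q (c + c').
Proof.
move=> Qc Qc' y; rewrite mcoeffD.
have [->|/Qc //] := eqVneq c@_y 0; rewrite add0r; exact: Qc'.
Qed.

Lemma chain_inZ Q a c : chain_in Q c -> chain_in Q (a *: c).
Proof.
by move=> Qc y; rewrite fgscaleE mulf_eq0 negb_or => /andP[_ /Qc].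
Qed.

Lemma chain_inB Q c c' : chain_in Q c -> chain_in Q c' -> chain_in Q (c - c').
Proof.
by move=> Qc Qc'; apply: chain_inD => //; rewrite -scaleN1r; exact: chain_inZ.
Qed.

Lemma chain_in_sub Q Q' c : Q `<=` Q' -> chain_in Q c -> chain_in Q' c.
Proof. by move=> QQ' Qc y /Qc/QQ'. Qed.

Lemma chain_in_ext (X : choiceType) (P : set X) Q (F : X -> {malg rat[Y]})
    (c : {malg rat[X]}) :
  chain_in P c -> (forall x, P x -> chain_in Q (F x)) -> chain_in Q (malg_ext F c).
Proof.
move=> Pc PF; rewrite /malg_ext big_seq; apply: (big_ind (chain_in Q)).
- exact: chain_in0.
- by move=> *; exact: chain_inD.
- by move=> x; rewrite -mcoeff_neq0 => /Pc/PF; exact: chain_inZ.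
Qed.

End ChainIn.

(* All degrees are treated at once: the empty tuple spans degree -1, so that [bd]
   is the augmented boundary. *)
Notation cone x := (malg_ext (fun u => delta (x :: u))).
Notation push f := (malg_ext (fun u => delta (map f u))).

Fixpoint bd_seq (X : choiceType) (s : seq X) : {malg rat[seq X]} :=
  if s is x :: s' then delta s' - cone x (bd_seq s') else 0.

Notation bd := (malg_ext (@bd_seq _)).

(** The recursive form of the sum of (-1)^i (f x_0, ..., f x_i, g x_i, ..., g x_n). *)
Fixpoint prism_seq (X Y : choiceType) (f g : X -> Y) (s : seq X) :
    {malg rat[seq Y]} :=
  if s is x :: s' then
    delta (f x :: g x :: map g s') - cone (f x) (prism_seq f g s')
  else 0.

Notation prism f g := (malg_ext (prism_seq f g)).

Section Boundary.
Variables X : choiceType.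
Implicit Types (c : {malg rat[seq X]}) (s : seq X).

Lemma bd_cone x c : bd (cone x c) = c - cone x (bd c).
Proof.
rewrite malg_ext_comp (malg_ext_comp (cone x)) -{2}[c]malg_ext_id -malg_extB.
by congr (malg_ext _ c); apply/funext => s; rewrite /= malg_ext_delta.
Qed.

Lemma bd_bd c : bd (bd c) = 0.
Proof.
have bb s : bd (bd_seq s) = 0 :> {malg rat[seq X]}.
  elim: s => [|x s IH]; first exact: linear0.
  by rewrite /= linearB /= malg_ext_delta bd_cone IH linear0 subr0 subrr.
rewrite malg_ext_comp -[RHS](malg_ext0 _ c).
by apply: (@malg_ext_eq _ _ setT) => // s _; exact: bb.
Qed.

Lemma bd_seq_in s :
  chain_in [set u | subseq u s /\ (size u).+1 = size s] (bd_seq s).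
Proof.
elim: s => [|x s IH] /=; first exact: chain_in0.
apply: chain_inB; first by apply: chain_in_delta; split=> //; exact: subseq_cons.
apply: (chain_in_ext IH) => u [us su]; apply: chain_in_delta; split=> /=.
  by rewrite eqxx.
by rewrite su.
Qed.

End Boundary.

Lemma zmod_prism (V : zmodType) (a b c d e f : V) :
  a - (b - d) - (f - (b - c - e)) = a - c - (f - (d - e)).
Proof. by rewrite !opprB !addrA subrK [a - c + d]addrAC. Qed.

Lemma zmod_telescope (V : zmodType) (a b c : V) : a - c + (b - a) = b - c.
Proof. by rewrite addrC addrA subrK. Qed.

Section Maps.
Variables X Y : choiceType.
Implicit Types (c : {malg rat[seq X]}) (f g : X -> Y) (s : seq X).

Lemma push_cone f x c : push f (cone x c) = cone (f x) (push f c).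
Proof.
rewrite (malg_ext_comp (push f)) (malg_ext_comp (cone _)).
congr (malg_ext _ c); apply/funext => s.
by rewrite /= !malg_ext_delta.
Qed.

Lemma push_bd_seq f s : push f (bd_seq s) = bd_seq (map f s).
Proof.
elim: s => [|x s IH] /=; first by rewrite linear0.
by rewrite linearB /= malg_ext_delta push_cone IH.
Qed.

Lemma bd_push f c : bd (push f c) = push f (bd c).
Proof.
rewrite (malg_ext_comp bd) (malg_ext_comp (push f)).
congr (malg_ext _ c); apply/funext => s /=.
by rewrite malg_ext_delta push_bd_seq.
Qed.

Lemma prism_cone f g x c : prism f g (cone x c) =
  cone (f x) (cone (g x) (push g c)) - cone (f x) (prism f g c).
Proof.
rewrite (malg_ext_comp (prism f g)) (malg_ext_comp (cone (g x))).
rewrite !(malg_ext_comp (cone (f x))) -malg_extB.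
congr (malg_ext _ c); apply/funext => s.
by rewrite /= !malg_ext_delta.
Qed.

Lemma bd_prism f g c :
  bd (prism f g c) = push g c - push f c - prism f g (bd c).
Proof.
rewrite (malg_ext_comp bd) (malg_ext_comp (prism f g)) -!malg_extB.
congr (malg_ext _ c); apply/funext => s /=.
elim: s => [|x s IH] /=; first by rewrite !linear0 addr0 subrr.
have coneB y (u v : {malg rat[seq Y]}) : cone y (u - v) = cone y u - cone y v.
  exact: linearB.
rewrite [bd (_ - _)]linearB [prism f g (_ - _)]linearB /= !malg_ext_delta.
rewrite bd_cone prism_cone IH push_bd_seq /= !coneB !malg_ext_delta.
set A := delta (g x :: _); set B := delta (f x :: map g s).
set C := delta (f x :: _); set D := cone (f x) (cone (g x) _).
set E := cone (f x) (prism f g _); set F := prism_seq f g s.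
exact: zmod_prism.
Qed.

Lemma prism_seq_in f g s :
  chain_in [set u : seq Y | {subset u <= map f s ++ map g s}] (prism_seq f g s).
Proof.
elim: s => [|x s IH] /=; first exact: chain_in0.
apply: chain_inB.
  apply: chain_in_delta => y; rewrite !inE mem_cat inE.
  by case/or3P => [->|->|->]; rewrite ?orbT.
apply: (chain_in_ext IH) => u us; apply: chain_in_delta => y.
rewrite !inE mem_cat inE => /orP[->//|/us]; rewrite mem_cat.
by case/orP => ->; rewrite ?orbT.
Qed.

End Maps.

Section Contraction.
Variables (X Y : choiceType) (Q : set (seq Y)).
Hypothesis Qsub : forall s u, Q s -> {subset u <= s} -> Q u.

(** A discrete contraction: prisms join consecutive maps g_j, and a cone with apex x fills the last
    image. It serves both for shrinking a closed simplex linearly and for following H. *)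
Lemma contract_cycle (g : nat -> X -> Y) N x (z : {malg rat[seq X]}) :
  bd z = 0 ->
  chain_in [set s | forall j, (j < N)%N -> Q (map (g j) s ++ map (g j.+1) s)] z ->
  chain_in [set s | Q (x :: map (g N) s)] z ->
  exists y, chain_in Q y /\ bd y = push (g 0%N) z.
Proof.
move=> bz Qj QN.
pose D := cone x (push (g N) z) - \sum_(j < N) prism (g j) (g j.+1) z.
exists D; split.
  apply: chain_inB.
    rewrite malg_ext_comp; apply: (chain_in_ext QN) => s Qs /=.
    by rewrite malg_ext_delta; exact: chain_in_delta.
  apply: (big_ind (chain_in Q)) => [||j _]; first exact: chain_in0.
    by move=> *; exact: chain_inD.
  apply: (chain_in_ext Qj) => s Qs; apply: (chain_in_sub _ (@prism_seq_in _ _ (g j) (g j.+1) s)).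
  by move=> u us; apply: Qsub us; exact: Qs.
have bdB u v : bd (u - v) = bd u - bd v :> {malg rat[seq Y]} by exact: linearB.
have bd_sum (F : 'I_N -> {malg rat[seq Y]}) :
    bd (\sum_(j < N) F j) = \sum_(j < N) bd (F j) by exact: linear_sum.
rewrite /D bdB bd_cone bd_push bz bd_sum.
have E n : \sum_(j < n) bd (prism (g j) (g j.+1) z) =
    push (g n) z - push (g 0%N) z.
  elim: n => [|n IH]; first by rewrite big_ord0 subrr.
  have p0 : prism (g n) (g n.+1) 0 = 0 by exact: linear0.
  have bp : bd (prism (g n) (g n.+1) z) = push (g n.+1) z - push (g n) z.
    apply: (etrans (bd_prism _ _ z)).
    apply: (etrans (congr1 (fun c => _ - prism (g n) (g n.+1) c) bz)).
    by apply: (etrans (congr1 (fun c => _ - c) p0)); exact: subr0.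
  apply: (etrans (big_ord_recr _ _)); rewrite IH bp.
  exact: zmod_telescope.
by rewrite E [push _ 0]linear0 [cone _ 0]linear0 subr0 subKr.
Qed.

End Contraction.

Section AcyclicFill.
Variables (X Y : choiceType) (P : set (seq X)) (C : seq X -> set (seq Y)).
Variables (w : seq X -> {malg rat[seq Y]}) (e : rat) (F0 : {malg rat[seq Y]}).
Hypothesis Pbd : forall s, P s -> chain_in [set u | P u /\ C u `<=` C s] (bd_seq s).
Hypothesis Cacyclic : forall s, P s -> s <> [::] -> forall z, chain_in (C s) z ->
  bd z = 0 -> exists y, chain_in (C s) y /\ bd y = z.
Hypothesis wC : forall s, P s -> chain_in (C s) (w s).
Hypothesis bd_w : forall s, P s -> bd (w s) = - (e *: malg_ext w (bd_seq s)).
Hypotheses (F0C : chain_in (C [::]) F0) (bdF0 : bd F0 = w [::]).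

(* [e = 1] and [w = 0] yields a chain map carried by [C]; [e = -1] and [w] the
   difference of two chain maps carried by [C] yields a homotopy. *)
Lemma acyclic_fill : exists F : seq X -> {malg rat[seq Y]}, F [::] = F0 /\
  forall s, P s -> chain_in (C s) (F s) /\ bd (F s) = w s + e *: malg_ext F (bd_seq s).
Proof.
(* The recursion is on the length of s; for s in P the choice is among existing fillings, so the
   default 0 is not reached. *)
pose fill := fix fill n s := if n is n'.+1 then
  xget 0 [set y | chain_in (C s) y /\ bd y = w s + e *: malg_ext (fill n') (bd_seq s)]
  else F0.
pose F s := fill (size s) s; exists F; split=> // s Ps.
have FE s' n : size s' = n.+1 ->
    malg_ext (fill n) (bd_seq s') = malg_ext F (bd_seq s').
  move=> sn; apply: (@malg_ext_eq _ _ _ (fill n) F _ (@bd_seq_in X s')) => u [_].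
  by rewrite sn /F => -[->].
move: {2}(size s) (erefl (size s)) Ps => n; elim: n s => [|n IH] s sn Ps.
  move/size0nil : sn => ->; rewrite /F /=; split=> //.
  by rewrite bdF0 linear0 scaler0 addr0.
rewrite /F sn /= FE //.
have sC : chain_in [set u | (size u = n) /\ P u /\ C u `<=` C s] (bd_seq s).
  move=> u us; have [_ su] := bd_seq_in us; have [Pu Cu] := Pbd Ps us.
  by split=> //; move: su; rewrite sn => -[].
have sN : s <> [::] by move=> s0; rewrite s0 in sn.
have [||y yP] := Cacyclic Ps sN (z := w s + e *: malg_ext F (bd_seq s)).
- apply: chain_inD; first exact: wC.
  apply: chain_inZ; apply: (chain_in_ext sC) => u [su [Pu Cu]].
  by apply: (chain_in_sub Cu); have [] := IH _ su Pu.
(* The prescribed boundary is a cycle: bd F(bd s) = w(bd s) + e F(bd bd s) = w(bd s), which [bd_w]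
   cancels. *)
- have bdD a b : bd (a + e *: b) = bd a + e *: bd b :> {malg rat[seq Y]}.
    by rewrite linearD linearZZ.
  apply: (etrans (bdD _ _)); rewrite bd_w //.
  suff -> : bd (malg_ext F (bd_seq s)) = malg_ext w (bd_seq s) by rewrite addNr.
  apply: (etrans (malg_ext_comp bd F _)).
  apply: (etrans (@malg_ext_eq _ _ _ (bd \o F)
    (fun u => w u + e *: malg_ext F (bd_seq u)) _ sC _)).
    by move=> u [su [Pu Cu]] /=; have [] := IH _ su Pu.
  rewrite malg_extD malg_extZ.
  rewrite -(malg_ext_comp (malg_ext F) (@bd_seq _) (bd_seq s)).
  have -> : bd (bd_seq s) = 0.
    by rewrite -[in LHS](malg_ext_delta (@bd_seq _) s) bd_bd.
  by rewrite linear0 scaler0 addr0.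
exact: (@xgetPex _ 0 [set y | chain_in (C s) y /\
  bd y = w s + e *: malg_ext F (bd_seq s)] (ex_intro _ y yP)).
Qed.

End AcyclicFill.

(** * Acyclicity of contractible complexes *)

Lemma finite_lower_bound (R : realFieldType) (T : eqType) (l : seq T) (a : T -> R) :
  (forall i, i \in l -> 0 < a i) ->
  exists2 e : R, 0 < e & forall i, i \in l -> e <= a i.
Proof.
elim: l => [|i l IH] al; first by exists 1.
have [j jl|e e0 el] := IH; first by apply: al; rewrite inE jl orbT.
exists (Num.min (a i) e); first by rewrite lt_min e0 al // mem_head.
by move=> j; rewrite inE ge_min => /predU1P[->|/el ->]; rewrite ?lexx ?orbT.
Qed.

Section Support.
Variables (R : realType) (V : choiceType) (S : simplicial_complex V).
Implicit Types (x y : realization R S).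

Lemma bary_ge0 x v : 0 <= bary x v.
Proof. by have /set_mem[x0 _] := valP x; exact: x0. Qed.

Let supp_ex x : exists s, [/\ simplex S s, forall v, (v \in s) = (bary x v != 0) &
  \sum_(v <- s) bary x v = 1].
Proof. by have /set_mem[] := valP x. Qed.

Definition supp x : {fset V} := sval (cid (supp_ex x)).

Lemma supp_simplex x : simplex S (supp x).
Proof. by rewrite /supp; case: cid => s []. Qed.

Lemma in_supp x v : (v \in supp x) = (bary x v != 0).
Proof. by rewrite /supp; case: cid => s []. Qed.

Lemma supp_sum x : \sum_(v <- supp x) bary x v = 1.
Proof. by rewrite /supp; case: cid => s []. Qed.

Lemma supp_neq0 x : exists v, v \in supp x.
Proof. exact/fset0Pn/(simplex_neq0 (supp_simplex x)). Qed.

Lemma bary_sum x (F : {fset V}) : (supp x `<=` F)%fset -> \sum_(v <- F) bary x v = 1.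
Proof.
move=> sF; rewrite -(supp_sum x); apply/esym.
apply: (big_fset_incl _ sF) => v _; rewrite in_supp negbK => /eqP.
by [].
Qed.

Lemma realization_of (F : {fset V}) (a : V -> R) : (forall v, 0 <= a v) ->
  (forall v, v \notin F -> a v = 0) -> \sum_(v <- F) a v = 1 ->
  simplex S [fset v in F | a v != 0]%fset -> exists x, bary x = a.
Proof.
move=> a0 aF aS sS.
have aP : a \in [set a : V -> R | (forall v, 0 <= a v) /\
    exists s, [/\ simplex S s, forall v, (v \in s) = (a v != 0) &
                \sum_(v <- s) a v = 1]].
  apply/mem_set; split=> //; exists [fset v in F | a v != 0]%fset; split=> //.
    move=> v; rewrite !inE /=; have [vF|/aF ->] := boolP (v \in F) => //.
    by rewrite eqxx.
  rewrite -aS; apply: big_fset_incl; first exact: fset_sub.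
  by move=> v vF; rewrite !inE /= vF /= negbK => /eqP.
by exists (exist _ a aP).
Qed.

(** These are the open vertex stars: a positive coordinate stays nonzero under any change smaller
    than itself. *)
Lemma supp_open v : open [set x : realization R S | bary x v != 0].
Proof.
move=> s Ss x sx /= xv; exists (bary x v).
  by rewrite lt_neqAle eq_sym xv bary_ge0.
move=> y sy xy; have := xy v; apply: contraTneq => ->.
by rewrite sub0r normrN ger0_norm ?bary_ge0 // ltxx.
Qed.

End Support.

(** * A Lebesgue number for the contraction *)

Section Lebesgue.
Variables (R : realType) (V : choiceType) (S : simplicial_complex V).
Variables (H : R * realization R S -> realization R S) (F : {fset V}).
Hypothesis cH : {within `[0, 1]%classic `*` [set: realization R S], continuous H}.
Implicit Types (x y : realization R S) (t : R).

Let near_simplices x (O : set (realization R S)) : nbhs x O ->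
  exists2 e : R, 0 < e & forall y, (supp y `<=` F)%fset ->
    (forall v, v \in F -> `|bary y v - bary x v| < e) -> (supp x `<=` F)%fset -> O y.
Proof.
rewrite nbhsE => -[N [oN Nx] NO].
have es (s : {fset V}) : exists e : R, 0 < e /\ (simplex S s -> in_face s x ->
    forall y, in_face s y -> (forall v, `|bary y v - bary x v| < e) -> N y).
  have [[Ss sx]|nS] := pselect (simplex S s /\ in_face s x); last first.
    by exists 1; split=> // Ss sx; case: nS.
  by have [e e0 eO] := oN s Ss x sx Nx; exists e.
have [f fP] := choice es.
have [e1 e10 e1P] := @finite_lower_bound R _ (fpowerset F) f (fun s _ => (fP s).1).
(* A y closer to x than all positive coordinates of x has them nonzero too, so x lies in the closed
   simplex carrying y, where openness can be used. *)
have [e2 e20 e2P] : exists2 e2 : R, 0 < e2 & forall v, v \in supp x -> e2 <= bary x v.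
  apply: finite_lower_bound => v; rewrite in_supp => xv.
  by rewrite lt_neqAle eq_sym xv bary_ge0.
exists (Num.min e1 e2); first by rewrite lt_min e10.
move=> y yF xy xF; apply: NO.
have xy' v : `|bary y v - bary x v| < Num.min e1 e2.
  have [/xy //|vF] := boolP (v \in F).
  have z (w : realization R S) : (supp w `<=` F)%fset -> bary w v = 0.
    by move=> wF; apply/eqP; apply: contraNT vF; rewrite -in_supp => /(fsubsetP wF).
  by rewrite !z // subrr normr0 lt_min e10.
apply: ((fP (supp y)).2 (supp_simplex y)).
- move=> v; rewrite in_supp negbK => /eqP yv; apply/eqP/negP => /negP xv.
  have := xy' v; rewrite yv sub0r normrN ger0_norm ?bary_ge0 // lt_min.
  by move=> /andP[_]; rewrite ltNge e2P // in_supp.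
- by move=> v; rewrite in_supp negbK => /eqP.
- move=> v; apply: lt_le_trans (xy' v) _; rewrite ge_min e1P //.
  by rewrite fpowersetE.
Qed.

(* [near_simplices]: on the points carried by the finite set [F] the coherent
   topology is the Euclidean one. *)
Lemma near_vertex t x : 0 <= t <= 1 -> (supp x `<=` F)%fset ->
  exists2 e : R, 0 < e & exists v, forall t' y, 0 <= t' <= 1 -> (supp y `<=` F)%fset ->
    `|t' - t| < e -> (forall v, v \in F -> `|bary y v - bary x v| < e) ->
    v \in supp (H (t', y)).
Proof.
move=> t01 xF; have [v vH] := supp_neq0 (H (t, x)).
have Ap : (`[0, 1]%classic `*` [set: realization R S]) (t, x).
  by split=> //=; rewrite in_itv.
have HO : nbhs (H (t, x)) [set y : realization R S | bary y v != 0].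
  apply: open_nbhs_nbhs; split; first exact: supp_open.
  by rewrite /= -in_supp.
have {}HO : nbhs ((t, x) : subspace (`[0, 1]%classic `*` [set: realization R S]))
  (H @^-1` [set y : realization R S | bary y v != 0]) := @cH _ _ HO.
have : within (`[0, 1]%classic `*` [set: realization R S]) (nbhs (t, x))
    (H @^-1` [set y : realization R S | bary y v != 0]).
  by rewrite (nbhs_subspace_in Ap); exact: HO.
move => -[[N1 N2] /= [Nt Nx] NH].
have [e1 /= e10 e1P] := Nt.
have [e2 e20 e2P] := near_simplices Nx.
exists (Num.min e1 e2); first by rewrite lt_min e10.
exists v => t' y t'01 yF tt' xy; rewrite in_supp.
apply: (NH (t', y)); last by split=> //=; rewrite in_itv.
split=> /=.
  by apply: e1P; rewrite /ball_ /= distrC; apply: lt_le_trans tt' _; rewrite ge_min lexx.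
apply: e2P => // w wF; apply: lt_le_trans (xy w wF) _.
by rewrite ge_min lexx orbT.
Qed.

Let n := size F.
Let vert (i : 'I_n) : V := tnth (in_tuple F) i.

(** The pair (t, a) as a point of R^(n+1), with the time at index 0, so that the compactness needed
    is that of the cube [box]. *)
Let enc t (a : V -> R) : 'rV[R]_n.+1 :=
  \row_i (if unlift ord0 i is Some j then a (vert j) else t).

Let enc_lt (e : R) t (a : V -> R) t' (b : V -> R) : `|t' - t| < e ->
  (forall v, v \in F -> `|b v - a v| < e) -> ball (enc t a) e (enc t' b).
Proof.
move=> tt' ab; split=> [|i j]; first exact: le_lt_trans tt'.
rewrite !mxE /ball /= /ball_ distrC.
by case: unliftP => [k _|_] //; apply: ab; rewrite /vert mem_tnth.
Qed.

Let dec (p : 'rV[R]_n.+1) (v : V) : R :=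
  if insub (index v F) is Some i then p ord0 (lift ord0 i) else 0.

Let decE p v : v \in F -> exists2 i, dec p v = p ord0 (lift ord0 i) & vert i = v.
Proof.
move=> vF; have iF : (index v F < n)%N by rewrite index_mem.
exists (Ordinal iF); first by rewrite /dec insubT.
by rewrite /vert (tnth_nth v) /= nth_index.
Qed.

Let dec0 p v : v \notin F -> dec p v = 0.
Proof. by move=> vF; rewrite /dec insubF // index_mem; exact: negbTE. Qed.

Let ball_dec (e : R) p t (b : V -> R) : ball p e (enc t b) ->
  `|t - p ord0 ord0| < e /\ forall v, v \in F -> `|b v - dec p v| < e.
Proof.
move=> [_ B]; split=> [|v vF].
  by have := B ord0 ord0; rewrite mxE unlift_none /ball /= /ball_ distrC.
have [i -> iv] := decE p vF; have := B ord0 (lift ord0 i).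
by rewrite mxE liftK iv /ball /= /ball_ distrC.
Qed.

Let box := [set p : 'rV[R]_n.+1 | forall i, p ord0 i \in `[0, 1]].

Let good (p : 'rV[R]_n.+1) (e : R) (v : V) := forall t y, 0 <= t <= 1 ->
  (supp y `<=` F)%fset -> ball p e (enc t (bary y)) -> v \in supp (H (t, y)).

(** The cube also contains points that represent no point of the realization: the coordinates may
    not sum to 1 or their support may not be a simplex. Such points have a ball free of encoded
    points, on which any vertex is good vacuously. *)
Let box_good (v0 : V) p : box p -> exists ev : R * V, 0 < ev.1 /\ good p ev.1 ev.2.
Proof.
move=> pbox; pose a := dec p.
have a0 v : 0 <= a v.
  rewrite /a; have [vF|/dec0 -> //] := boolP (v \in F).
  by have [i -> _] := decE p vF; have := pbox (lift ord0 i); rewrite in_itv => /andP[].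
have t01 : 0 <= p ord0 ord0 <= 1 by have := pbox ord0; rewrite in_itv.
have [a1|a1] := eqVneq (\sum_(v <- F) a v) 1; last first.
  (* If all n coordinates were closer than this, their sum would differ from 1 by at most n/(n+1) of
     its actual defect. *)
  exists (`|\sum_(v <- F) a v - 1| / n.+1%:R, v0); split.
    by rewrite /= divr_gt0 // normr_gt0 subr_eq0.
  move=> t y _ yF /ball_dec[_ ya]; exfalso.
  set c := `|_ - 1| / _ in ya.
  have sc : \sum_(v <- F) c = n%:R * c.
    by rewrite big_const_seq count_predT iter_addr addr0 mulr_natl.
  have : `|\sum_(v <- F) a v - 1| <= n%:R * c.
    rewrite -sc -[X in `|_ - X|](bary_sum yF) -sumrB; apply: le_trans (ler_norm_sum _ _ _) _.
    rewrite big_seq [leRHS]big_seq; apply: ler_sum => v vF.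
    by rewrite distrC ltW // ya.
  rewrite leNgt => /negP; apply.
  rewrite /c mulrA ltr_pdivrMr // mulrC ltr_pM2l ?normr_gt0 ?subr_eq0 //.
  by rewrite ltr_nat.
have [Sa|nSa] := pselect (simplex S [fset v in F | a v != 0]%fset).
  have [x xa] := realization_of a0 (@dec0 p) a1 Sa.
  have xF : (supp x `<=` F)%fset.
    apply/fsubsetP => v; rewrite in_supp xa; apply: contraNT => vF.
    by rewrite /a dec0.
  have [e e0 [v ev]] := near_vertex t01 xF; exists (e, v); split=> // t y t01' yF.
  by move=> /ball_dec[tp ya]; apply: ev => //; rewrite xa.
(* Within e of a, no positive coordinate of a vanishes, so the support of a would be a face of the
   simplex supporting y. *)
have [e e0 eP] : exists2 e : R, 0 < e & forall v, v \in [fset v in F | a v != 0]%fset -> e <= a v.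
  apply: finite_lower_bound => v; rewrite !inE /= => /andP[_ av].
  by rewrite lt_neqAle eq_sym av a0.
exists (e, v0); split=> // t y _ yF /ball_dec[_ ya]; exfalso; apply: nSa.
apply: (simplex_sub (supp_simplex y)).
  apply/fsubsetP => v vs; have := eP v vs; move: vs; rewrite !inE /= in_supp.
  move=> /andP[vF av] eav; apply/negP => /eqP yv; have := ya v vF.
  by rewrite yv sub0r normrN ger0_norm ?a0 // ltNge eav.
apply/negP => /eqP s0; have := oner_neq0 R; rewrite -a1 big_seq big1 ?eqxx // => v vF.
apply/eqP; apply: contraFT (in_fset0 v) => av.
by rewrite -s0 !inE /= vF.
Qed.

(** [f] assigns to (t, x) a vertex whose star contains the H-image of the e-neighbourhood of (t, x).
    Hence the vertices assigned to mutually close points lie in one simplex. *)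
Lemma lebesgue_vertex (v0 : V) : exists2 e : R, 0 < e & exists f : R -> (V -> R) -> V,
  forall t t' x y, 0 <= t <= 1 -> 0 <= t' <= 1 -> (supp x `<=` F)%fset ->
    (supp y `<=` F)%fset -> `|t' - t| < e -> (forall v, `|bary y v - bary x v| < e) ->
    f t (bary x) \in supp (H (t', y)).
Proof.
have /choice[g gP] p : exists ev : R * V, box p -> 0 < ev.1 /\ good p ev.1 ev.2.
  have [/(box_good v0)[ev evP]|nb] := pselect (box p); first by exists ev.
  by exists (0, v0).
have : compact box by apply: (rV_compact (fun=> @segment_compact R 0 1)).
(* Balls of half the good radius leave room for a further move by e, the least half radius of a
   finite subcover. *)
rewrite compact_cover => /(_ _ box (fun p => (ball p ((g p).1 / 2))°)) [].
- by move=> p _; exact: open_interior.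
- move=> p bp; exists p => //; apply: nbhs_singleton; apply: nbhs_interior.
  by apply: nbhsx_ballx; rewrite divr_gt0 // (gP p bp).1.
move=> D Dbox Dcov.
have Db p : p \in D -> box p by move=> /Dbox/set_mem.
have [e e0 eP] := @finite_lower_bound R _ D (fun p => (g p).1 / 2)
  (fun p pD => divr_gt0 (gP p (Db p pD)).1 (ltr0n _ 2)).
exists e => //.
pose c t (a : V -> R) := xget 0 [set p : 'rV[R]_n.+1 | p \in D /\ ball p ((g p).1 / 2) (enc t a)].
exists (fun t a => (g (c t a)).2) => t t' x y t01 t'01 xF yF tt' xy.
have bx : box (enc t (bary x)).
  move=> i; rewrite mxE in_itv /=; case: unliftP => [j _|_] //.
  rewrite bary_ge0 /=; have [vx|] := boolP (vert j \in supp x).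
    rewrite -(supp_sum x) (big_fsetD1 _ vx) /= lerDl sumr_ge0 // => v _.
    exact: bary_ge0.
  by rewrite in_supp negbK => /eqP ->.
have [p pD /interior_subset pball] := Dcov _ bx.
have [cD cball] : c t (bary x) \in D /\ ball (c t (bary x)) ((g (c t (bary x))).1 / 2) (enc t (bary x)).
  exact: (@xgetPex _ 0 [set p : 'rV[R]_n.+1 | p \in D /\
    ball p ((g p).1 / 2) (enc t (bary x))] (ex_intro _ p (conj pD pball))).
have [_ gd] := gP _ (Db _ cD); apply: (gd t' y t'01 yF).
rewrite [X in ball _ X _]splitr; apply: ball_triangle cball _.
apply: (@le_ball _ _ _ e); first exact: eP.
exact: enc_lt.
Qed.

End Lebesgue.

(** * Small tuples of points in a closed simplex *)

Section Vietoris.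
Variables (R : realType) (V : choiceType).
Implicit Types (x y c : V -> R) (s : seq V) (u : seq (V -> R)).

Definition geo s : set (V -> R) := [set x | [/\ forall v, 0 <= x v,
  forall v, v \notin s -> x v = 0 & \sum_(v <- [fset v in s]%fset) x v = 1]].

(* [s] lists the vertices of a simplex, [u] points of that closed simplex with
   pairwise distances less than [e]. *)
Definition vietoris (e : R) s : set (seq (V -> R)) :=
  [set u : seq (V -> R) | (forall x, x \in u -> geo s x) /\
    forall x y v, x \in u -> y \in u -> `|x v - y v| < e].

Lemma geo_le1 s x v : geo s x -> x v <= 1.
Proof.
move=> [x0 xs x1]; have [vs|/xs ->//] := boolP (v \in s).
rewrite -x1 (big_fsetD1 v) ?in_fset //= lerDl.
by apply: sumr_ge0.
Qed.

Lemma geo_sub s s' x : {subset s <= s'} -> geo s x -> geo s' x.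
Proof.
move=> ss' [x0 xs x1]; split=> // [v vs'|].
  by apply: xs; apply: contra vs' => /ss'.
rewrite -x1; apply/esym; apply: big_fset_incl.
  by apply/fsubsetP => v; rewrite !in_fset; exact: ss'.
by move=> v _; rewrite in_fset; exact: xs.
Qed.

Lemma vietoris_sub e s s' : {subset s <= s'} -> vietoris e s `<=` vietoris e s'.
Proof.
by move=> ss' u [us ue]; split=> // x /us; exact: geo_sub.
Qed.

Lemma vietoris_subset e s u u' : vietoris e s u -> {subset u' <= u} ->
  vietoris e s u'.
Proof.
by move=> [us ue] u'u; split=> [x /u'u/us //|x y v /u'u xu /u'u]; exact: ue.
Qed.

Definition vertex (v : V) : V -> R := fun w => (w == v)%:R.

Lemma geo_vertex s v : v \in s -> geo s (vertex v).
Proof.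
move=> vs; split=> [w|w|]; rewrite /vertex ?ler0n //.
  by have [->|//] := eqVneq w v; rewrite vs.
rewrite (big_fsetD1 v) ?in_fset //= eqxx big1_fset ?addr0 // => w.
by rewrite !inE => /andP[/negPf ->].
Qed.

Definition shrink c (a : R) x : V -> R := fun v => (1 - a) * x v + a * c v.

Lemma geo_shrink s c a x : 0 <= a <= 1 -> geo s c -> geo s x -> geo s (shrink c a x).
Proof.
move=> /andP[a0 a1] [c0 cs c1] [x0 xs x1]; split=> [v|v vs|].
- by rewrite addr_ge0 // mulr_ge0 // subr_ge0.
- by rewrite /shrink xs // cs // !mulr0 addr0.
- by rewrite /shrink big_split /= -!mulr_sumr x1 c1 !mulr1 subrK.
Qed.

(** The difference is (1 - a)(x - y) + (a - b)(c - y) with coordinates in [0, 1], so a short step of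
    the contraction spoils smallness only by its length. *)
Lemma shrink_dist s c a b x y v : 0 <= a <= 1 -> geo s c -> geo s y ->
  `|shrink c a x v - shrink c b y v| <= `|x v - y v| + `|a - b|.
Proof.
move=> /andP[a0 a1] gc gy.
have -> : shrink c a x v - shrink c b y v =
  (1 - a) * (x v - y v) + (a - b) * (c v - y v) by rewrite /shrink; ring.
apply: le_trans (ler_normD _ _) _; apply: lerD; rewrite normrM.
  rewrite ger0_norm ?subr_ge0 //; apply: ler_piMl => //.
  by rewrite gerBl.
apply: ler_piMr => //; rewrite ler_norml.
have [[c0 _ _] [y0 _ _]] := (gc, gy).
have := geo_le1 v gc; have := geo_le1 v gy; have := c0 v; have := y0 v.
by move=> *; apply/andP; split; lra.
Qed.

(** A chain has finitely many tuples, and coordinates outside s vanish, so finitely many strict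
    inequalities leave a uniform margin d. *)
Lemma small_gap e s (z : {malg rat[seq (V -> R)]}) : 0 < e ->
  chain_in (vietoris e s) z -> exists2 d : R, 0 < d &
    forall u x y v, z@_u != 0 -> x \in u -> y \in u -> `|x v - y v| + d <= e.
Proof.
move=> e0 ze; pose L := flatten (msupp z : seq (seq (V -> R))).
pose l := [seq (p, v) | p <- [seq (x, y) | x <- L, y <- L], v <- s].
(* [L] mixes points of different tuples, which need not be close; such pairs get the harmless value
   1. *)
pose a (q : (V -> R) * (V -> R) * V) := if `|q.1.1 q.2 - q.1.2 q.2| < e
  then e - `|q.1.1 q.2 - q.1.2 q.2| else 1.
have [q ql|d d0 dP] := @finite_lower_bound R _ l a.
  by rewrite /a; case: ifP => // qe; rewrite subr_gt0.
exists (Num.min d e); first by rewrite lt_min d0.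
move=> u x y v zu xu yu; have [us ue] := ze _ zu.
have inL x' : x' \in u -> x' \in L.
  by move=> x'u; apply/flattenP; exists u => //; rewrite -mcoeff_neq0.
have [vs|vs] := boolP (v \in s); last first.
  have [_ -> // _] := us _ xu; have [_ -> // _] := us _ yu.
  by rewrite subrr normr0 add0r ge_min lexx orbT.
have ql : ((x, y), v) \in l by apply: allpairs_f => //; apply: allpairs_f; exact: inL.
have := dP _ ql; rewrite /a /= ue // => de.
by rewrite -lerBrDl ge_min de.
Qed.

Lemma vietoris_acyclic e s (z : {malg rat[seq (V -> R)]}) : 0 < e -> s <> [::] ->
  chain_in (vietoris e s) z -> bd z = 0 ->
  exists w, chain_in (vietoris e s) w /\ bd w = z.
Proof.
move=> e0; case: s => // v0 s0 _; set s := v0 :: s0 => ze bz.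
have [d d0 dP] := small_gap e0 ze.
(* Steps of length 1/N < d keep every prism of the linear contraction to v0 e-small. *)
pose N := Num.bound d^-1; have dN : d^-1 < N%:R.
  by apply: archi_boundP; rewrite invr_ge0 ltW.
have N0 : 0 < N%:R :> R by apply: lt_trans dN; rewrite invr_gt0.
pose c := vertex v0; have gc : geo s c by apply: geo_vertex; rewrite mem_head.
pose a (j : nat) : R := j%:R / N%:R.
have a01 j : (j <= N)%N -> 0 <= a j <= 1.
  by move=> jN; rewrite /a divr_ge0 //= ler_pdivrMr // mul1r ler_nat.
have aS j : `|a j - a j.+1| < d /\ `|a j.+1 - a j| < d.
  suff E : a j.+1 - a j = N%:R^-1.
    by rewrite distrC E ger0_norm ?invr_ge0 ?ltW // invf_plt ?posrE.
  by rewrite /a -mulrBl -natrB // subSnn mul1r.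
have push0 : push (shrink c (a 0%N)) z = z.
  rewrite -[RHS]malg_ext_id; congr (malg_ext _ z); apply/funext => u.
  congr delta; rewrite -[RHS]map_id; apply: eq_map => x.
  by apply/funext => v; rewrite /shrink /a mul0r subr0 mul1r mul0r addr0.
suff [w [ww bw]] : exists w, chain_in (vietoris e s) w /\
    bd w = push (shrink c (a 0%N)) z by exists w; rewrite bw push0.
apply: (@contract_cycle _ _ (vietoris e s) (@vietoris_subset e s) (fun j => shrink c (a j)) N c) => //.
- move=> u zu j jN; have [us ue] := ze _ zu; split=> [x|x y v].
    by rewrite mem_cat => /orP[] /mapP[x' x'u ->]; apply: geo_shrink (us _ x'u) => //;
      apply: a01 => //; exact: ltnW.
  have D j' k x' y' : (j' <= N)%N -> x' \in u -> y' \in u -> `|a j' - a k| < d ->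
      `|shrink c (a j') x' v - shrink c (a k) y' v| < e.
    move=> jN' x'u y'u ajk.
    apply: le_lt_trans (shrink_dist _ _ _ (a01 _ jN') gc (us _ y'u)) _.
    by apply: lt_le_trans (dP _ _ _ v zu x'u y'u); rewrite ltrD2l.
  have [aj aj'] := aS j; have jN' := ltnW jN.
  rewrite !mem_cat => /orP[]/mapP[x' x'u ->] /orP[]/mapP[y' y'u ->];
    by apply: D; rewrite // subrr normr0.
- move=> u zu; have [us ue] := ze _ zu.
  have aN x : shrink c (a N) x = c.
    by apply/funext => v; rewrite /shrink /a divff ?gt_eqF // subrr mul0r add0r mul1r.
  have cE x : x \in c :: map (shrink c (a N)) u -> x = c.
    by rewrite inE => /predU1P[//|/mapP[x' _ ->]].
  split=> [x /cE -> //|x y v /cE -> /cE ->].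
  by rewrite subrr normr0.
Qed.

End Vietoris.

(** * Ordered chains of a contractible complex *)

Section Ordered.
Variables (R : realType) (V : choiceType) (S : simplicial_complex V).

Definition ordered : set (seq V) :=
  [set s : seq V | exists2 t, simplex S t & {subset s <= t}].

Lemma ordered_subset s u : ordered s -> {subset u <= s} -> ordered u.
Proof. by move=> [t St st] us; exists t => // v /us/st. Qed.

Lemma geo_realization s x : ordered s -> geo s x ->
  exists a : realization R S, bary a = x /\ {subset supp a <= s}.
Proof.
move=> [t St st] [x0 xs x1].
have [||//||a ax] := @realization_of R V S [fset v in s]%fset x.
- by [].
- by move=> v; rewrite in_fset; exact: xs.
- apply: (simplex_sub St).
    by apply/fsubsetP => v; rewrite !inE /= => /andP[/st].
  apply/negP => /eqP s0; have := oner_neq0 R; rewrite -x1 big_seq big1 ?eqxx // => v vs.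
  apply/eqP; apply: contraFT (in_fset0 v) => xv.
  by rewrite -s0 !inE /= xv andbT; rewrite in_fset in vs.
exists a; split=> // v; rewrite in_supp ax; apply: contraNT => vs.
by rewrite xs.
Qed.

Lemma simplex_chain_acyclic (s : seq V) (z : {malg rat[seq V]}) : s <> [::] ->
  chain_in [set u : seq V | {subset u <= s}] z -> bd z = 0 ->
  exists y, chain_in [set u : seq V | {subset u <= s}] y /\ bd y = z.
Proof.
case: s => // v s _ zs bz; exists (cone v z); split.
  apply: (chain_in_ext zs) => u us; apply: chain_in_delta => w.
  by rewrite inE => /predU1P[->|/us //]; exact: mem_head.
by rewrite bd_cone bz linear0 subr0.
Qed.

Hypothesis S_contr : contractible R (realization R S).

Lemma ordered_acyclic (z : {malg rat[seq V]}) : chain_in ordered z -> bd z = 0 ->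
  exists y, chain_in ordered y /\ bd y = z.
Proof.
move=> zS bz; have [x0 [H [cH H0 H1]]] := S_contr.
have [v0 v0x] := supp_neq0 x0.
pose F : {fset V} := [fset v in flatten (msupp z : seq (seq V))]%fset.
have [e e0 [f fP]] := lebesgue_vertex F cH v0.
(* The Lebesgue number concerns points carried by F, the vertices of z, so all constructions on z
   stay with tuples in F. *)
pose P : set (seq V) := [set s : seq V | ordered s /\ {subset s <= F}].
have zP : chain_in P z.
  move=> s zs; split; first exact: zS.
  move=> v vs; rewrite in_fset; apply/flattenP; exists s => //.
  by rewrite -mcoeff_neq0.
have Psub s u : P s -> {subset u <= s} -> P u.
  by move=> [os sF] us; split=> [|v /us/sF //]; exact: ordered_subset us.
have Pbd (T : choiceType) (C : seq V -> set (seq T)) :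
    (forall s u, {subset u <= s} -> C u `<=` C s) ->
    forall s, P s -> chain_in [set u | P u /\ C u `<=` C s] (bd_seq s).
  move=> Cs s Ps u /bd_seq_in[/mem_subseq us _].
  by split; [exact: Psub us|exact: Cs].
have geoP s x : P s -> geo s x ->
    exists a : realization R S, [/\ bary a = x, {subset supp a <= s} & (supp a `<=` F)%fset].
  move=> [os sF] gx; have [a [ax as_]] := geo_realization os gx.
  by exists a; split=> //; apply/fsubsetP => v /as_/sF.
have bd_nil (T : choiceType) : bd (delta [::]) = 0 :> {malg rat[seq T]}.
  exact: malg_ext_delta.
have Vnil : chain_in (vietoris e [::]) (delta [::] : {malg rat[seq (V -> R)]}).
  by apply: chain_in_delta; split.
have bd_w0 (s : seq V) : P s ->
    bd (0 : {malg rat[seq (V -> R)]}) = - (1 *: malg_ext (fun=> 0) (bd_seq s)).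
  by move=> _; rewrite malg_ext0 scaler0 oppr0 linear0.
(* The chain map replacing an ordered simplex by small tuples of points in its closed simplex; the
   carriers are acyclic by linear contraction. *)
have [phi [phi0 phiP]] := @acyclic_fill V (V -> R) P (vietoris e) (fun=> 0) 1
  (delta [::]) (Pbd _ _ (fun s u => @vietoris_sub _ _ e u s))
  (fun s _ sN z ze bz => vietoris_acyclic e0 sN ze bz)
  (fun _ _ => @chain_in0 _ _) bd_w0 Vnil (bd_nil _).
have bd_phi s : P s -> bd (phi s) = malg_ext phi (bd_seq s).
  by move=> /phiP[_ ->]; rewrite add0r scale1r.
pose C (s : seq V) := [set u : seq V | {subset u <= s}].
have Cs s u : {subset u <= s} -> C u `<=` C s by move=> us w wu x /wu/us.
(* As H is the identity at time 0, [f 0] sends points of a closed simplex to its vertices. So [f 0]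
   after [phi] and the identity share the acyclic carrier [C], and [D] below is a homotopy between
   them. *)
pose w s : {malg rat[seq V]} := push (f 0) (phi s) - delta s.
have f0P s u : P s -> vietoris e s u -> {subset map (f 0) u <= s}.
  move=> Ps [us _] _ /mapP[x xu ->].
  have [a [ax as_ aF]] := geoP _ _ Ps (us _ xu); apply: as_.
  rewrite -ax -[in supp _](H0 a); apply: fP => //; rewrite ?lexx ?ler01 ?subrr ?normr0 //.
  by move=> v; rewrite subrr normr0.
have wC s : P s -> chain_in (C s) (w s).
  move=> Ps; apply: chain_inB; last by apply: chain_in_delta => x.
  have [phis _] := phiP _ Ps; apply: (chain_in_ext phis) => u us.
  by apply: chain_in_delta; exact: f0P us.
have bd_w s : P s -> bd (w s) = - (-1 *: malg_ext w (bd_seq s)).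
  move=> Ps; rewrite scaleN1r opprK /w.
  have -> : bd (push (f 0) (phi s) - delta s) = bd (push (f 0) (phi s)) - bd (delta s).
    exact: linearB.
  rewrite bd_push bd_phi // malg_ext_delta malg_extB malg_ext_id.
  by rewrite (malg_ext_comp (push (f 0))).
have C0 : chain_in (C [::]) 0 by exact: chain_in0.
have bdw0 : bd 0 = w [::].
  by rewrite /w phi0 malg_ext_delta /= subrr linear0.
have [D [D0 DP]] := @acyclic_fill V V P C w (-1) 0 (Pbd _ C Cs)
  (fun s _ sN z => @simplex_chain_acyclic s z sN) wC bd_w C0 bdw0.
pose z1 := push (f 0) (malg_ext phi z).
have bdD : bd (malg_ext D z) = z1 - z.
  apply: (etrans (malg_ext_comp bd D z)).
  apply: (etrans (@malg_ext_eq _ _ _ (bd \o D) (fun u => w u + -1 *: malg_ext D (bd_seq u)) _ zP _)).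
    by move=> u /DP[_].
  rewrite malg_extD malg_extZ -(malg_ext_comp (malg_ext D) (@bd_seq _) z) bz.
  rewrite linear0 scaler0 addr0 malg_extB malg_ext_id.
  by rewrite /z1 (malg_ext_comp (push (f 0))).
have bd_phiz : bd (malg_ext phi z) = 0.
  apply: (etrans (malg_ext_comp bd phi z)).
  apply: (etrans (@malg_ext_eq _ _ _ (bd \o phi) (malg_ext phi \o @bd_seq _) _ zP _)).
    by move=> u /bd_phi.
  by rewrite -(malg_ext_comp (malg_ext phi) (@bd_seq _) z) bz linear0.
pose N := Num.bound e^-1; have eN : e^-1 < N%:R.
  by apply: archi_boundP; rewrite invr_ge0 ltW.
have N0 : 0 < N%:R :> R by apply: lt_trans eN; rewrite invr_gt0.
pose t (j : nat) : R := j%:R / N%:R.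
have t01 j : (j <= N)%N -> 0 <= t j <= 1.
  by move=> jN; rewrite /t divr_ge0 //= ler_pdivrMr // mul1r ler_nat.
have phiz : chain_in [set u | exists s, P s /\ vietoris e s u] (malg_ext phi z).
  apply: (chain_in_ext zP) => s Ps; have [phis _] := phiP _ Ps.
  by apply: (chain_in_sub _ phis) => u us; exists s.
(* At any time within e of t_j, all points of a small tuple receive vertices of the single simplex
   [supp (H (t j, a))], where a is one of them. *)
have fsupp s u x j k : P s -> vietoris e s u -> x \in u -> (j <= N)%N -> (k <= N)%N ->
    `|t j - t k| < e -> exists2 a : realization R S, bary a = x &
    forall y, y \in u -> f (t k) y \in supp (H (t j, a)).
  move=> Ps [us ue] xu jN kN jk; have [a [ax _ aF]] := geoP _ _ Ps (us _ xu).
  exists a => // y yu; have [b [by_ _ bF]] := geoP _ _ Ps (us _ yu).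
  by rewrite -by_; apply: fP => //; rewrite ?t01 // => v; rewrite ax by_; exact: ue.
have [||y [yS bdy]] := @contract_cycle _ _ ordered ordered_subset (fun j => f (t j)) N v0 _ bd_phiz.
- move=> [|x u] /phiz[s [Ps us]] j jN.
    (* The empty tuple lies in any simplex; [supp x0] is one at hand. *)
    by exists (supp x0) => //; exact: supp_simplex.
  have xu : x \in x :: u by exact: mem_head.
  have dt : `|t j - t j.+1| < e.
    rewrite distrC -mulrBl -natrB // subSnn mul1r ger0_norm ?invr_ge0 ?ltW //.
    by rewrite invf_plt ?posrE.
  have tt : `|t j - t j| < e by rewrite subrr normr0.
  have [a ax aP] := fsupp s (x :: u) x j j Ps us xu (ltnW jN) (ltnW jN) tt.
  have [b bx bP] := fsupp s (x :: u) x j j.+1 Ps us xu (ltnW jN) jN dt.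
  have ab : b = a by apply: val_inj; move: bx; rewrite -ax.
  exists (supp (H (t j, a))); first exact: supp_simplex.
  move=> v; rewrite mem_cat => /orP[]/mapP[y yu ->]; first exact: aP.
  by rewrite -ab; exact: bP.
(* At time 1 the map H is constant with value x0, so all assigned vertices and the apex v0 lie in
   [supp x0]. *)
- move=> u /phiz[s [Ps us]]; exists (supp x0); first exact: supp_simplex.
  move=> v; rewrite inE => /predU1P[->//|/mapP[y yu ->]].
  have tt : `|t N - t N| < e by rewrite subrr normr0.
  have [a ax aP] := fsupp s u y N N Ps us yu (leqnn N) (leqnn N) tt.
  have tN : t N = 1 by rewrite /t divff // gt_eqF.
  by have := aP _ yu; rewrite tN H1.
exists (y - malg_ext D z); split.
  apply: chain_inB => //; apply: (chain_in_ext zP) => s Ps.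
  have [Ds _] := DP _ Ps; apply: (chain_in_sub _ Ds) => u us.
  by have [os _] := Ps; exact: ordered_subset us.
have -> : bd (y - malg_ext D z) = bd y - bd (malg_ext D z) by exact: linearB.
have t0 : t 0%N = 0 by rewrite /t mul0r.
rewrite bdD bdy t0 -/z1.
exact: subKr.
Qed.

End Ordered.

(** * Flags and the barycentric subdivision *)

Section Flags.
Variables (V : choiceType) (S : simplicial_complex V).
Implicit Types (s u : seq {fset V}) (t o : {fset V}).

Definition flag : set (seq {fset V}) := [set s : seq {fset V} |
  sorted (fun a b : {fset V} => (b `<` a)%fset) s /\ forall t, t \in s -> simplex S t].

Let gt_trans : transitive (fun a b : {fset V} => (b `<` a)%fset).
Proof. by move=> b a c ab bc; exact: (fproper_sub_trans bc (fproper_sub ab)). Qed.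

Lemma flag_subseq s u : flag s -> subseq u s -> flag u.
Proof.
move=> [ss sS] us; split; first exact: (subseq_sorted gt_trans us).
by move=> t /(mem_subseq us)/sS.
Qed.

Lemma flag_consP t s :
  flag (t :: s) <-> [/\ simplex S t, flag s & forall o, o \in s -> (o `<` t)%fset].
Proof.
split=> [[/= pts sS]|[St [ss sS] st]].
  have := pts; rewrite (path_sortedE gt_trans) => /andP[/allP ts ss].
  split=> //; first by apply: sS; rewrite mem_head.
  by split=> // u us; apply: sS; rewrite inE us orbT.
split; last by move=> u; rewrite inE => /predU1P[->|/sS].
by rewrite /= (path_sortedE gt_trans); apply/andP; split=> //; exact/allP.
Qed.

Lemma flag_head s t : flag s -> t \in s -> (t `<=` head fset0 s)%fset.
Proof.
case: s => // o s /flag_consP[_ _ os]; rewrite inE => /predU1P[->//|/os].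
exact: fproper_sub.
Qed.

Definition flag_below o : set (seq {fset V}) :=
  [set s | flag s /\ forall t, t \in s -> (t `<=` o)%fset].

(* The cone over the chains below [o], normalised to avoid a repeated [o]. *)
Definition flag_cone o s : {malg rat[seq {fset V}]} :=
  if o \in s then 0 else delta (o :: s).

(** If o occurs in s it is the top of s, and the right-hand side cancels: the face of s omitting o
    is coned back to s, and every other face still contains o. *)
Lemma bd_flag_cone o s : flag_below o s ->
  bd (flag_cone o s) = delta s - malg_ext (flag_cone o) (bd_seq s).
Proof.
move=> [fs so]; have [os|os] := boolP (o \in s); last first.
  rewrite /flag_cone (negPf os) malg_ext_delta /=; congr (_ - _).
  apply: (malg_ext_eq (@bd_seq_in _ s)) => u [us _].
  have ou : o \notin u by apply: contra os; exact: (mem_subseq us).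
  by rewrite (negPf ou).
case: s => // t s in fs so os *.
have [_ _ st] := (flag_consP _ _).1 fs.
have ot : o = t.
  move: os; rewrite inE => /predU1P[//|/st]; have := so t (mem_head _ _).
  by move=> to /fproper_sub ot; apply/eqP; rewrite eqEfsubset to ot.
rewrite -{t}ot in fs so os st *.
have ns : o \notin s by apply/negP => /st; rewrite fproperEneq eqxx.
rewrite {1}/flag_cone mem_head linear0 /=.
have -> : malg_ext (flag_cone o) (delta s - cone o (bd_seq s)) =
    malg_ext (flag_cone o) (delta s) - malg_ext (flag_cone o) (cone o (bd_seq s)).
  exact: linearB.
rewrite malg_ext_delta {1}/flag_cone (negPf ns).
rewrite (malg_ext_comp (malg_ext (flag_cone o))).
rewrite (@malg_ext_eq _ _ _ _ (fun=> 0) _ (@bd_seq_in _ s)).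
  by rewrite malg_ext0 subr0 subrr.
by move=> u _ /=; rewrite malg_ext_delta /flag_cone mem_head.
Qed.

Lemma flag_below_acyclic o (z : {malg rat[seq {fset V}]}) : simplex S o ->
  chain_in (flag_below o) z -> bd z = 0 ->
  exists y, chain_in (flag_below o) y /\ bd y = z.
Proof.
move=> So zo bz; exists (malg_ext (flag_cone o) z); split.
  apply: (chain_in_ext zo) => s [fs so]; rewrite /flag_cone.
  case: ifPn => os; first exact: chain_in0.
  apply: chain_in_delta; split.
    apply/flag_consP; split=> // u us; rewrite fproperEneq so // andbT.
    by apply: contraNneq os => <-.
  by move=> t; rewrite inE => /predU1P[->|/so].
apply: (etrans (malg_ext_comp bd (flag_cone o) z)).
apply: (etrans (@malg_ext_eq _ _ _ (bd \o flag_cone o)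
  (fun s => delta s - malg_ext (flag_cone o) (bd_seq s)) _ zo _)).
  by move=> s /bd_flag_cone.
rewrite malg_extB malg_ext_id -(malg_ext_comp (malg_ext (flag_cone o)) (@bd_seq _) z) bz.
by rewrite linear0 subr0.
Qed.

Section Acyclic.
Hypothesis S_ex : exists t, simplex S t.
Hypothesis ordered_acyclic : forall z : {malg rat[seq V]}, chain_in (ordered S) z ->
  bd z = 0 -> exists y, chain_in (ordered S) y /\ bd y = z.

(** The chosen vertices [pv] map flags to ordered tuples, and acyclic carriers give a chain map [r]
    back to flags of simplices inside the tuple. Going there and back stays below the top simplex of
    a flag, hence is homotopic to the identity, and acyclicity is inherited. *)
Lemma flag_acyclic (z : {malg rat[seq {fset V}]}) : chain_in flag z -> bd z = 0 ->
  exists y, chain_in flag y /\ bd y = z.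
Proof.
move=> zf bz.
have [t0 St0] := S_ex; have /fset0Pn[v0 _] := simplex_neq0 St0.
have pv_ex t : exists v, simplex S t -> v \in t.
  have [/simplex_neq0/fset0Pn[v vt]|nS] := pselect (simplex S t); first by exists v.
  by exists v0.
have [pv pvP] := choice pv_ex.
pose B (s : seq V) : set (seq {fset V}) :=
  [set u | flag u /\ forall t, t \in u -> {subset t <= s}].
have Bnil (T : choiceType) : bd (delta [::]) = 0 :> {malg rat[seq T]}.
  exact: malg_ext_delta.
have bd_w0 (s : seq V) : ordered S s ->
    bd (0 : {malg rat[seq {fset V}]}) = - (1 *: malg_ext (fun=> 0) (bd_seq s)).
  by move=> _; rewrite malg_ext0 scaler0 oppr0 linear0.
have Obd (s : seq V) : ordered S s ->
    chain_in [set u | ordered S u /\ B u `<=` B s] (bd_seq s).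
  move=> os u /bd_seq_in[/mem_subseq us _]; split; first exact: ordered_subset os us.
  by move=> w [fw wu]; split=> // t /wu tu v /tu/us.
have Bacyc (s : seq V) : ordered S s -> s <> [::] -> forall c : {malg rat[seq {fset V}]},
    chain_in (B s) c -> bd c = 0 -> exists y, chain_in (B s) y /\ bd y = c.
  move=> [t St st] sN c cB bc.
  have Bo : B s = flag_below [fset v in s]%fset.
    apply/seteqP; split=> u [fu us]; split=> // t' t'u.
      by apply/fsubsetP => v vt; rewrite in_fset; exact: us vt.
    by move=> v vt; have /fsubsetP/(_ _ vt) := us _ t'u; rewrite in_fset.
  rewrite Bo in cB *; apply: flag_below_acyclic => //.
  apply: (simplex_sub St).
    by apply/fsubsetP => v; rewrite in_fset; exact: st.
  case: s sN {st Bo cB} => // v s _; apply/fset0Pn; exists v.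
  by rewrite in_fset mem_head.
have Bn : chain_in (B [::]) (delta [::] : {malg rat[seq {fset V}]}).
  by apply: chain_in_delta; split.
have [r [r0 rP]] := @acyclic_fill V {fset V} (ordered S) B (fun=> 0) 1
  (delta [::]) Obd Bacyc (fun _ _ => @chain_in0 _ _) bd_w0 Bn (Bnil _).
have bd_r (s : seq V) : ordered S s -> bd (r s) = malg_ext r (bd_seq s).
  by move=> /rP[_ ->]; rewrite add0r scale1r.
have pv_ordered s : flag s -> ordered S (map pv s) /\ {subset map pv s <= head fset0 s}.
  move=> fs; have sub : {subset map pv s <= head fset0 s}.
    move=> _ /mapP[t ts ->]; apply: (fsubsetP (flag_head fs ts)).
    by apply: pvP; case: fs => _; apply.
  split=> //; case: s fs sub => [|t s] fs sub; first by exists t0.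
  by exists t => //; have [] := (flag_consP _ _).1 fs.
pose C s := flag_below (head fset0 s).
have Fbd s : flag s -> chain_in [set u | flag u /\ C u `<=` C s] (bd_seq s).
  move=> fs u /bd_seq_in[us _]; split; first exact: flag_subseq us.
  move=> w [fw wu]; split=> // t /wu tu; apply: (fsubset_trans tu).
  case: u us {wu tu} => [|t' u] us /=; first exact: fsub0set.
  by apply: (flag_head fs); apply: (mem_subseq us); exact: mem_head.
have Cacyc s : flag s -> s <> [::] -> forall c : {malg rat[seq {fset V}]},
    chain_in (C s) c -> bd c = 0 -> exists y, chain_in (C s) y /\ bd y = c.
  case: s => // t s /flag_consP[St _ _] _ c; exact: flag_below_acyclic.
pose w s : {malg rat[seq {fset V}]} := r (map pv s) - delta s.
have wC s : flag s -> chain_in (C s) (w s).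
  move=> fs; have [os sh] := pv_ordered s fs; apply: chain_inB.
    have [rs _] := rP _ os; apply: (chain_in_sub _ rs) => u [fu us]; split=> // t tu.
    by apply/fsubsetP => v vt; apply: sh; exact: us vt.
  by apply: chain_in_delta; split=> // t; exact: flag_head.
have r_push c : malg_ext r (push pv c) = malg_ext (r \o map pv) c.
  apply: (etrans (malg_ext_comp (malg_ext r) _ c)).
  by congr (malg_ext _ c); apply/funext => s /=; rewrite malg_ext_delta.
have bd_w s : flag s -> bd (w s) = - (-1 *: malg_ext w (bd_seq s)).
  move=> fs; have [os _] := pv_ordered s fs; rewrite scaleN1r opprK.
  have -> : bd (w s) = bd (r (map pv s)) - bd (delta s) by exact: linearB.
  rewrite bd_r // malg_ext_delta -push_bd_seq r_push.
  by rewrite malg_extB malg_ext_id.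
have bdw0 : bd 0 = w [::] by rewrite /w /= r0 subrr linear0.
have [D [D0 DP]] := @acyclic_fill {fset V} {fset V} flag C w (-1) 0 Fbd Cacyc wC bd_w
  (@chain_in0 _ _) bdw0.
have bdD : bd (malg_ext D z) = malg_ext r (push pv z) - z.
  apply: (etrans (malg_ext_comp bd D z)).
  apply: (etrans (@malg_ext_eq _ _ _ (bd \o D) (fun u => w u + -1 *: malg_ext D (bd_seq u)) _ zf _)).
    by move=> u /DP[_].
  rewrite malg_extD malg_extZ -(malg_ext_comp (malg_ext D) (@bd_seq _) z) bz.
  by rewrite linear0 scaler0 addr0 malg_extB malg_ext_id r_push.
have [||y [yO bdy]] := ordered_acyclic (z := push pv z).
- apply: (chain_in_ext zf) => s fs; apply: chain_in_delta.
  by have [] := pv_ordered s fs.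
- by rewrite bd_push bz linear0.
exists (malg_ext r y - malg_ext D z); split.
  apply: chain_inB.
    apply: (chain_in_ext yO) => s os; have [rs _] := rP _ os.
    by apply: (chain_in_sub _ rs) => u [].
  apply: (chain_in_ext zf) => s fs; have [Ds _] := DP _ fs.
  by apply: (chain_in_sub _ Ds) => u [].
have -> : bd (malg_ext r y - malg_ext D z) = bd (malg_ext r y) - bd (malg_ext D z).
  exact: linearB.
have -> : bd (malg_ext r y) = malg_ext r (bd y).
  apply: (etrans (malg_ext_comp bd r y)).
  apply: (etrans (@malg_ext_eq _ _ _ (bd \o r) (malg_ext r \o @bd_seq _) _ yO _)).
    by move=> u /bd_r.
  by rewrite -(malg_ext_comp (malg_ext r) (@bd_seq _) y).
by rewrite bdy bdD; exact: subKr.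
Qed.

End Acyclic.
End Flags.

(** * Orientations *)

Lemma zmod_polar (A : zmodType) (x a b c d : A) :
  x = (a + b) + (c + d) -> x = 0 -> a = 0 -> d = 0 -> b = - c.
Proof.
move=> -> /eqP + a0 d0; rewrite a0 d0 add0r addr0 addr_eq0.
by move=> /eqP.
Qed.

Section Wedge.
Import perm.
Variables (n : nat) (M : lmodType rat).
Implicit Types (t : {ffun 'I_n -> M}) (i j : 'I_n) (u v : M).

Let wedge_rel (x : {malg rat[{ffun 'I_n -> M}]}) :
  ext_rel x -> lproj (@ext_rel n M) x = 0.
Proof.
move=> rx; rewrite -[RHS](raddf0 (lproj (@ext_rel n M))); apply/lprojP/asboolP.
exists [:: (1, x)]; rewrite big_seq1 scale1r subr0; split=> // p.
by rewrite inE => /eqP ->.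
Qed.

Lemma wedgeD t i u v :
  wedge (upd t i (u + v)) = wedge (upd t i u) + wedge (upd t i v).
Proof.
have rel : ext_rel (delta (upd t i (1 *: u + v)) -
   (1 *: delta (upd t i u) + delta (upd t i v))) by left; exists t, i, 1, u, v.
have := wedge_rel rel; rewrite !scale1r linearB linearD => /eqP.
by rewrite subr_eq0 => /eqP.
Qed.

Lemma wedge_alt t i j : i != j -> t i = t j -> wedge t = 0.
Proof. by move=> ij tij; apply: wedge_rel; right; exists t, i, j. Qed.

Lemma updC t i j u v : i != j -> upd (upd t i u) j v = upd (upd t j v) i u.
Proof.
move=> ij; apply/ffunP => k; rewrite !ffunE.
have [->|] := eqVneq k j; last by [].
by rewrite eq_sym (negPf ij).
Qed.

Lemma upd_id t i : upd t i (t i) = t.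
Proof. by apply/ffunP => k; rewrite ffunE; case: eqP => [->|]. Qed.

(** Polarisation: the wedge with t i + t j in both slots vanishes and is expanded bilinearly. *)
Lemma wedge_swap t i j : i != j ->
  wedge (upd (upd t i (t j)) j (t i)) = - wedge t.
Proof.
move=> ij; pose W a b := wedge (upd (upd t i a) j b).
have Walt a : W a a = 0.
  by apply: (wedge_alt ij); rewrite !ffunE eqxx eqxx (negPf ij).
have WDr a b c : W a (b + c) = W a b + W a c by exact: wedgeD.
have WDl a b c : W (a + b) c = W a c + W b c.
  by rewrite /W ![upd (upd t i _) j c]updC // wedgeD.
have Wt : W (t i) (t j) = wedge t.
  rewrite /W upd_id; congr wedge; exact: upd_id.
rewrite -Wt; apply: (zmod_polar _ (Walt (t i + t j)) (Walt (t i)) (Walt (t j))).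
exact: etrans (WDr _ _ _) (f_equal2 +%R (WDl _ _ _) (WDl _ _ _)).
Qed.

Lemma wedge_perm t (s : {perm 'I_n}) :
  wedge [ffun i => t (s i)] = wedge t \/ wedge [ffun i => t (s i)] = - wedge t.
Proof.
have [ts -> _] := prod_tpermP s.
elim: ts t => [|[i j] ts IH] t /=.
  left; congr wedge; apply/ffunP => i.
  by rewrite ffunE big_nil perm1.
rewrite big_cons /=.
pose p := (\prod_(k <- ts) tperm k.1 k.2)%g.
have E : [ffun k => t ((tperm i j * p)%g k)] =
    [ffun k => [ffun l => t (p l)] (tperm i j k)].
  by apply/ffunP => k; rewrite !ffunE permM.
rewrite E; have [<-|ij] := eqVneq i j.
  have -> : [ffun k => [ffun l => t (p l)] (tperm i i k)] = [ffun l => t (p l)].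
    by apply/ffunP => k; rewrite !ffunE tperm1 perm1.
  exact: IH.
set t' := [ffun l => t (p l)] in IH *.
have -> : [ffun k => t' (tperm i j k)] = upd (upd t' i (t' j)) j (t' i).
  apply/ffunP => k; rewrite !ffunE.
  by case: tpermP => [->|->|/eqP/negPf -> /eqP/negPf ->];
    rewrite ?(negPf ij) ?eqxx.
rewrite wedge_swap //; case: (IH t) => ->; first by right.
by left; rewrite opprK.
Qed.

End Wedge.

Section Orientation.
Import perm.
Variables (G : topGroupType) (V : gSetType G) (w : {fset V}).

Let n := #|` w|.
Let vert (i : 'I_n) : V := tnth (in_tuple w) i.

(** The minor on the columns of the vertices of w. It induces a linear form on the exterior power
    with value 1 at [orient w], and it vanishes on a wedge of vertices one of which lies outside
    w. *)
Let coord_det (t : {ffun 'I_n -> {malg rat[V]}}) : rat^o :=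
  \det (\matrix_(i, j) (t i)@_(vert j)).

Let coord_det_rel r : ext_rel r -> malg_ext coord_det r = 0.
Proof.
case=> [[t [i [a [u [v ->]]]]]|[t [i [j [ij tij ->]]]]].
  apply: (etrans (linearB (malg_ext coord_det) _ _)).
  have E : malg_ext coord_det (a *: delta (upd t i u) + delta (upd t i v)) =
      a * coord_det (upd t i u) + 1 * coord_det (upd t i v).
    rewrite mul1r; apply: (etrans (linearD (malg_ext coord_det) _ _)).
    apply: (f_equal2 +%R _ (malg_ext_delta _ _)).
    apply: (etrans (linearZZ (malg_ext coord_det) _ _)).
    have := malg_ext_delta coord_det (upd t i u).
    by move=> /(congr1 (fun x : rat^o => a *: x)).
  apply: (etrans (f_equal2 (fun x y : rat^o => x - y) (malg_ext_delta _ _) E)).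
  apply/eqP; rewrite subr_eq0; apply/eqP; apply: (determinant_multilinear (i0 := i)).
  - by apply/rowP => k; rewrite !mxE !ffunE eqxx mcoeffD fgscaleE mul1r.
  - apply/matrixP => k l; rewrite !mxE !ffunE.
    by rewrite -[_ == i]/(lift i k == i) eq_sym (negPf (neq_lift i k)).
  - apply/matrixP => k l; rewrite !mxE !ffunE.
    by rewrite -[_ == i]/(lift i k == i) eq_sym (negPf (neq_lift i k)).
rewrite malg_ext_delta; apply: (determinant_alternate ij) => k.
by rewrite !mxE tij.
Qed.

Let coord_ext : ext n {malg rat[V]} -> rat^o := lquot_lift (malg_ext coord_det).

Let coord_ext_wedge t : coord_ext (wedge t) = coord_det t.
Proof.
apply: (etrans (lquot_liftE _ coord_det_rel)).
exact: malg_ext_delta.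
Qed.

Let coord_extN x : coord_ext (- x) = - coord_ext x.
Proof.
rewrite -[x]lreprK.
have -> : - lproj (@ext_rel n {malg rat[V]}) (lrepr x) = lproj (@ext_rel n {malg rat[V]}) (- lrepr x).
  by rewrite linearN.
apply: (etrans (lquot_liftE _ coord_det_rel)).
apply/esym; apply: (etrans (congr1 -%R (lquot_liftE _ coord_det_rel))).
by apply/esym; rewrite linearN.
Qed.

Let vert_inj : injective vert.
Proof. by apply/tuple_uniqP; exact: fset_uniq. Qed.

Let vertP v : v \in w -> exists i, vert i = v.
Proof. by move=> vw; have /tnthP[i ->] : v \in in_tuple w by []; exists i. Qed.

Let orient_coord : coord_ext (orient w) = 1.
Proof.
rewrite coord_ext_wedge -[RHS](det1 _ n); congr (\det _).
apply/matrixP => i j; rewrite !mxE ffunE mcoeffU (inj_eq vert_inj).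
by case: eqP.
Qed.

(** An element preserving w permutes its vertices and so changes the wedge at most by a sign. If a
    vertex leaves w, a row of the determinant vanishes, whereas it would be 1 or -1 if the wedge
    were preserved up to sign. *)
Lemma stab_pmE : stab_pm G w = [set g : G | gact g w = w].
Proof.
have gK (g : G) : injective (gact g : V -> V).
  by move=> x y /(congr1 (gact g^-1%g)); rewrite !gactK.
apply/seteqP; split=> g; rewrite /stab_pm /=; last first.
  move=> gw; have go : gact g (orient w) = orient w \/ gact g (orient w) = - orient w.
    have gv i : exists j, vert j = gact g (vert i).
      by apply: vertP; rewrite -gw; apply: in_imfset; rewrite /vert mem_tnth.
    have [f fP] := choice gv.
    have f_inj : injective f.
      by move=> i j fij; apply: vert_inj; apply: (gK g); rewrite -!fP fij.
    rewrite /orient gact_wedge.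
    have -> : gact g [ffun i => delta (tnth (in_tuple w) i)] =
        [ffun i => [ffun j => delta (vert j)] (perm f_inj i)] :> {ffun 'I_n -> {malg rat[V]}}.
      by apply/ffunP => i; rewrite !ffunE gact_delta permE fP.
    exact: wedge_perm.
  have gN : gact g (- orient w) = - gact g (orient w) by exact: linearN.
  apply/seteqP; split=> [_ [x /= xo <-]|x /= xo].
    by case: go xo => E [->|->]; rewrite ?gN E ?opprK; [left|right|right|left].
  case: go xo => E [->|->].
  - by exists (orient w); [left|].
  - by exists (- orient w); [right|rewrite gN E].
  - by exists (- orient w); [right|rewrite gN E opprK].
  - by exists (orient w); [left|].
move=> gE.
have {gE} go : coord_ext (gact g (orient w)) != 0.
  have : (gact g @` [set orient w; - orient w]) (gact g (orient w)).
    by exists (orient w) => //; left.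
  by rewrite gE => -[->|->]; rewrite ?coord_extN orient_coord ?oppr_eq0 oner_neq0.
have sub : (gact g w `<=` w)%fset.
  apply/fsubsetP => _ /imfsetP[v /= vw ->]; apply: contraNT go => gv.
  have [i iv] := vertP vw.
  apply/eqP; rewrite /orient gact_wedge coord_ext_wedge /coord_det.
  rewrite (expand_det_row _ i) big1 // => j _; rewrite !mxE !ffunE.
  rewrite -/(vert i) iv gact_delta mcoeffU; case: eqP => [E|_]; last by rewrite mul0r.
  by move: gv; rewrite E /vert mem_tnth.
apply/eqP; rewrite eqEfcard sub /= card_imfset //.
Qed.

End Orientation.

(** * The resolution by flags *)

Section PermMod.
Variables (G : topGroupType) (Y : gSetType G).
Hypothesis CO_Y : forall y : Y, CO G (stab y).

Let P := perm_mod (CO_discrete CO_Y).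

(** A preimage of f(r) is averaged over the stabiliser of the orbit representative r. The average is
    fixed by that stabiliser and still maps to f(r), so it extends equivariantly along the orbit. *)
Lemma perm_projective : projective P.
Proof.
move=> A B p f onto_p.
have [dA dB] := (@disMod_discrete _ A, @disMod_discrete _ B).
have [a aP] := choice (fun y => onto_p (f (delta y))).
(* Orbits are taken as sets, so that the representative chosen by [c] depends on the orbit only. *)
pose orb (y : Y) : set Y := [set z | exists g, gact g z = y].
have orbM g y : orb (gact g y) = orb y.
  apply/seteqP; split=> z [k zy].
    by exists (g^-1 * k)%g; rewrite gactM zy gactK.
  by exists (g * k)%g; rewrite gactM zy.
have c_ex (X : set Y) : exists r : option Y, (exists x, X x) -> exists x, r = Some x /\ X x.
  have [[x Xx]|nX] := pselect (exists x, X x); last by exists None.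
  by exists (Some x) => _; exists x.
have [c cP] := choice c_ex.
pose hval (y : Y) : A := if c (orb y) is Some r then
  gact (xget 1%g [set g | gact g r = y]) (av (stab r) (a r)) else 0.
have hvalE y : exists r, c (orb y) = Some r /\
    forall g, gact g r = y -> hval y = gact g (av (stab r) (a r)).
  have [|r [cr [k ky]]] := cP (orb y); first by exists y, 1%g; rewrite gact1.
  exists r; split=> // g gy; rewrite /hval cr.
  have := xgetPex 1%g (ex_intro (fun g => gact g r = y) k ky).
  set g' := xget _ _ => /= g'y.
  rewrite -[g'](mulVKg g) gactM; congr (gact g _).
  apply: av_gact; first exact: CO_Y.
  by rewrite /stab /= gactM g'y -gy gactK.
have orb_rep y r : c (orb y) = Some r -> exists g, gact g r = y.
  have [|r' [-> [k ky]] [<-]] := cP (orb y); first by exists y, 1%g; rewrite gact1.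
  by exists k.
have hval_act g y : hval (gact g y) = gact g (hval y).
  have [r [cr rE]] := hvalE y; have [r' [cr' rE']] := hvalE (gact g y).
  have rr' : r' = r by move: cr'; rewrite orbM cr => -[].
  have [k ky] := orb_rep _ _ cr.
  by rewrite (rE k ky) (rE' (g * k)%g) ?rr' gactM // ky.
exists (perm_ghom hval_act : ghom P A) => x.
pose F : {linear {malg rat[Y]} -> B} := (p \o malg_ext hval : {malg rat[Y]} -> B).
have lf : linear (f : {malg rat[Y]} -> B) by move=> b u v; exact: ghom_linear.
pose F' : {linear {malg rat[Y]} -> B} := HB.pack (f : {malg rat[Y]} -> B)
  (GRing.isLinear.Build _ _ _ _ _ lf).
apply: (malg_ind_linear (f := F) (g := F')) => y /=.
rewrite malg_ext_delta; have [r [cr rE]] := hvalE y; have [k ky] := orb_rep _ _ cr.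
rewrite (rE k ky) ghom_act -av_ghom // aP av_fixed //.
  by rewrite -ky -gact_delta; exact/esym/(ghom_act f).
move=> g gr; rewrite /stab /=.
by apply: (etrans (esym (ghom_act f g (delta r)))); rewrite gact_delta gr.
Qed.

Lemma perm_fin_gen (r : seq Y) : orbit_system r -> fin_gen P.
Proof.
move=> [rex _]; pose U (i : 'I_(size r)) := CO_stab CO_Y (tnth (in_tuple r) i).
pose Z : gSetType G := coprod (fun i => lcoset (val (U i))).
pose F (z : Z) : {malg rat[Y]} :=
  delta (gact (xget 1%g (val (tagged z))) (tnth (in_tuple r) (tag z))).
have FE i g : F (Tagged (fun i => lcoset (val (U i)) : Type) (mkcoset (val (U i)) g)) =
    delta (gact g (tnth (in_tuple r) i)).
  rewrite /F /=; have [u su ->] := ltrans_xgetM g (is_subgroup_stab (tnth (in_tuple r) i)).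
  by rewrite gactM su.
have zE (z : Z) : exists i g,
    z = Tagged (fun i => lcoset (val (U i)) : Type) (mkcoset (val (U i)) g).
  case: z => i [A pA]; have /set_mem[g _ gA] := pA; exists i, g.
  apply: (congr1 (Tagged (fun i => lcoset (val (U i)) : Type))).
  exact: val_inj.
have F_act g z : F (gact g z) = gact g (F z).
  have [i [k ->]] := zE z; rewrite FE gact_delta -gactM -FE; congr F.
  apply: (congr1 (Tagged (fun i => lcoset (val (U i)) : Type))).
  by apply: val_inj; rewrite /= ltransM.
exists (size r), U, (perm_ghom F_act : ghom _ P) => x.
have pre y : exists z, malg_ext F z = delta y.
  have [x' x'r [g <-]] := rex y.
  have /tnthP[i ->] : x' \in in_tuple r by [].
  exists (delta (Tagged (fun i => lcoset (val (U i)) : Type) (mkcoset (val (U i)) g) : Z)).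
  by rewrite malg_ext_delta FE.
have [q qP] := choice pre; exists (malg_ext q x).
pose f : {linear {malg rat[Y]} -> {malg rat[Y]}} :=
  (malg_ext F \o malg_ext q : {malg rat[Y]} -> {malg rat[Y]}).
apply: (malg_ind_linear (f := f) (g := idfun)) => y /=.
by rewrite malg_ext_delta qP.
Qed.

End PermMod.

Lemma orbit_system_ex (G : topGroupType) (Y : gSetType G) (Z : seq Y) :
  (forall y, exists2 z, z \in Z & exists g, gact g z = y) ->
  exists r, [/\ uniq r, {subset r <= Z} & orbit_system r].
Proof.
move=> Zall.
suff [r [ur rZ rZcov rsep]] : exists r : seq Y, [/\ uniq r, {subset r <= Z},
    forall z, z \in Z -> exists2 x, x \in r & exists g, gact g x = z &
    forall x x' g, x \in r -> x' \in r -> gact g x = x' -> x = x'].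
  exists r; split=> //; split=> // y.
  have [z /rZcov[x xr [g gx]] [h hz]] := Zall y.
  by exists x => //; exists (h * g)%g; rewrite gactM gx.
elim: Z {Zall} => [|z Z [r [ur rZ cov sep]]]; first by exists [::].
have [[x xr [g gx]]|nz] := pselect (exists2 x, x \in r & exists g, gact g x = z).
  exists r; split=> // [y /rZ yZ|y]; first by rewrite inE yZ orbT.
  by rewrite inE => /predU1P[->|/cov//]; exists x => //; exists g.
exists (z :: r); split.
- rewrite /= ur andbT; apply/negP => zr; apply: nz; exists z => //.
  by exists 1%g; rewrite gact1.
- by move=> y; rewrite !inE => /predU1P[->|/rZ ->]; rewrite ?eqxx ?orbT.
- move=> y; rewrite inE => /predU1P[->|/cov[x xr xy]].
    by exists z; [exact: mem_head|exists 1%g; rewrite gact1].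
  by exists x => //; rewrite inE xr orbT.
- move=> x x' g; rewrite !inE => /predU1P[->|xr] /predU1P[->|x'r] gx //.
  + by exfalso; apply: nz; exists x' => //; exists g^-1%g; rewrite -gx gactK.
  + by exfalso; apply: nz; exists x => //; exists g.
  + exact: sep gx.
Qed.

Section SeqGSet.
Variables (G : groupType) (Y : gSetType G).

Definition seq_act (g : G) (s : seq Y) : seq Y := map (gact g) s.

Fact seq_act1 s : seq_act 1%g s = s.
Proof. by rewrite -[RHS]map_id; apply: eq_map => y; exact: gact1. Qed.

Fact seq_actM g h s : seq_act (g * h)%g s = seq_act g (seq_act h s).
Proof. by rewrite /seq_act -map_comp; apply: eq_map => y; exact: gactM. Qed.

HB.instance Definition _ := isGSet.Build G (seq Y) seq_act1 seq_actM.

Lemma stab_cons (y : Y) (s : seq Y) : stab (y :: s) = stab y `&` stab s.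
Proof.
apply/seteqP; split=> g [gy gs]; first by split.
exact: (f_equal2 cons gy gs).
Qed.

End SeqGSet.

Section SubGSet.
Variables (G : groupType) (Y : gSetType G) (X : set Y).
Hypothesis XG : forall g y, X y -> X (gact g y).

Definition sub_act (g : G) (x : X) : X :=
  exist (fun y => y \in X) (gact g (val x)) (mem_set (XG g (set_mem (valP x)))).

Fact sub_act1 x : sub_act 1%g x = x.
Proof. by apply: val_inj; rewrite /= gact1. Qed.

Fact sub_actM g h x : sub_act (g * h)%g x = sub_act g (sub_act h x).
Proof. by apply: val_inj; rewrite /= gactM. Qed.

Definition sub_gset : gSetType G :=
  HB.pack_for (gSetType G) (set_type X) (isGSet.Build G (set_type X) sub_act1 sub_actM).

Definition sub_val (x : sub_gset) : Y := \val (x : set_type X).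

Lemma sub_valP x : X (sub_val x).
Proof. exact: set_mem (valP (x : set_type X)). Qed.

Lemma sub_val_inj : injective sub_val.
Proof. exact: val_inj. Qed.

Lemma sub_val_act g x : sub_val (gact g x) = gact g (sub_val x).
Proof. by []. Qed.

Lemma stab_sub_val x : stab (sub_val x) = stab x.
Proof.
apply/seteqP; split=> g; rewrite /stab /= -sub_val_act; last by move=> ->.
exact: sub_val_inj.
Qed.

Lemma sub_valE y : X y -> exists x, sub_val x = y.
Proof. by move=> Xy; exists (exist (fun y => y \in X) y (mem_set Xy)). Qed.

(** Chain arguments take place in one free module containing all degrees; inclusion and projection
    connect it with the permutation module of a single degree. *)
Definition sub_incl : ghom {malg rat[sub_gset]} {malg rat[Y]} :=
  perm_ghom (h := fun x => delta (sub_val x) : {malg rat[Y]})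
    (fun g x => esym (gact_delta g (sub_val x))).

Definition sub_proj_fun (y : Y) : {malg rat[sub_gset]} :=
  if pselect (exists x, sub_val x = y) is left e then delta (sval (cid e)) else 0.

Lemma sub_proj_val x : sub_proj_fun (sub_val x) = delta x.
Proof.
rewrite /sub_proj_fun; case: pselect => [e|[]]; last by exists x.
by case: cid => x' /= /sub_val_inj ->.
Qed.

Lemma sub_proj0 y : ~ X y -> sub_proj_fun y = 0.
Proof.
move=> nX; rewrite /sub_proj_fun; case: pselect => // e.
by exfalso; apply: nX; case: e => x <-; exact: sub_valP.
Qed.

Fact sub_proj_act g y : sub_proj_fun (gact g y) = gact g (sub_proj_fun y).
Proof.
have [Xy|nXy] := pselect (X y).
  have [x <-] := sub_valE Xy.
  by rewrite -sub_val_act !sub_proj_val gact_delta.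
rewrite !sub_proj0 ?linear0 // => Xgy; apply: nXy.
by rewrite -(gactK g y); exact: XG.
Qed.

Definition sub_proj : ghom {malg rat[Y]} {malg rat[sub_gset]} :=
  perm_ghom sub_proj_act.

Lemma sub_inclK c : sub_proj (sub_incl c) = c.
Proof.
apply: (malg_ind_linear (f := malg_ext sub_proj_fun \o malg_ext (fun x => delta (sub_val x)))
  (g := idfun)) => x /=.
by rewrite !malg_ext_delta sub_proj_val.
Qed.

Lemma sub_projK c : chain_in X c -> sub_incl (sub_proj c) = c.
Proof.
move=> Xc; apply: (etrans (malg_ext_comp (malg_ext (fun x => delta (sub_val x))) sub_proj_fun c)).
rewrite -[RHS]malg_ext_id; apply: (malg_ext_eq Xc) => y Xy /=.
have [x <-] := sub_valE Xy.
by rewrite sub_proj_val malg_ext_delta.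
Qed.

Lemma sub_incl_in c : chain_in X (sub_incl c).
Proof.
apply: (@chain_in_ext _ _ setT) => // x _; apply: chain_in_delta; exact: sub_valP.
Qed.

End SubGSet.

Section BoundaryGhom.
Variables (G : groupType) (Y : gSetType G).

Fact bd_seq_act g (s : seq Y) : bd_seq (gact g s) = gact g (bd_seq s).
Proof. exact/esym/(push_bd_seq (gact g)). Qed.

Definition bd_ghom : ghom {malg rat[seq Y]} {malg rat[seq Y]} :=
  perm_ghom bd_seq_act.

End BoundaryGhom.

Section FlagResolution.
Variables (G : topGroupType) (V : gSetType G) (S : simplicial_complex V) (d : nat).
Hypothesis S_dim : forall s, simplex S s -> (#|` s| <= d.+1)%N.
Hypothesis G_acts : acts_on S.
Hypothesis S_stab : forall s : {fset V}, simplex S s -> CO G (stab s).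
Hypothesis S_ex : exists t, simplex S t.
Hypothesis flag_acyclic : forall z : {malg rat[seq {fset V}]}, chain_in (flag S) z ->
  bd z = 0 -> exists y, chain_in (flag S) y /\ bd y = z.

Definition flag_dim k : set (seq {fset V}) := [set s | flag S s /\ size s = k.+1].

Lemma fproper_act (g : G) (a b : {fset V}) :
  (a `<` b)%fset -> (gact g a `<` gact g b)%fset.
Proof.
have sub (h : G) (x y : {fset V}) : (x `<=` y)%fset -> (gact h x `<=` gact h y)%fset.
  move=> xy; apply/fsubsetP => _ /imfsetP[v /= vx ->]; apply: in_imfset.
  exact: (fsubsetP xy).
move=> ab; rewrite fproperE; apply/andP; split; first exact: sub (fproper_sub ab).
apply/negP => gba.
have := sub g^-1%g _ _ gba; rewrite !gactK => ba; by have := fproper_sub_trans ab ba; rewrite fproperEneq eqxx.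
Qed.

Lemma flag_act (g : G) s : flag S s -> flag S (gact g s).
Proof.
elim: s => // t s IH /flag_consP[St fs st]; apply/flag_consP; split.
- exact: G_acts.
- exact: IH.
- by move=> _ /mapP[u us ->]; apply: fproper_act; exact: st.
Qed.

Fact flag_dim_act k (g : G) s : flag_dim k s -> flag_dim k (gact g s).
Proof. by move=> [fs ss]; split; [exact: flag_act|rewrite size_map]. Qed.

Definition flag_gset k : gSetType G := sub_gset (@flag_dim_act k).

Lemma open_stab_flag s : flag S s -> open (stab s).
Proof.
elim: s => [_|t s IH /flag_consP[St fs _]].
  rewrite (_ : stab [::] = setT); first exact: openT.
  by apply/seteqP; split.
rewrite stab_cons; apply: openI; first exact: (CO_open (S_stab St)).
exact: IH.
Qed.

Lemma CO_stab_flag k (y : flag_gset k) : CO G (stab y).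
Proof.
rewrite -stab_sub_val; have := sub_valP y.
case: (sub_val y) => [|t s] [] // /flag_consP[St fs _] _.
rewrite stab_cons; apply: CO_setI; first exact: S_stab.
  exact: is_subgroup_stab.
exact: open_stab_flag.
Qed.

Definition flag_mod k : disModType G := perm_mod (CO_discrete (@CO_stab_flag k)).

Let incl k : ghom (flag_mod k) {malg rat[seq {fset V}]} := sub_incl (@flag_dim_act k).
Let proj k : ghom {malg rat[seq {fset V}]} (flag_mod k) := sub_proj (@flag_dim_act k).
Let bdG := bd_ghom [the gSetType G of {fset V}].

Let incl_inj k : injective (incl k).
Proof. by move=> x y /(congr1 (proj k)); rewrite /incl /proj !sub_inclK. Qed.

Definition flag_d k : ghom (flag_mod k.+1) (flag_mod k) :=
  comp_ghom (proj k) (comp_ghom bdG (incl k.+1)).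

Let flag_dE k x : flag_d k x = proj k (bdG (incl k.+1 x)).
Proof. by []. Qed.

Let bd_flag_in k (x : flag_mod k.+1) : chain_in (flag_dim k) (bdG (incl k.+1 x)).
Proof.
suff bdk s : flag_dim k.+1 s -> chain_in (flag_dim k) (bd_seq s).
  exact: (chain_in_ext (@sub_incl_in _ _ _ (@flag_dim_act k.+1) x) bdk).
move=> [fs ss] u /bd_seq_in[us su]; split; first exact: flag_subseq us.
by move: su; rewrite ss => -[].
Qed.

Let incl_d k x : incl k (flag_d k x) = bdG (incl k.+1 x).
Proof. by apply: sub_projK; exact: bd_flag_in. Qed.

Let bd_bdG c : bdG (bdG c) = 0.
Proof. exact: bd_bd. Qed.

(** A filling supplied by [flag_acyclic] may have parts in every degree. As [bd] shortens tuples by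
    one, only the part of size k+2 contributes in degree k, and the rest can be discarded. *)
Let proj_bd k c : chain_in (flag S) c ->
  proj k (bdG (incl k.+1 (proj k.+1 c))) = proj k (bdG c).
Proof.
move=> fc.
pose g : {linear {malg rat[flag_gset k.+1]} -> {malg rat[flag_gset k]}} :=
  proj k \o bdG \o incl k.+1.
have E1 := malg_ext_comp g (sub_proj_fun (@flag_dim_act k.+1)) c.
have E2 := malg_ext_comp (proj k) (@bd_seq _) c.
apply: (etrans E1); apply/esym; apply: (etrans E2); apply/esym.
apply: (malg_ext_eq fc) => s fs.
have [ss|ss] := eqVneq (size s) k.+2.
  have [x <-] := @sub_valE _ _ _ (@flag_dim_act k.+1) s (conj fs ss).
  rewrite /= sub_proj_val; congr (proj k _).
  apply: (etrans (congr1 bdG (malg_ext_delta _ _))); exact: malg_ext_delta.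
rewrite /= sub_proj0 => [|[_ /eqP]]; last by rewrite (negPf ss).
apply: (etrans (linear0 g)); apply/esym.
apply: (etrans (@malg_ext_eq _ _ _ _ (fun=> 0) _ (@bd_seq_in _ s) _)).
  move=> u [_ su]; apply: sub_proj0 => -[_ ku].
  by move: ss; rewrite -su ku eqxx.
exact: malg_ext0.
Qed.

Lemma flag_exact k x : flag_d k x = 0 <-> exists y, flag_d k.+1 y = x.
Proof.
split=> [dx|[y <-]]; last first.
  apply: (@incl_inj k); rewrite incl_d incl_d bd_bdG.
  exact/esym/ghom0.
have bx : bd (incl k.+1 x) = 0.
  by apply: (etrans (esym (incl_d x))); rewrite dx; exact: ghom0.
have fx : chain_in (flag S) (incl k.+1 x).
  have sub : flag_dim k.+1 `<=` flag S by move=> s [].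
  exact: (chain_in_sub sub (@sub_incl_in _ _ _ (@flag_dim_act k.+1) x)).
have [w [fw bw]] := flag_acyclic fx bx; exists (proj k.+2 w).
have E : flag_d k.+1 (proj k.+2 w) = proj k.+1 (bdG w).
  by rewrite flag_dE; exact: (proj_bd k.+1 fw).
have bw' : bdG w = incl k.+1 x := bw.
rewrite E bw'; exact: sub_inclK.
Qed.

Definition flag_aug : ghom (flag_mod 0) (trivQ G) :=
  perm_ghom (Y := flag_gset 0) (M := trivQ G) (h := fun=> 1) (fun _ _ => erefl).

(** The augmentation is the boundary into degree -1, spanned by the empty tuple, so exactness in
    degree 0 is again acyclicity of the augmented complex. *)
Let flag_augE x : bdG (incl 0 x) = (flag_aug x : rat) *: delta [::].
Proof.
apply: (etrans (malg_ext_comp bdG (fun y => delta (sub_val y)) x)).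
apply: (etrans (@malg_ext_eq _ _ setT _ (fun=> delta [::]) _ _ _)) => //.
  move=> y _; apply: (etrans (malg_ext_delta _ _)).
  have [_] := sub_valP y; case: (sub_val y) => [|t []] // _.
  by rewrite /= linear0 subr0.
rewrite /malg_ext -scaler_suml; congr (_ *: _).
by apply: eq_bigr => y _; rewrite /GRing.scale /= mulr1.
Qed.

Lemma flag_exact0 x : flag_aug x = 0 <-> exists y, flag_d 0 y = x.
Proof.
have augN0 a : a *: delta [::] = 0 :> {malg rat[seq {fset V}]} -> a = 0.
  by move=> /malgP/(_ [::]); rewrite fgscaleE mcoeffUU mcoeff0 mulr1.
split=> [ax|[y <-]]; last first.
  by apply: augN0; rewrite -flag_augE incl_d bd_bdG.
have bx : bd (incl 0 x) = 0 by apply: (etrans (flag_augE x)); rewrite ax scale0r.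
have fx : chain_in (flag S) (incl 0 x).
  have sub : flag_dim 0 `<=` flag S by move=> s [].
  exact: (chain_in_sub sub (@sub_incl_in _ _ _ (@flag_dim_act 0) x)).
have [w [fw bw]] := flag_acyclic fx bx; exists (proj 1 w).
have E : flag_d 0 (proj 1 w) = proj 0 (bdG w).
  by rewrite flag_dE; exact: (proj_bd 0 fw).
have bw' : bdG w = incl 0 x := bw.
rewrite E bw'; exact: sub_inclK.
Qed.

Lemma flag_aug_onto : onto flag_aug.
Proof.
move=> q; have [t St] := S_ex.
have [|y _] := @sub_valE _ _ _ (@flag_dim_act 0) [:: t].
  by split=> //; apply/flag_consP; split=> //; split.
exists (q *: (delta y : {malg rat[flag_gset 0]})).
apply: (etrans (linearZZ flag_aug q _)).
apply: (etrans (congr1 (fun x : trivQ G => q *: x) (malg_ext_delta _ y))).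
exact: mulr1.
Qed.

Lemma flag_size s : flag S s -> (size s <= #|` head fset0 s|)%N.
Proof.
elim: s => // t s IH /flag_consP[St fs st]; case: s IH fs st => [|u s] IH fs st.
  by rewrite cardfs_gt0; exact: simplex_neq0 St.
by apply: (leq_ltn_trans (IH fs)); apply: fproper_ltn_card; apply: st; rewrite mem_head.
Qed.

Lemma flag_mod_zero k (x : flag_mod k) : (d < k)%N -> x = 0.
Proof.
move=> dk; apply/malgP => y; exfalso.
have [fs ss] := sub_valP y; have := flag_size fs.
case: (sub_val y) fs ss => // t s /flag_consP[St _ _] -> /= kt.
by have := leq_trans kt (S_dim St); rewrite ltnS leqNgt dk.
Qed.

Hypothesis flag_reps : forall k, (k <= d)%N ->
  exists r : seq (flag_gset k), orbit_system r.

Fact flag_mod_proj k : (k <= d)%N -> fin_gen (flag_mod k) /\ projective (flag_mod k).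
Proof.
move=> /flag_reps[r sr]; split; last exact: perm_projective.
exact: perm_fin_gen sr.
Qed.

Definition flag_resolution : FP_resolution G :=
  @FPResolution G d flag_mod flag_d flag_aug flag_mod_proj flag_mod_zero
    flag_aug_onto flag_exact0 flag_exact.

End FlagResolution.

(** * Counting flags *)

Section FlagCount.
Variable V : choiceType.
Implicit Types (w t : {fset V}) (s : seq {fset V}).

Definition proper_faces w : seq {fset V} :=
  [seq t <- fpowerset w | (t != w) && (t != fset0)].

Lemma in_proper_faces w t :
  (t \in proper_faces w) = (t `<` w)%fset && (t != fset0).
Proof.
by rewrite mem_filter fpowersetE fproperEneq andbAC.
Qed.

Fixpoint flags_under k w : seq (seq {fset V}) :=
  if k is k'.+1 then [seq w :: s | t <- proper_faces w, s <- flags_under k' t]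
  else [:: [:: w]].

Lemma flags_under_head k w s : s \in flags_under k w -> head fset0 s = w.
Proof.
by case: k => [|k] /=; [rewrite inE => /eqP ->|move=> /allpairsPdep[t [u [_ _ ->]]]].
Qed.

Lemma flags_under_uniq k w : uniq (flags_under k w).
Proof.
elim: k w => // k IH w; apply: allpairs_uniq_dep.
- by rewrite filter_uniq ?fset_uniq.
- by move=> t _; exact: IH.
- move=> [t s] [t' s'] /allpairsPdep[t1 [s1 [_ s1t e1]]] /allpairsPdep[t2 [s2 [_ s2t e2]]] /= [ss].
  have [-> ss1] : t = t1 /\ s = s1.
    by split; [exact: (congr1 tag e1)|exact: (congr1 (fun p : {_ : {fset V} & seq {fset V}} => projT2 p) e1)].
  have [-> ss2] : t' = t2 /\ s' = s2.
    by split; [exact: (congr1 tag e2)|exact: (congr1 (fun p : {_ : {fset V} & seq {fset V}} => projT2 p) e2)].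
  have -> : t1 = t2.
    by rewrite -(flags_under_head s1t) -(flags_under_head s2t) -ss1 -ss2 ss.
  by rewrite ss.
Qed.

Lemma mem_flags_under (S : simplicial_complex V) k w s : simplex S w ->
  s \in flags_under k w <-> [/\ flag S s, size s = k.+1 & head fset0 s = w].
Proof.
move=> Sw; elim: k w s Sw => [|k IH] w s Sw /=.
  rewrite inE; split=> [/eqP ->|[fs ss hs]].
    by split=> //; apply/flag_consP; split=> //; split.
  by case: s fs ss hs => [|t []] //= _ _ ->.
have Sface t : t \in proper_faces w -> simplex S t.
  rewrite in_proper_faces => /andP[/fproper_sub tw t0].
  exact: simplex_sub tw t0.
split=> [/allpairsPdep[t [u [tw ut ->]]]|].
  have [fu su hu] := (IH t u (Sface _ tw)).1 ut.
  split=> //=; last by rewrite su.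
  apply/flag_consP; split=> // o ou; move: tw; rewrite in_proper_faces => /andP[tw _].
  by apply: fsub_proper_trans tw; rewrite -hu; exact: (flag_head fu).
case: s => [|w' [|t s]] [] //= /flag_consP[_ fs st] [ss] w'w; rewrite w'w in st *.
have tw : t \in proper_faces w.
  rewrite in_proper_faces st ?mem_head //=.
  by have [St _ _] := (flag_consP _ _ _).1 fs; exact: simplex_neq0 St.
apply/allpairsPdep; exists t, (t :: s); split=> //.
by apply/(IH _ _ (Sface _ tw)); split=> //=; rewrite ss.
Qed.

Section Alternating.
Variable R : numDomainType.

(** Adding or removing a fixed vertex v of w is an involution of the power set that changes every
    sign. *)
Lemma alternating_powerset w : w != fset0 ->
  \sum_(t <- fpowerset w) (-1) ^+ #|` t| = 0 :> R.
Proof.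
move=> /fset0Pn[v vw].
pose f t := if v \in t then (t `\ v)%fset else (v |` t)%fset.
have fK : involutive f.
  move=> t; rewrite /f; case: (boolP (v \in t)) => vt.
    by rewrite !inE eqxx /= fsetD1K.
  by rewrite !inE eqxx /= fsetU1K.
have fw t : t \in fpowerset w -> f t \in fpowerset w.
  rewrite !fpowersetE /f => tw; case: ifP => _; last by rewrite fsubUset tw fsub1set vw.
  exact: fsubset_trans (fsubD1set _ _) tw.
have perm : perm_eq (fpowerset w) (map f (fpowerset w)).
  apply: uniq_perm; rewrite ?map_inj_uniq ?fset_uniq //; first exact: (can_inj fK).
  move=> t; apply/idP/mapP => [tw|[t' t'w ->]]; last exact: fw.
  by exists (f t); [exact: fw|rewrite fK].
set s := \sum_(_ <- _) _; have : s = - s.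
  rewrite {1}/s (perm_big _ perm) big_map /s -sumrN; apply: eq_bigr => t _.
  rewrite /f; case: (boolP (v \in t)) => vt.
    by rewrite (cardfsD1 v t) vt add1n exprS mulN1r opprK.
  by rewrite cardfsU1 vt add1n exprS mulN1r.
move=> /eqP; rewrite -addr_eq0 -mulr2n mulrn_eq0 /= => /eqP.
by [].
Qed.

Lemma alternating_proper_faces w : w != fset0 ->
  1 + \sum_(t <- proper_faces w) (-1) ^+ #|` t| = - (-1) ^+ #|` w| :> R.
Proof.
move=> w0; have := alternating_powerset w0.
rewrite (big_fsetD1 w) ?fpowersetE ?fsubset_refl //=.
rewrite (big_fsetD1 fset0) /=; last by rewrite !inE eq_sym w0 fpowersetE fsub0set.
rewrite ?cardfs0 ?expr0.
have -> : \sum_(t <- ((fpowerset w `\ w) `\ fset0)%fset) (-1) ^+ #|` t| =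
    \sum_(t <- proper_faces w) (-1) ^+ #|` t| :> R.
  apply: perm_big; apply: uniq_perm; rewrite ?fset_uniq ?filter_uniq ?fset_uniq //.
  by move=> t; rewrite !inE mem_filter andbA [(t != fset0) && _]andbC.
by move=> /eqP; rewrite addr_eq0 => /eqP ->; rewrite opprK.
Qed.

(** Deleting the top w leaves a flag under a proper face, so the signed count is 1 minus the sum of
    the counts of the proper faces; induction reduces it to [alternating_proper_faces]. The value is
    (-1)^(dim w). *)
Lemma flags_under_alternating d w : w != fset0 -> (#|` w| <= d.+1)%N ->
  \sum_(0 <= k < d.+1) (-1) ^+ k * (size (flags_under k w))%:R =
  - (-1) ^+ #|` w| :> R.
Proof.
elim: d w => [|d IH] w w0 wd.
  rewrite big_nat1 expr0 mul1r; have -> : #|` w| = 1%N.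
    by apply/eqP; rewrite eqn_leq wd cardfs_gt0 w0.
  by rewrite expr1 opprK.
rewrite big_nat_recl // expr0 mul1r -(alternating_proper_faces w0); congr (1 + _).
transitivity (\sum_(0 <= k < d.+1) \sum_(t <- proper_faces w)
    - ((-1) ^+ k * (size (flags_under k t))%:R : R)).
  apply: eq_bigr => k _; rewrite [size _]size_allpairs_dep sumnE big_map natr_sum.
  by rewrite mulr_sumr; apply: eq_bigr => t _; rewrite exprS mulN1r mulNr.
rewrite exchange_big /= big_seq [RHS]big_seq; apply: eq_bigr => t.
rewrite in_proper_faces => /andP[tw t0]; rewrite sumrN IH ?opprK //.
by rewrite -ltnS; apply: leq_trans wd; exact: fproper_ltn_card.
Qed.

End Alternating.
End FlagCount.

(** * From orbits of flags to orbits of simplices *)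

Section OrbitCount.
Variables (R : realType) (G : topGroupType) (O : set G).
Variable mu : {measure set (borel G) -> \bar R}.
Hypotheses (CO_O : CO G O) (hmu : left_haar mu) (muO : mu O = 1%E).
Variables (Y T : gSetType G) (p : Y -> T) (Z : set Y) (r : seq Y).
Hypothesis CO_Y : forall y : Y, CO G (stab y).
Hypothesis pG : forall g y, p (gact g y) = gact g (p y).
Hypothesis CO_p : forall y, CO G (stab (p y)).
Hypothesis Zfin : finite_set Z.
Hypothesis Zorb : forall z g, Z z -> Z (gact g z) <-> gact g (p z) = p z.
Hypotheses (ur : uniq r) (rZ : forall x, x \in r -> Z x) (sr : orbit_system r).

(* Orbit-stabiliser: the part of the orbit of [x] that meets [Z] is in bijection
   with the cosets of [stab x] in [stab (p x)]. *)
Lemma orbit_count :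
  \sum_(x <- r) (vol mu (stab x))^-1 = \sum_(z \in Z) (vol mu (stab (p z)))^-1.
Proof.
have [rex rsep] := sr.
have h_ex y : exists x, x \in r /\ exists g, gact g x = y.
  by have [x xr xy] := rex y; exists x.
have [h hP] := choice h_ex.
have hE x g : x \in r -> h (gact g x) = x.
  move=> xr; have [hr [k kx]] := hP (gact g x).
  by apply: (rsep _ _ (g^-1 * k)%g) => //; rewrite gactM kx gactK.
rewrite (fsbig_fibers h) //.
have -> : h @` Z = [set` r].
  apply/seteqP; split=> [_ [z _ <-]|x xr]; first by have [] := hP z.
  by exists x; [exact: rZ|rewrite -[x in LHS]gact1 hE].
rewrite -fsbig_seq //; apply: eq_big_seq => x xr.
have sxp : stab x `<=` stab (p x) by move=> g gx; rewrite /stab /= -pG gx.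
have [sx _ ox] := CO_Y x; have [spx _ _] := CO_p x.
have bij : set_bij (cosets_in (stab (p x)) (stab x)) (Z `&` h @^-1` [set x])
    (fun B => gact (xget 1%g B) x).
  split.
  - move=> B UB; have [Ub _] := cosets_in_rep spx sx sxp UB; split.
      by apply/Zorb; [exact: rZ|exact: Ub].
    by rewrite /= hE.
  - move=> B B' /set_mem UB /set_mem UB' E.
    have [_ <-] := cosets_in_rep spx sx sxp UB.
    have [_ <-] := cosets_in_rep spx sx sxp UB'.
    by apply/ltrans_eqP => //; rewrite /stab /= gactM -E gactK.
  - move=> z [Zz /= hz]; have [_ [g]] := hP z; rewrite hz => gz.
    have gp : stab (p x) g by apply/(Zorb g (rZ xr)); rewrite gz.
    exists (ltrans g (stab x)); first by exists g.
    by have [u ux ->] := ltrans_xgetM g sx; rewrite gactM ux.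
rewrite (reindex_fsbig _ _ _ _ bij).
transitivity (\sum_(B \in cosets_in (stab (p x)) (stab x)) (vol mu (stab (p x)))^-1).
  have Uf := CO_finite (CO_p x) sx ox.
  rewrite fsbig_finite // big_const_seq count_predT iter_addr addr0 -mulr_natl.
  rewrite (vol_cindex hmu CO_O muO (CO_p x) sx ox sxp).
  have := vol_gt0 hmu CO_O muO (CO_p x); have := vol_gt0 hmu CO_O muO (CO_Y x).
  by move=> /gt_eqF a /gt_eqF b; field; rewrite a b.
apply: eq_fsbigr => B /set_mem UB; have [Ub _] := cosets_in_rep spx sx sxp UB.
by rewrite pG Ub.
Qed.

End OrbitCount.

Section FlagRank.
Variables (R : realType) (G : topGroupType) (O : set G).
Variable mu : {measure set (borel G) -> \bar R}.
Hypotheses (uG : unimodular R G) (CO_O : CO G O).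
Hypotheses (hmu : left_haar mu) (muO : mu O = 1%E).
Variables (V : gSetType G) (S : simplicial_complex V) (d : nat).
Hypothesis S_dim : forall s, simplex S s -> (#|` s| <= d.+1)%N.
Hypothesis G_acts : acts_on S.
Hypothesis S_stab : forall s : {fset V}, simplex S s -> CO G (stab s).
Variable Omega : nat -> set {fset V}.
Hypothesis Omega_reps : forall k, (k <= d)%N ->
  orbit_reps G (simplices S k) (Omega k).
Hypothesis Omega_fin : forall k, (k <= d)%N -> finite_set (Omega k).

Definition rep_simplices : seq {fset V} :=
  [seq w | j <- iota 0 d.+1, w <- fset_set (Omega j)].

Lemma mem_rep_simplices w :
  w \in rep_simplices <-> exists2 j, (j <= d)%N & Omega j w.
Proof.
split=> [/allpairsPdep[j [x [jd xj ->]]]|[j jd wj]].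
  rewrite mem_iota /= add0n ltnS in jd; exists j => //.
  by move: xj; rewrite in_fset_set ?inE //; exact: Omega_fin.
apply/allpairsPdep; exists j, w; rewrite mem_iota /= add0n ltnS; split=> //.
by rewrite in_fset_set ?inE //; exact: Omega_fin.
Qed.

Lemma Omega_simplex j w : (j <= d)%N -> Omega j w -> simplex S w /\ #|` w| = j.+1.
Proof. by move=> /Omega_reps[sub _] /sub. Qed.

Lemma rep_simplices_uniq : uniq rep_simplices.
Proof.
apply: allpairs_uniq_dep; first exact: iota_uniq.
  by move=> j _; exact: fset_uniq.
move=> [j w] [j' w'] /allpairsPdep[j1 [w1 [j1d w1j e1]]].
move=> /allpairsPdep[j2 [w2 [j2d w2j e2]]] /= ww'.
have [-> ww1] : j = j1 /\ w = w1.
  by split; [exact: (congr1 tag e1)|exact: (congr1 (fun p : {_ : nat & {fset V}} => projT2 p) e1)].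
have [-> ww2] : j' = j2 /\ w' = w2.
  by split; [exact: (congr1 tag e2)|exact: (congr1 (fun p : {_ : nat & {fset V}} => projT2 p) e2)].
rewrite mem_iota /= add0n ltnS in j1d; rewrite mem_iota /= add0n ltnS in j2d.
have O1 : Omega j1 w1 by move: w1j; rewrite in_fset_set ?inE //; exact: Omega_fin.
have O2 : Omega j2 w2 by move: w2j; rewrite in_fset_set ?inE //; exact: Omega_fin.
have [_ c1] := Omega_simplex j1d O1; have [_ c2] := Omega_simplex j2d O2.
have -> : j1 = j2.
  by apply/eqP; rewrite -eqSS -c1 -c2 -ww1 -ww2 ww'.
by rewrite ww'.
Qed.

Lemma rep_simplices_simplex w : w \in rep_simplices -> simplex S w.
Proof. by move=> /mem_rep_simplices[j jd /(Omega_simplex jd)[]]. Qed.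

Lemma card_act (g : G) (s : {fset V}) : #|` gact g s| = #|` s|.
Proof.
by rewrite card_imfset // => x y /(congr1 (gact g^-1%g)); rewrite !gactK.
Qed.

(** Provides the condition [Zorb] of [orbit_count]: an element taking a flag with representative top
    to another such flag stabilises the top. *)
Lemma rep_simplices_act g w : w \in rep_simplices ->
  gact g w \in rep_simplices <-> gact g w = w.
Proof.
move=> wr; split=> [gwr|-> //].
have /mem_rep_simplices[j jd wj] := wr; have /mem_rep_simplices[j' jd' gwj] := gwr.
have [Sw cw] := Omega_simplex jd wj; have [Sgw cgw] := Omega_simplex jd' gwj.
have jj' : j' = j by apply/eqP; rewrite -eqSS -cw -cgw card_act.
rewrite jj' in gwj; have [_ reps] := Omega_reps jd.
have [|u [_ uniq_u]] := reps (gact g w); first by split; rewrite // card_act.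
rewrite -(uniq_u (gact g w)); last by split=> //; exists 1%g; rewrite gact1.
by apply: uniq_u; split=> //; exists g.
Qed.

Lemma rep_simplices_cover t : simplex S t ->
  exists2 w, w \in rep_simplices & exists g, gact g w = t.
Proof.
move=> St; have ct : #|` t| = #|` t|.-1.+1.
  by rewrite prednK // cardfs_gt0; exact: simplex_neq0 St.
have jd : (#|` t|.-1 <= d)%N by rewrite -ltnS -ct; exact: S_dim.
have [_ reps] := Omega_reps jd; have [|w [[wO wt] _]] := reps t; first by split.
by exists w => //; apply/mem_rep_simplices; exists #|` t|.-1.
Qed.

Section Dim.
Variable k : nat.

Let Y := flag_gset G_acts k.
Let top (y : Y) : {fset V} := head fset0 (sub_val y).
Let Z : set Y := [set y | top y \in rep_simplices].

Let top_simplex y : simplex S (top y).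
Proof.
have := sub_valP y; rewrite /top; case: (sub_val y) => [|t s] [] //.
by move=> /flag_consP[].
Qed.

Let top_act g y : top (gact g y) = gact g (top y).
Proof.
have := sub_valP y; rewrite /top sub_val_act.
by case: (sub_val y) => [|t s] [].
Qed.

Definition rep_flags : seq (seq {fset V}) :=
  [seq s | w <- rep_simplices, s <- flags_under k w].

Lemma rep_flags_uniq : uniq rep_flags.
Proof.
apply: allpairs_uniq_dep; first exact: rep_simplices_uniq.
  by move=> w _; exact: flags_under_uniq.
move=> [w s] [w' s'] /allpairsPdep[w1 [s1 [_ sw1 e1]]].
move=> /allpairsPdep[w2 [s2 [_ sw2 e2]]] /= ss'.
have [-> ss1] : w = w1 /\ s = s1.
  by split; [exact: (congr1 tag e1)|exact: (congr1 (fun p : {_ : {fset V} & seq {fset V}} => projT2 p) e1)].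
have [-> ss2] : w' = w2 /\ s' = s2.
  by split; [exact: (congr1 tag e2)|exact: (congr1 (fun p : {_ : {fset V} & seq {fset V}} => projT2 p) e2)].
have -> : w1 = w2.
  by rewrite -(flags_under_head sw1) -(flags_under_head sw2) -ss1 -ss2 ss'.
by rewrite ss'.
Qed.

Let imZ : (@sub_val _ _ _ (@flag_dim_act _ _ _ G_acts k)) @` Z = [set` rep_flags].
Proof.
apply/seteqP; split=> [_ [y yZ <-]|s /allpairsPdep[w [s' [wr sw ->]]]].
  apply/allpairsPdep; exists (top y), (sub_val y); split=> //.
  have [fy sy] := sub_valP y.
  by apply/(mem_flags_under k _ (top_simplex y)); split.
have [fs ss hs] := (mem_flags_under k s' (rep_simplices_simplex wr)).1 sw.
have [y yE] := @sub_valE _ _ _ (@flag_dim_act _ _ _ G_acts k) s' (conj fs ss).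
by exists y => //; rewrite /Z /= /top yE hs.
Qed.

Let Zfin : finite_set Z.
Proof.
have inj : set_inj Z (@sub_val _ _ _ (@flag_dim_act _ _ _ G_acts k)).
  by move=> x y _ _; exact: sub_val_inj.
rewrite -(eq_finite_set (inj_card_eq inj)) imZ.
exact: finite_seq.
Qed.

Let Zorb z g : Z z -> Z (gact g z) <-> gact g (top z) = top z.
Proof. by move=> Zz; rewrite /Z /= top_act; exact: rep_simplices_act. Qed.

Let Zcover y : exists2 z, Z z & exists g, gact g z = y.
Proof.
have [w wr [g gw]] := rep_simplices_cover (top_simplex y).
exists (gact g^-1%g y); last by exists g; rewrite gactVK.
by rewrite /Z /= top_act -gw gactK.
Qed.

Lemma flag_orbit_system : exists r : seq Y, [/\ uniq r, orbit_system r &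
  \sum_(x <- r) (vol mu (stab x))^-1 =
  \sum_(w <- rep_simplices) (size (flags_under k w))%:R / vol mu (stab w)].
Proof.
have [y|r [ur rZ sr]] := @orbit_system_ex G Y (fset_set Z).
  have [z Zz zy] := Zcover y; exists z => //.
  by rewrite in_fset_set // inE.
have rZ' x : x \in r -> Z x by move=> /rZ; rewrite in_fset_set // inE.
exists r; split=> //.
have CO_top y : CO G (stab (top y)) by exact: S_stab (top_simplex y).
rewrite (orbit_count CO_O hmu muO (@CO_stab_flag _ _ _ G_acts S_stab k) top_act
  CO_top Zfin Zorb ur rZ' sr).
pose c (s : seq {fset V}) := (vol mu (stab (head fset0 s)))^-1.
transitivity (\sum_(s <- rep_flags) c s).
  rewrite [RHS](fsbig_seq _ _ rep_flags_uniq) -imZ fsbig_image //.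
  by move=> x y _ _; exact: sub_val_inj.
rewrite big_allpairs_dep; apply: eq_bigr => w _.
rewrite big_seq (eq_bigr (fun=> (vol mu (stab w))^-1)); last first.
  by move=> s /flags_under_head; rewrite /c => ->.
rewrite -big_seq big_const_seq count_predT iter_addr addr0.
by rewrite mulr_natl.
Qed.

End Dim.

Hypothesis S_ex : exists t, simplex S t.
Hypothesis flag_acyclic : forall z : {malg rat[seq {fset V}]}, chain_in (flag S) z ->
  bd z = 0 -> exists y, chain_in (flag S) y /\ bd y = z.

Lemma flag_reps k : (k <= d)%N -> exists r : seq (flag_gset G_acts k), orbit_system r.
Proof. by move=> _; have [r [_ sr _]] := flag_orbit_system k; exists r. Qed.

Lemma flag_rank k : HS_rank O mu (flag_mod G_acts S_stab k) =
  (\sum_(w <- rep_simplices) (size (flags_under k w))%:R / vol mu (stab w)) *: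
    haar_vec mu.
Proof.
have [r [ur sr <-]] := flag_orbit_system k.
have xs := @perm_xi _ _ (@CO_stab_flag _ _ _ G_acts S_stab k) r ur sr.
apply: (etrans (HS_rankE uG CO_O hmu muO xs)); congr (_ *: _).
rewrite (perm_tr _ r CO_O hmu muO) rmorph_sum; apply: eq_bigr => x _ /=.
rewrite (ratr_gindex hmu CO_O muO) //; last exact: CO_stab_flag.
by rewrite {1}/vol muO div1r.
Qed.

Lemma flag_euler : type_FP G /\ euler_char O mu =
  \sum_(0 <= j < d.+1) (-1) ^+ j *:
    \sum_(w \in Omega j) (vol mu (stab w))^-1 *: haar_vec mu.
Proof.
pose res := flag_resolution S_dim S_stab S_ex flag_acyclic flag_reps.
split; first by exists res.
rewrite (euler_charE uG CO_O hmu muO res).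
transitivity (\sum_(0 <= k < d.+1) (-1) ^+ k *: ((\sum_(w <- rep_simplices)
    (size (flags_under k w))%:R / vol mu (stab w)) *: haar_vec mu)).
  by apply: eq_bigr => k _; congr (_ *: _); exact: flag_rank.
(* Exchanging the sums isolates, for each w, the signed number of flags with top w; its sign is
   (-1)^j for w in [Omega j], as w then has j+1 vertices. *)
transitivity ((\sum_(w <- rep_simplices) - (-1) ^+ #|` w| / vol mu (stab w))
    *: haar_vec mu).
  under eq_bigr do rewrite scalerA.
  rewrite -scaler_suml; congr (_ *: _).
  under eq_bigr do rewrite mulr_sumr.
  rewrite exchange_big big_seq [RHS]big_seq; apply: eq_bigr => w wr.
  have Sw := rep_simplices_simplex wr.
  rewrite -(flags_under_alternating R (simplex_neq0 Sw) (S_dim Sw)) mulr_suml.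
  by apply: eq_bigr => k _; rewrite mulrA.
rewrite big_allpairs_dep scaler_suml -[iota 0 d.+1]/(index_iota 0 d.+1).
rewrite [LHS]big_nat_cond [RHS]big_nat_cond; apply: eq_bigr => j /andP[/andP[_ jd] _].
rewrite ltnS in jd; have Oj := Omega_fin jd.
rewrite fsbig_finite // scaler_sumr scaler_suml big_seq [RHS]big_seq.
apply: eq_bigr => w; rewrite in_fset_set // => /set_mem wj.
have [_ ->] := Omega_simplex jd wj.
by rewrite scalerA exprS mulN1r opprK.
Qed.

End FlagRank.

Theorem theoremB (R : realType) (G : topGroupType)
  (G_tdlc : tdlc G) (G_unimodular : unimodular R G)
  (* mu U is the Haar measure mu_U; O is the subgroup fixed to define tr *)
  (mu : set G -> {measure set (borel G) -> \bar R})
  (mu_haar : forall U : set G, CO G U -> left_haar (mu U) /\ mu U U = 1%E)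
  (O : set G) (O_CO : CO G O)
  (V : gSetType G) (S : simplicial_complex V) (d : nat)
  (S_dim : dimension S d)
  (G_acts : acts_on S)
  (S_stab : forall s : {fset V}, simplex S s -> CO G [set g : G | gact g s = s])
  (Omega : nat -> set {fset V})
  (Omega_reps : forall k, (k <= d)%N ->
     orbit_reps G (simplices S k) (Omega k))
  (Omega_fin : forall k, (k <= d)%N -> finite_set (Omega k))
  (S_contractible : contractible R (realization R S)) :
  type_FP G /\
  euler_char O (mu O) =
    \sum_(0 <= k < d.+1) (-1) ^+ k *:
      (\sum_(w \in Omega k) (1 *: haar_vec (mu (stab_pm G w)))).
Proof.
have [[hG _ tG] [[t0 [St0 _]] dimS]] := (G_tdlc, S_dim).
have S_ex : exists t, simplex S t by exists t0.
have [hO muO] := mu_haar O O_CO.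
have acyc := flag_acyclic S_ex (@ordered_acyclic R V S S_contractible).
have [FP ->] := flag_euler G_unimodular O_CO hO muO dimS G_acts S_stab
  Omega_reps Omega_fin S_ex acyc.
split=> //; rewrite [LHS]big_nat_cond [RHS]big_nat_cond.
apply: eq_bigr => k /andP[/andP[_ kd] _]; congr (_ *: _).
apply: eq_fsbigr => w /set_mem wk.
have [Sw _] := (Omega_reps k kd).1 w wk.
have [hw muw] := mu_haar _ (S_stab w Sw).
(* The Haar measure normalised on G_w is that of O divided by its value on G_w, which is the weight
   produced by the flag count. *)
rewrite scale1r stab_pmE; apply/esym.
exact: (haar_vec_unique hG tG O_CO (S_stab w Sw) hO hw muO muw).
Qed.
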